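(* Let $N\ge3$, let $\Omega\subset\mathbb{R}^N$ be a bounded domain with $\partial\Omega\in C^2$, let $\lambda>0$ and $\varepsilon>0$, and let $J_\varepsilon$ (depending also on $\lambda$ and $\kappa$) be the functional defined in the context. Given $M>0$, set $$\kappa^\ast=\left[\frac{S^{N/2}}{N(M+|\Omega|)}\right]^{\frac{2}{N-2}},$$ where $S$ is the best Sobolev constant defined in the context. If $0<\kappa<\kappa^\ast$, then $J_\varepsilon$ satisfies the $(\mathrm{PS})_c$ condition for all $c\le M$.
   Context: Here $2^\ast=2N/(N-2)$, $t_+=\max\{t,0\}$, $|\Omega|$ is the Lebesgue measure of $\Omega$, and $$S=\inf_{u\in H^1_0(\Omega)\setminus\{0\}}\frac{\int_\Omega|\nabla u|^2dx}{\left(\int_\Omega|u|^{2^\ast}dx\right)^{2/2^\ast}}.$$ The functional is $$J_\varepsilon(u)=\int_\Omega\left[\tfrac12|\nabla u|^2+\mathcal{B}\left(\frac{u-1}{\varepsilon}\right)-\tfrac{\lambda}{2}(u-1)_+^2-\tfrac{\kappa}{2^\ast}(u-1)_+^{2^\ast}\right]dx,\quad u\in H^1_0(\Omega),$$ where $\mathcal{B}(t)=\int_0^t\beta(s)\,ds$ and $\beta:\mathbb{R}\to[0,2]$ is a fixed smooth function with $\beta(t)=0$ for $t\le0$, $\beta(t)>0$ for $0<t<1$, $\beta(t)=0$ for $t\ge1$, and $\int_0^1\beta(s)\,ds=1$. $J_\varepsilon$ is of class $C^1$. For $c\in\mathbb{R}$, $J_\varepsilon$ satisfies the $(\mathrm{PS})_c$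 condition if every sequence $(u_j)\subset H^1_0(\Omega)$ such that $J_\varepsilon(u_j)\to c$ and $J_\varepsilon'(u_j)\to0$ (in the dual of $H^1_0(\Omega)$) has a subsequence converging in $H^1_0(\Omega)$. *)

(* Defs.v *)
From HB Require Import structures.
From mathcomp Require Import all_boot all_order all_algebra.
From mathcomp Require Import all_classical all_reals all_analysis.

Set Implicit Arguments.
Unset Strict Implicit.
Unset Printing Implicit Defensive.

Import Order.TTheory GRing.Theory Num.Theory.
Import numFieldNormedType.Exports.

Local Open Scope classical_set_scope.
Local Open Scope ring_scope.

(* The product sigma-algebra on R^n, i.e. its Borel sigma-algebra. *)
Definition row_display : measure_display -> measure_display.
Proof. exact. Qed.

Section row_measurable.
Context {d : measure_display} {T : measurableType d} {n : nat}.

Definition row_coord (i : 'I_n) (x : 'rV[T]_n) : T := x 0 i.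

Let row_set0 : g_sigma_preimage row_coord set0.
Proof. exact: sigma_algebra0. Qed.

Let row_setC A : g_sigma_preimage row_coord A -> g_sigma_preimage row_coord (~` A).
Proof. exact: sigma_algebraC. Qed.

Let row_bigcup (F : (set 'rV[T]_n)^nat) : (forall i, g_sigma_preimage row_coord (F i)) ->
  g_sigma_preimage row_coord (\bigcup_i (F i)).
Proof. exact: sigma_algebra_bigcup. Qed.

HB.instance Definition _ := @isMeasurable.Build (row_display d)
  'rV[T]_n (g_sigma_preimage row_coord) row_set0 row_setC row_bigcup.

End row_measurable.

Section lebesgue_row.
Context {R : realType}.

Definition row_cons n (p : R * 'rV[R]_n) : 'rV[R]_n.+1 :=
  \row_i (if unlift ord0 i is Some j then p.2 0 j else p.1).

Lemma measurable_row_coord n (i : 'I_n) :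
  measurable_fun [set: 'rV[R]_n] (@row_coord _ R n i).
Proof.
move=> _ Y mY; rewrite setTI; apply: sub_sigma_algebra => /=.
rewrite -bigcup_seq/=; exists i => /=; first by rewrite mem_index_enum.
by exists Y => //; rewrite setTI.
Qed.

Lemma measurable_row d (T : measurableType d) n (f : T -> 'rV[R]_n) :
  (forall i, measurable_fun setT (@row_coord _ R n i \o f)) ->
  measurable_fun [set: T] f.
Proof.
move=> mf.
suff pf : g_sigma_preimage (fun i => @row_coord _ R n i \o f) `<=` measurable.
  move: pf; rewrite g_sigma_preimage_comp => pf _ A mA.
  by apply: pf; exists A.
apply: smallest_sub; first exact: sigma_algebra_measurable.
case: n => [|n] in f mf *; first by rewrite big_ord0.
by rewrite -bigcup_mkord_ord; apply: bigcup_sub => i Ii A [B mB <-]; exact: mf.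
Qed.

Lemma measurable_row_cons n : measurable_fun setT (@row_cons n).
Proof.
apply: measurable_row => i; case: (unliftP ord0 i) => [j ->|->].
  rewrite (_ : _ \o _ = row_coord j \o snd); last first.
    by apply/funext => p; rewrite /= /row_coord mxE liftK.
  by apply: measurableT_comp => //; exact: measurable_row_coord.
rewrite (_ : _ \o _ = fst) //.
by apply/funext => p; rewrite /= /row_coord mxE unlift_none.
Qed.

Section lebesgue_step.
Local Open Scope ereal_scope.
Context {n : nat} (m : {sigma_finite_measure set 'rV[R]_n -> \bar R}).

Definition lebesgue_step : set 'rV[R]_n.+1 -> \bar R :=
  pushforward (lebesgue_measure \x m) (@row_cons n).

Let step0 : lebesgue_step set0 = 0.
Proof. by rewrite /lebesgue_step /pushforward preimage_set0 measure0. Qed.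

Let step_ge0 A : 0 <= lebesgue_step A.
Proof.
by apply: integral_ge0 => x _; exact: measure_ge0.
Qed.

Let step_sigma_additive : semi_sigma_additive lebesgue_step.
Proof.
move=> F mF tF mUF; rewrite /lebesgue_step /pushforward preimage_bigcup.
apply: measure_semi_sigma_additive.
- by move=> k; rewrite -[X in measurable X]setTI; exact: measurable_row_cons.
- apply/trivIsetP => /= i j _ _ ij; rewrite -preimage_setI.
  by move/trivIsetP : tF => /(_ _ _ _ _ ij) ->//; rewrite preimage_set0.
- rewrite -preimage_bigcup -[X in measurable X]setTI.
  exact: measurable_row_cons.
Qed.

HB.instance Definition _ := isMeasure.Build _ _ _ lebesgue_step
  step0 step_ge0 step_sigma_additive.

(* The library's instance of this fact on products is not found by inference. *)
Let prod_sigma_finite : sigma_finite setT (lebesgue_measure \x m).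
Proof.
have /sigma_finiteP[F [TF ndF Foo]] := sigma_finiteT (@lebesgue_measure R).
have /sigma_finiteP[G [TG ndG Goo]] := sigma_finiteT m.
exists (fun k => F k `*` G k).
  rewrite -setXTT TF TG predeqE => -[x y]; split.
    move=> [/= [k _ Fkx] [l _ Gly]]; exists (maxn k l) => //; split.
    - by move: x Fkx; exact/subsetPset/ndF/leq_maxl.
    - by move: y Gly; exact/subsetPset/ndG/leq_maxr.
  by move=> [k _ []/= ? ?]; split; exists k.
move=> k; have [? ?] := Foo k; have [? ?] := Goo k.
split; first exact: measurableX.
by rewrite product_measure1E// lte_mul_pinfty// ge0_fin_numE.
Qed.

Let step_sigma_finite : sigma_finite setT lebesgue_step.
Proof.
have [F TF Foo] := prod_sigma_finite.
pose uncons (x : 'rV[R]_n.+1) : R * 'rV[R]_n :=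
  (row_coord ord0 x, \row_j row_coord (lift ord0 j) x).
have mu : measurable_fun setT uncons.
  apply: measurable_fun_pair => /=; first exact: measurable_row_coord.
  apply: measurable_row => j.
  rewrite (_ : _ \o _ = row_coord (lift ord0 j)).
    exact: measurable_row_coord.
  by apply/funext => x; rewrite /= /row_coord mxE.
have uncK : cancel (@row_cons n) uncons.
  move=> [x y]; rewrite /uncons /row_cons /row_coord mxE unlift_none; congr pair.
  by apply/rowP => j; rewrite !mxE liftK.
exists (fun k => uncons @^-1` F k).
  by rewrite -preimage_bigcup -TF preimage_setT.
move=> k; have [mFk Fk] := Foo k; split.
  by rewrite -[X in measurable X]setTI; exact: mu.
rewrite /lebesgue_step /pushforward (_ : _ @^-1` _ = F k)//.
by apply/seteqP; split => p /=; rewrite uncK.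
Qed.

HB.instance Definition _ := Measure_isSigmaFinite.Build _ _ _ lebesgue_step
  step_sigma_finite.

End lebesgue_step.

Fixpoint lebesgue_row (n : nat) : {sigma_finite_measure set 'rV[R]_n -> \bar R} :=
  match n with
  | 0 => @dirac _ 'rV[R]_0 0 R
  | n'.+1 => lebesgue_step (lebesgue_row n')
  end.

Lemma lebesgue_row_box n (B : 'I_n -> set R) : (forall i, measurable (B i)) ->
  lebesgue_row n [set x | forall i, B i (x 0 i)] =
  (\prod_(i < n) lebesgue_measure (B i))%E.
Proof.
elim: n B => [|n IH] B mB.
  rewrite big_ord0 /= diracE mem_set//= => -[] //.
rewrite big_ord_recl -IH//.
transitivity ((lebesgue_measure \x lebesgue_row n)%E
    (B ord0 `*` [set y : 'rV[R]_n | forall i, B (lift ord0 i) (y 0 i)])).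
  congr (product_measure1 _ _ _).
  apply/seteqP; split => -[x y] /=.
    move=> H; split=> [|i].
      by have := H ord0; rewrite mxE unlift_none.
    by have := H (lift ord0 i); rewrite mxE liftK.
  case=> Hx Hy i; rewrite mxE.
  by case: unliftP => [j ->|->].
rewrite product_measure1E//; first exact: mB.
rewrite (_ : [set y | _] = \big[setI/setT]_(i < n)
    (@row_coord _ R n i @^-1` B (lift ord0 i))); last first.
  apply/seteqP; split => y /=.
    by move=> H; rewrite -bigcap_seq => i _; exact: H.
  by move=> H i; move: H; rewrite -bigcap_seq => /(_ i); apply; rewrite /= mem_index_enum.
apply: bigsetI_measurable => i _; rewrite -[X in measurable X]setTI.
exact: measurable_row_coord.
Qed.

End lebesgue_row.

Section smoothness.
Context {R : realType} {n : nat}.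
Implicit Types (f : 'rV[R]_n -> R) (Omega : set 'rV[R]_n).

Definition partial (i : 'I_n) f (x : 'rV[R]_n) : R := 'D_(delta_mx 0 i) f x.

Definition iter_partial (s : seq 'I_n) f : 'rV[R]_n -> R := foldr partial f s.

Definition is_Ck (k : nat) f := forall s : seq 'I_n,
  ((size s <= k)%N -> continuous (iter_partial s f)) /\
  ((size s < k)%N -> forall i x, derivable (iter_partial s f) x (delta_mx 0 i)).

Definition test_function Omega f :=
  [/\ forall k, is_Ck k f,
      compact (closure [set x | f x != 0]) &
      closure [set x | f x != 0] `<=` Omega].

Definition bounded_domain Omega :=
  [/\ open Omega, connected Omega, Omega !=set0 & bounded_set Omega].

End smoothness.

(* Near each boundary point, after relabelling and possibly reversing a
   coordinate axis, Omega is the strict epigraph of a C^2 function of the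
   remaining n - 1 coordinates. *)
Definition C2_boundary {R : realType} {n : nat} (Omega : set 'rV[R]_n) :=
  forall x0, (closure Omega `\` interior Omega) x0 ->
  exists (i : 'I_n) (flip : bool) (gamma : 'rV[R]_n.-1 -> R),
    is_Ck 2 gamma /\
    \forall x \near x0, Omega x <-> gamma (col' i x) < (-1) ^+ flip * x 0 i.

Section sobolev.
Context {R : realType} {n : nat} (Omega : set 'rV[R]_n).
Local Notation mu := (@lebesgue_row R n).
Local Notation fn := ('rV[R]_n -> R).
Implicit Types (u v : fn) (G : 'rV[R]_n -> 'rV[R]_n).

Definition L2 u :=
  measurable_fun Omega u /\ mu.-integrable Omega (fun x => (u x ^+ 2)%:E).

Definition weak_gradient u G :=
  (forall i, L2 (fun x => G x 0 i)) /\
  forall i phi, test_function Omega phi ->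
    \int[mu]_(x in Omega) (u x * partial i phi x) =
    - \int[mu]_(x in Omega) (G x 0 i * phi x).

Definition H1 u := L2 u /\ exists G, weak_gradient u G.

(* Functions stand for their classes modulo equality a.e. in Omega; for u in
   H^1(Omega) the weak gradient is unique up to such equality, and [grad u] is
   one of its representatives. *)
Definition grad u := xget (fun=> 0) [set G | weak_gradient u G].

Definition sqr_grad u (x : 'rV[R]_n) : R := \sum_(i < n) (grad u x 0 i) ^+ 2.

Definition H1_norm u : R :=
  Num.sqrt (\int[mu]_(x in Omega) (u x ^+ 2) + \int[mu]_(x in Omega) sqr_grad u x).

(* The closure of the test functions in H^1(Omega). *)
Definition H10 u := H1 u /\
  exists phi : nat -> fn, (forall k, test_function Omega (phi k)) /\
    H1_norm (u \- phi k) @[k --> \oo] --> (0 : R).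

Definition crit_exp : R := 2 * n%:R / (n%:R - 2).

Definition sobolev_const : R :=
  inf [set (\int[mu]_(x in Omega) sqr_grad u x) /
           (\int[mu]_(x in Omega) (`|u x| `^ crit_exp)) `^ (2 / crit_exp)
      | u in [set u | H10 u /\ ~ {ae mu, forall x, Omega x -> u x = 0}]].

Definition bounded_linear_H10 (l : fn -> R) :=
  (forall (a : R) u v, H10 u -> H10 v ->
     l (fun x => a * u x + v x) = a * l u + l v) /\
  exists C : R, forall v, H10 v -> `|l v| <= C * H1_norm v.

Definition dual_norm (l : fn -> R) : R :=
  sup [set `|l v| | v in [set v | H10 v /\ H1_norm v <= 1]].

(* [l] is only constrained on H^1_0(Omega), where it is unique. *)
Definition is_frechet_derivative (J : fn -> R) u (l : fn -> R) :=
  bounded_linear_H10 l /\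
  forall e : R, 0 < e -> exists2 d : R, 0 < d &
    forall v, H10 v -> H1_norm v < d ->
      `|J (u \+ v) - J u - l v| <= e * H1_norm v.

Definition palais_smale (J : fn -> R) (c : R) :=
  forall (u : nat -> fn) (dJ : nat -> fn -> R),
    (forall j, H10 (u j)) ->
    J (u j) @[j --> \oo] --> c ->
    (forall j, is_frechet_derivative J (u j) (dJ j)) ->
    dual_norm (dJ j) @[j --> \oo] --> (0 : R) ->
  exists (sigma : nat -> nat) (v : fn),
    [/\ forall j, (sigma j < sigma j.+1)%N, H10 v &
        H1_norm (u (sigma j) \- v) @[j --> \oo] --> (0 : R)].

End sobolev.

Section functional.
Context {R : realType}.

Definition smooth_bump (beta : R -> R) :=
  [/\ forall k t, derivable (derive1n k beta) t 1,
      forall t, 0 <= beta t <= 2,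
      forall t, t <= 0 \/ 1 <= t -> beta t = 0,
      forall t, 0 < t < 1 -> 0 < beta t &
      \int[lebesgue_measure]_(s in `[0, 1]) beta s = 1].

(* The oriented integral of beta from 0 to t. *)
Definition primitive0 (beta : R -> R) (t : R) : R :=
  \int[lebesgue_measure]_(s in `[0, t]) beta s -
  \int[lebesgue_measure]_(s in `[t, 0]) beta s.

Definition J_functional {n : nat} (Omega : set 'rV[R]_n) (beta : R -> R)
    (lambda kappa epsilon : R) (u : 'rV[R]_n -> R) : R :=
  \int[@lebesgue_row R n]_(x in Omega)
    (2^-1 * sqr_grad Omega u x
     + primitive0 beta ((u x - 1) / epsilon)
     - lambda / 2 * Num.max (u x - 1) 0 ^+ 2
     - kappa / @crit_exp R n * Num.max (u x - 1) 0 `^ @crit_exp R n).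

Definition kappa_star {n : nat} (Omega : set 'rV[R]_n) (M : R) : R :=
  (sobolev_const Omega `^ (n%:R / 2) /
     (n%:R * (M + fine (@lebesgue_row R n Omega)))) `^ (2 / (n%:R - 2)).

End functional.

(* Main.v *)
Require Import Defs.
From mathcomp Require Import all_boot all_order all_algebra.
From mathcomp Require Import all_classical all_reals all_analysis.
From mathcomp Require Import measurable_realfun ring lra.

Set Implicit Arguments.
Unset Strict Implicit.
Unset Printing Implicit Defensive.

Import Order.TTheory GRing.Theory Num.Theory.
Import numFieldNormedType.Exports.

Local Open Scope classical_set_scope.
Local Open Scope ring_scope.

(* Along a Palais-Smale sequence u_j, testing J'(u_j) with a smooth version of
   (u_j - 1)_+ and subtracting half of the result from J(u_j) bounds
   (kappa/N) int (u_j - 1)_+^p by c + |Omega| + o(1), where p = 2^*: the terms in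
   beta and B cost at most |Omega|. Hence u_j is bounded, and a subsequence
   converges in L^2 (Rellich) to some u in H^1_0. Set w_j = u_j - u and
   X_j = int |grad w_j|^2. Testing with w_j gives
     X_j = kappa int (u_j - 1)_+^{p-1} w_j + o(1),
   and the last integral is bounded, up to o(1) and factors arbitrarily close
   to 1, both by int (u_j - 1)_+^p, so that X_j <= N (M + |Omega|) + o(1), and by
   int |w_j|^p <= (X_j/S)^{p/2}. Since kappa < kappa^*, these two bounds force
   X_j -> 0. *)

(** * Square-integrable functions *)

(** The hypothesis [kappa < kappa_star Omega M] is used twice. It forces S > 0, because for S = 0
    the number [kappa_star] vanishes; the Sobolev inequality and the integrability of |u|^p are then
    read off the definition of S as an infimum. It also closes the final estimate: X <= kappa
    (X/S)^{p/2} + o(1) forces X to 0 as long as kappa/S (X/S)^{2/(N-2)} stays below a constant less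
    than 1, and at X = N (M + |Omega|) the inequality kappa/S (X/S)^{2/(N-2)} < 1 is the condition
    on kappa. Weak convergence in H^1_0 never appears as such. That the L^2 limit u lies in H^1_0 is
    obtained by minimising Dirichlet integrals, and the cross term int grad u . grad w_j tends to 0
    by integration by parts against test functions. Pointwise convergence of u_j is avoided too. To
    bound int (u_j - 1)_+^{p-1} w_j, the points are split by comparing (u_j - 1)_+ with w_j up to a
    factor theta > 1; where the comparison fails, both are at most C (1 + |u|) with u fixed, and
    convergence of w_j in L^1 is enough. *)

Definition rintegrable d (T : measurableType d) (R : realType)
    (mu : {measure set T -> \bar R}) (D : set T) (f : T -> R) :=
  mu.-integrable D (EFin \o f).

Definition square_integrable d (T : measurableType d) (R : realType)
    (mu : {measure set T -> \bar R}) (D : set T) (f : T -> R) :=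
  measurable_fun D f /\ rintegrable mu D (fun x => f x ^+ 2).

Section real_integrals.
Context d (T : measurableType d) (R : realType).
Variables (mu : {measure set T -> \bar R}) (D : set T).
Hypothesis mD : measurable D.
Implicit Types f g h : T -> R.
Local Notation itg := (rintegrable mu D).
Local Notation I f := (\int[mu]_(x in D) f x).

Lemma rintegrable_measurable f : itg f -> measurable_fun D f.
Proof. by move=> /measurable_int /measurable_EFinP. Qed.

Lemma rintegrable_le f g : measurable_fun D f ->
  (forall x, D x -> `|f x| <= g x) -> itg g -> itg f.
Proof.
move=> mf fg; apply: le_integrable => //; first exact/measurable_EFinP.
by move=> x Dx; rewrite /= lee_fin (le_trans (fg x Dx))// ler_norm.
Qed.

Lemma rintegrableD f g : itg f -> itg g -> itg (fun x => f x + g x).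
Proof. by move=> hf hg; exact: (integrableD mD hf hg). Qed.

Lemma rintegrableB f g : itg f -> itg g -> itg (fun x => f x - g x).
Proof. by move=> hf hg; exact: (integrableB mD hf hg). Qed.

Lemma rintegrableZ k f : itg f -> itg (fun x => k * f x).
Proof. by move=> hf; exact: (integrableZl mD k hf). Qed.

Lemma rintegrableN f : itg f -> itg (fun x => - f x).
Proof.
by move=> /(rintegrableZ (-1)); apply: eq_integrable => // x _ /=; rewrite mulN1r.
Qed.

Lemma rintegrable_norm f : itg f -> itg (fun x => `|f x|).
Proof. by move=> hf; exact: (integrable_norm hf). Qed.

Lemma rintegrable_sum (J : Type) (s : seq J) (F : J -> T -> R) :
  (forall j, itg (F j)) -> itg (fun x => \sum_(j <- s) F j x).
Proof.
move=> hF; rewrite /rintegrable.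
rewrite (_ : _ \o _ = fun x => (\sum_(j <- s) (EFin \o F j) x)%E); last first.
  by apply/funext => x /=; rewrite sumEFin.
by apply: integrable_sum => // j _; exact: hF.
Qed.

Lemma eq_rintegrable f g : (forall x, D x -> f x = g x) -> itg f -> itg g.
Proof.
by move=> fg; apply: eq_integrable => // x /set_mem Dx /=; rewrite fg.
Qed.

Lemma ae_eq_rint f g : measurable_fun D f -> measurable_fun D g ->
  {ae mu, forall x, D x -> f x = g x} -> I f = I g.
Proof.
move=> mf mg fg; congr fine; apply: ae_eq_integral => //.
- exact/measurable_EFinP.
- exact/measurable_EFinP.
- by apply: filterS fg => x h Dx; rewrite h.
Qed.

Lemma rint_sum (J : Type) (s : seq J) (F : J -> T -> R) :
  (forall j, itg (F j)) ->
  I (fun x => \sum_(j <- s) F j x) = \sum_(j <- s) I (F j).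
Proof.
move=> hF; elim: s => [|j s IH].
  rewrite big_nil (_ : (fun _ => _) = cst 0); last first.
    by apply/funext => x; rewrite big_nil.
  by rewrite Rintegral_cst// mul0r.
rewrite big_cons -IH -RintegralD//; last exact: rintegrable_sum.
  by apply: eq_Rintegral => x _; rewrite big_cons.
exact: hF.
Qed.

(** The functions f 1_{f > k} tend to 0 pointwise and are dominated by f. Later arguments split a
    domain where a fixed integrable function is below or above [K], and this lemma makes the second
    part negligible. *)
Lemma tail_small f e : itg f -> (forall x, D x -> 0 <= f x) -> 0 < e ->
  exists2 K : R, 0 < K & I (fun x => f x * (K < f x)%R%:R) < e.
Proof.
move=> hf f0 e0.
have mf := rintegrable_measurable hf.
have mk k : measurable_fun D (fun x => f x * (k%:R < f x)%R%:R).
  apply: measurable_funM => //.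
  rewrite (_ : (fun _ => _) = (fun b : bool => b%:R : R) \o (fun x => k%:R < f x)) //.
  apply: measurableT_comp => //.
  by apply: measurable_fun_ltr.
have f_cvg x : D x -> (EFin \o (fun x => f x * (k%:R < f x)%R%:R)) x @[k --> \oo] --> (0%E : \bar R).
  move=> Dx; apply: cvg_EFin; first exact: nearW.
  apply: cvg_near_cst; near=> k.
  rewrite /= ltNge (_ : f x <= k%:R) ?mulr0//.
  by near: k; exact: nbhs_infty_ger.
have [||_ _ ] := @dominated_convergence _ _ _ mu D mD
  (fun k => EFin \o (fun x => f x * (k%:R < f x)%R%:R)) (cst 0%E) (EFin \o f)
  (fun k => proj2 (measurable_EFinP _ _) (mk k)) (measurable_cst _) _ hf.
- by apply: nearW.
- apply: nearW => x k Dx; rewrite /= lee_fin ger0_norm ?mulr_ge0 ?f0//.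
  by case: (_ < _); rewrite ?mulr1 ?mulr0 ?f0.
rewrite integral0 => /fine_cvgP[_] /cvgrPdist_lt/(_ _ e0)[n _ hn].
(* [n.+1] rather than [n], since the threshold has to be positive. *)
exists n.+1%:R => //; have /= := hn n.+1 (leqnSn n).
by rewrite sub0r normrN; apply: le_lt_trans; exact: ler_norm.
Unshelve. all: by end_near. Qed.

End real_integrals.

(** The discriminant criterion with degenerate leading coefficients included; both Cauchy-Schwarz
    inequalities, for L^2 and for the Dirichlet form, come from it. *)
Lemma nonneg_quadratic (R : realType) (a b c : R) :
  (forall t, 0 <= a + 2 * t * b + t ^+ 2 * c) -> b ^+ 2 <= a * c.
Proof.
move=> h.
have a0 : 0 <= a by have := h 0; rewrite mulr0 mul0r expr0n mul0r !addr0.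
have [c0|c0|c0] := ltgtP c 0.
(* For c < 0, adding the values at x + 1 and -(x + 1) removes the linear term and leaves c ((x +
   1)^2 - x) >= 0, although (x + 1)^2 > x. *)
- exfalso; pose x := a / - c.
  have x0 : 0 <= x by rewrite divr_ge0// oppr_ge0 ltW.
  have ea : a = - (x * c) by rewrite /x; field; rewrite lt_eqF.
  have := h (x + 1); have := h (- (x + 1)); rewrite sqrrN ea => h1 h2.
  have : 0 <= c * ((x + 1) ^+ 2 - x) by move: h1 h2; set s := (x + 1) ^+ 2; lra.
  by rewrite nmulr_rge0//; nra.
- have := h (- b / c); rewrite (_ : _ + _ = (a * c - b ^+ 2) / c); last first.
    by field; rewrite gt_eqF.
  by rewrite pmulr_lge0 ?invr_gt0// subr_ge0.
- rewrite c0 mulr0; have [->|b0] := eqVneq b 0; first by rewrite expr0n.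
  (* At this point the affine function a + 2 t b takes the value -1. *)
  have := h (- (a + 1) / (2 * b)); rewrite c0 mulr0 addr0.
  rewrite (_ : 2 * _ * b = - (a + 1)); first by lra.
  by field.
Qed.

Lemma sqrt_triangle (R : realType) (a b c : R) : 0 <= a -> 0 <= c -> b ^+ 2 <= a * c ->
  Num.sqrt (a + 2 * b + c) <= Num.sqrt a + Num.sqrt c.
Proof.
move=> a0 c0 h.
have hb : `|b| <= Num.sqrt a * Num.sqrt c.
  by rewrite -sqrtrM// -sqrtr_sqr ler_wsqrtr.
rewrite -(@ger0_norm _ (Num.sqrt a + _)) ?addr_ge0 ?sqrtr_ge0// -sqrtr_sqr ler_wsqrtr//.
rewrite sqrrD !sqr_sqrtr//; have := ler_norm b; lra.
Qed.

Section square_integrals.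
Context d (T : measurableType d) (R : realType).
Variables (mu : {measure set T -> \bar R}) (D : set T).
Hypothesis mD : measurable D.
Implicit Types f g h : T -> R.
Local Notation itg := (rintegrable mu D).
Local Notation sq := (square_integrable mu D).
Local Notation I f := (\int[mu]_(x in D) f x).

Lemma rintegrableM f g : sq f -> sq g -> itg (fun x => f x * g x).
Proof.
move=> [mf hf] [mg hg]; apply: (rintegrable_le mD _ _ (rintegrableD mD hf hg)).
  exact: measurable_funM.
by move=> x _; rewrite normrM; have := normr_ge0 (f x); have := normr_ge0 (g x);
  rewrite -(real_normK (num_real (f x))) -(real_normK (num_real (g x))); nra.
Qed.

Lemma square_integrableZ k f : sq f -> sq (fun x => k * f x).
Proof.
move=> [mf hf]; split; first exact: measurable_funM.
apply: (eq_rintegrable mD _ (rintegrableZ mD (k ^+ 2) hf)) => x _.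
by rewrite exprMn.
Qed.

Lemma square_integrableD f g : sq f -> sq g -> sq (fun x => f x + g x).
Proof.
move=> hf hg; split; first by case: hf; case: hg => *; exact: measurable_funD.
have [_ hf2] := hf; have [_ hg2] := hg.
apply: (eq_rintegrable mD _ (rintegrableD mD (rintegrableD mD hf2
  (rintegrableZ mD 2 (rintegrableM hf hg))) hg2)) => x _; ring.
Qed.

Lemma square_integrableB f g : sq f -> sq g -> sq (fun x => f x - g x).
Proof.
move=> hf /(square_integrableZ (-1)) /(square_integrableD hf).
by rewrite (_ : (fun x => _) = (fun x => f x - g x))//; apply/funext => x; rewrite mulN1r.
Qed.

Lemma square_integrable_le f g : measurable_fun D f ->
  (forall x, D x -> `|f x| <= `|g x|) -> sq g -> sq f.
Proof.
move=> mf fg [mg hg]; split => //; apply: (rintegrable_le mD _ _ hg).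
  exact: measurable_funX.
by move=> x Dx; rewrite normrX -(real_normK (num_real (g x))) lerXn2r ?nnegrE ?fg.
Qed.

Lemma rint_sqr_ge0 f : 0 <= I (fun x => f x ^+ 2).
Proof. by apply: Rintegral_ge0 => x _; exact: sqr_ge0. Qed.

Lemma rint_sqrD f g : sq f -> sq g ->
  I (fun x => (f x + g x) ^+ 2) =
  I (fun x => f x ^+ 2) + 2 * I (fun x => f x * g x) + I (fun x => g x ^+ 2).
Proof.
move=> hf hg; have [_ hf2] := hf; have [_ hg2] := hg; have hfg := rintegrableM hf hg.
rewrite -RintegralZl// -!RintegralD//.
- by apply: eq_Rintegral => x _; ring.
- exact: (rintegrableD mD hf2 (rintegrableZ mD 2 hfg)).
- exact: rintegrableZ.
Qed.

Lemma rint_cauchy_schwarz f g : sq f -> sq g ->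
  I (fun x => f x * g x) ^+ 2 <= I (fun x => f x ^+ 2) * I (fun x => g x ^+ 2).
Proof.
move=> hf hg; apply: nonneg_quadratic => t.
have := rint_sqr_ge0 (fun x => f x + t * g x).
rewrite rint_sqrD//; last exact: square_integrableZ.
rewrite (_ : I (fun x => f x * (t * g x)) = t * I (fun x => f x * g x)).
  rewrite (_ : I (fun x => (t * g x) ^+ 2) = t ^+ 2 * I (fun x => g x ^+ 2)).
    by rewrite !mulrA.
  by rewrite -RintegralZl//; [apply: eq_Rintegral => x _; ring|case: hg].
rewrite -RintegralZl//; first by apply: eq_Rintegral => x _; ring.
exact: rintegrableM.
Qed.

Definition l2norm f : R := Num.sqrt (I (fun x => f x ^+ 2)).

Lemma l2norm_ge0 f : 0 <= l2norm f. Proof. exact: sqrtr_ge0. Qed.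

Lemma l2norm_sqr f : l2norm f ^+ 2 = I (fun x => f x ^+ 2).
Proof. by rewrite sqr_sqrtr// rint_sqr_ge0. Qed.

Lemma l2normD f g : sq f -> sq g -> l2norm (fun x => f x + g x) <= l2norm f + l2norm g.
Proof.
move=> hf hg; rewrite /l2norm rint_sqrD//.
by apply: sqrt_triangle; rewrite ?rint_sqr_ge0// rint_cauchy_schwarz.
Qed.

Lemma l2normN f : l2norm (fun x => - f x) = l2norm f.
Proof. by congr Num.sqrt; apply: eq_Rintegral => x _; rewrite sqrrN. Qed.

Lemma l2normB f g : sq f -> sq g -> l2norm (fun x => f x - g x) <= l2norm f + l2norm g.
Proof.
move=> hf hg; rewrite -(l2normN g); apply: l2normD => //.
rewrite (_ : (fun x => - g x) = (fun x => -1 * g x)); first exact: square_integrableZ.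
by apply/funext => x; rewrite mulN1r.
Qed.

Lemma rint_norm_le f g : sq f -> sq g ->
  `|I (fun x => f x * g x)| <= l2norm f * l2norm g.
Proof.
move=> hf hg; rewrite -sqrtrM ?rint_sqr_ge0// -sqrtr_sqr ler_wsqrtr//.
exact: rint_cauchy_schwarz.
Qed.

End square_integrals.

Section finite_measure.
Context d (T : measurableType d) (R : realType).
Variables (mu : {measure set T -> \bar R}) (D : set T).
Hypotheses (mD : measurable D) (Doo : (mu D < +oo)%E).
Implicit Types f g h : T -> R.
Local Notation itg := (rintegrable mu D).
Local Notation sq := (square_integrable mu D).
Local Notation I f := (\int[mu]_(x in D) f x).

Lemma rintegrable_cst k : itg (fun=> k).
Proof.
rewrite /rintegrable; apply/integrableP; split; first exact/measurable_EFinP.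
rewrite [integral _ _ _](_ : _ = (`|k|%:E * mu D)%E).
  by rewrite lte_mul_pinfty// lee_fin.
by rewrite -(integral_cst mu mD).
Qed.

Lemma rintegrable_bounded f C : measurable_fun D f -> (forall x, D x -> `|f x| <= C) -> itg f.
Proof. by move=> mf fC; apply: (rintegrable_le mD mf fC); exact: rintegrable_cst. Qed.

Lemma square_integrable_bounded f C : measurable_fun D f ->
  (forall x, D x -> `|f x| <= C) -> sq f.
Proof.
move=> mf fC; split => //; apply: (@rintegrable_bounded _ (C ^+ 2)).
  exact: measurable_funX.
by move=> x Dx; rewrite normrX lerXn2r ?nnegrE ?fC// (le_trans _ (fC _ Dx)).
Qed.

Lemma square_integrable_rintegrable f : sq f -> itg f.
Proof.
move=> hf; have h1 : sq (fun=> 1) by apply: (@square_integrable_bounded _ 1) => // x; rewrite normr1.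
by apply: (eq_rintegrable mD _ (rintegrableM mD hf h1)) => x _; rewrite mulr1.
Qed.

Lemma rint_norm_l2norm f : sq f -> I (fun x => `|f x|) <= l2norm mu D f * Num.sqrt (fine (mu D)).
Proof.
move=> hf; have h1 : sq (fun=> 1) by apply: (@square_integrable_bounded _ 1) => // x; rewrite normr1.
have nf : sq (fun x => `|f x|).
  apply: (square_integrable_le mD _ _ hf) => [|x _]; last by rewrite normr_id.
  by apply: measurableT_comp => //; case: hf.
apply: le_trans (ler_norm _) _.
have := rint_norm_le mD nf h1.
rewrite {1}/Rintegral; under eq_integral do rewrite mulr1; move/le_trans; apply.
rewrite /l2norm (_ : I (fun x => `|f x| ^+ 2) = I (fun x => f x ^+ 2)); last first.
  by apply: eq_Rintegral => x _; rewrite real_normK ?num_real.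
by rewrite (_ : I (fun=> 1 ^+ 2) = fine (mu D))// expr1n Rintegral_cst// mul1r.
Qed.

End finite_measure.

(** * Completeness of L^2 *)

Section riesz_fischer.
Context d (T : measurableType d) (R : realType).
Variables (mu : {measure set T -> \bar R}) (D : set T).
Hypothesis mD : measurable D.
Implicit Types f g h : T -> R.
Local Notation sq := (square_integrable mu D).
Local Notation I f := (\int[mu]_(x in D) f x).

Lemma geometric_cauchy (a : nat -> R) (C : R) :
  (forall k, `|a k.+1 - a k| <= C * 2^-1 ^+ k) -> cvgn a.
Proof.
move=> h.
have hs : cvgn (series (fun k => a k.+1 - a k)).
  apply: normed_cvg; apply: (@series_le_cvg _ _ (geometric C 2^-1)).
  - by move=> n /=.
  - by move=> n; rewrite (le_trans _ (h n))/=.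
  - by move=> n; exact: h.
  - by apply: is_cvg_geometric_series; rewrite ger0_norm ?invr_ge0// invf_lt1 ?ltr1n.
have -> : a = (fun k => series (fun k => a k.+1 - a k) k + a 0%N).
  by apply/funext => k; rewrite /series /= telescope_sumr// subrK.
by apply: is_cvgD => //; exact: is_cvg_cst.
Qed.

(** Since 8 = 4 * 2, the weights 4^k leave terms [s k] of integral at most 2^-k. Their sum [g] is
    therefore finite almost everywhere, and there |v_{k+1} - v_k| <= sqrt(g) 2^-k. *)
Lemma riesz_fischer_fast (v : nat -> T -> R) : (forall k, sq (v k)) ->
  (forall k, I (fun x => (v k.+1 x - v k x) ^+ 2) <= 8^-1 ^+ k) ->
  exists2 w : T -> R, measurable_fun D w &
    {ae mu, forall x, D x -> v k x @[k --> \oo] --> w x}.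
Proof.
move=> hv hI.
pose s k x : R := 4 ^+ k * (v k.+1 x - v k x) ^+ 2.
have ms k : measurable_fun D (s k).
  apply: measurable_funM => //; apply: measurable_funX; apply: measurable_funB.
    by case: (hv k.+1).
  by case: (hv k).
have s0 k x : 0 <= s k x by rewrite mulr_ge0 ?sqr_ge0// exprn_ge0.
have sE k : (\int[mu]_(x in D) (s k x)%:E <= (geometric 1 2^-1 k)%:E)%E.
  have hs : rintegrable mu D (s k).
    by apply: rintegrableZ => //; case: (square_integrableB mD (hv k.+1) (hv k)).
  rewrite -(@fineK _ (integral _ _ _)); last exact: integrable_fin_num.
  rewrite lee_fin -/(Rintegral mu D (s k)) RintegralZl//; last first.
    by case: (square_integrableB mD (hv k.+1) (hv k)).
  apply: (le_trans (ler_wpM2l _ (hI k))); first by rewrite exprn_ge0.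
  by rewrite /= -exprMn (_ : 4 * 8^-1 = 2^-1 :> R) ?mul1r//; field.
pose g x := (\sum_(k <oo) (s k x)%:E)%E.
have mg : measurable_fun D g.
  apply: (ge0_emeasurable_sum (P := xpredT)) => [k x _ _|k _].
    by rewrite lee_fin.
  exact/measurable_EFinP.
have g0 x : (0 <= g x)%E by apply: nneseries_ge0 => k _ _; rewrite lee_fin.
have ig : mu.-integrable D g.
  apply/integrableP; split => //.
  under eq_integral do rewrite gee0_abs//.
  rewrite /g integral_nneseries//; last first.
    - by move=> k x _; rewrite lee_fin.
    - by move=> k; exact/measurable_EFinP.
  apply: (@le_lt_trans _ _ 2%:E); last exact: ltry.
  apply: lime_le.
    apply: is_cvg_nneseries => k _ _.
    by apply: integral_ge0 => x _; rewrite lee_fin.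
  apply: nearW => n; apply: (@le_trans _ _ (series (geometric 1 (2^-1 : R)) n)%:E).
    rewrite /series /= -sumEFin; apply: lee_sum => k _; exact: sE.
  rewrite lee_fin; apply: le_trans (geometric_le_lim _ _ _ _) _ => //.
    by rewrite ger0_norm ?invr_ge0// invf_lt1 ?ltr1n.
  by rewrite (_ : 1 * _ = 2)//; field.
have gfin := integrable_ae mD ig.
pose A := [set x | D x /\ (g x < +oo)%E].
have mA : measurable A.
  by rewrite (_ : A = D `&` [set x | (g x < +oo)%E])//; exact: emeasurable_fun_infty_o.
have cvgA x : A x -> cvgn (fun k => v k x).
  move=> [Dx gx]; have gxf : g x \is a fin_num by rewrite ge0_fin_numE.
  apply: (@geometric_cauchy _ (Num.sqrt (fine (g x)))) => k.
  rewrite -(@ger0_norm _ (2^-1 ^+ k)) ?exprn_ge0 ?invr_ge0//.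
  rewrite -(sqrtr_sqr (2^-1 ^+ k)) -sqrtrM; last by rewrite fine_ge0.
  rewrite -sqrtr_sqr ler_wsqrtr// -ler_pdivrMr ?exprn_gt0 ?invr_gt0//.
  rewrite -lee_fin fineK// (le_trans _ (nneseries_lim_ge (m := 0%N) k.+1 _))//; last first.
    by move=> n _ _; rewrite lee_fin.
  rewrite big_nat_recr//= (_ : _ / _ = s k x) ?leeDr//.
    by apply: sume_ge0 => i _; rewrite lee_fin.
  by rewrite /s mulrC -exprM mulnC exprM -exprVn; congr (_ ^+ _ * _); field.
(* With the indicator of [A] the sequence converges at every point of [D], so that its pointwise
   limit is measurable. *)
have mv k : measurable_fun D (fun x => v k x * \1_A x).
  by apply: measurable_funM; [case: (hv k)|exact: measurable_indic].
have hc x : D x -> (fun k => v k x * \1_A x) @ \oo --> limn (fun k => v k x * \1_A x).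
  move=> Dx; rewrite /indic; case: (boolP (x \in A)) => [/set_mem xA|xA].
    have -> : (fun k => v k x * true%:R) = v ^~ x by apply/funext => k; rewrite mulr1.
    exact: cvgA.
  have -> : (fun k => v k x * false%:R) = (fun=> 0) by apply/funext => k; rewrite mulr0.
  exact: is_cvg_cst.
exists (fun x => limn (fun k => v k x * \1_A x)).
  exact: (measurable_fun_cvg mv hc).
apply: filterS gfin => x gx Dx.
have xA : A x by split => //; rewrite -ge0_fin_numE// gx.
have := hc x Dx; rewrite indicE (mem_set xA).
by rewrite [X in X @ _ --> _ -> _](_ : _ = v ^~ x)//; apply/funext => k; rewrite mulr1.
Qed.

(** Fatou's lemma for (v_k - f)^2. Taking for [f] a member of a Cauchy sequence bounds its distance
    to the limit of a subsequence. *)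
Lemma fatou_sqr (v : nat -> T -> R) (w f : T -> R) (e : R) :
  (forall k, sq (v k)) -> measurable_fun D w -> sq f ->
  {ae mu, forall x, D x -> v k x @[k --> \oo] --> w x} ->
  (\forall k \near \oo, I (fun x => (v k x - f x) ^+ 2) <= e) ->
  sq w /\ I (fun x => (w x - f x) ^+ 2) <= e.
Proof.
move=> hv mw hf vw Ie.
have hvf k := square_integrableB mD (hv k) hf.
have [mf _] := hf.
have mwf : measurable_fun D (fun x => (w x - f x) ^+ 2).
  by apply: measurable_funX; exact: measurable_funB.
have mvf k : measurable_fun D (fun x => ((v k x - f x) ^+ 2)%:E).
  by apply/measurable_EFinP; case: (hvf k) => _ /(rintegrable_measurable).
have le1 : (\int[mu]_(x in D) ((w x - f x) ^+ 2)%:E <= e%:E)%E.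
  have -> : (\int[mu]_(x in D) ((w x - f x) ^+ 2)%:E =
    \int[mu]_(x in D) limn_einf (fun k => ((v k x - f x) ^+ 2)%:E))%E.
    apply: ae_eq_integral => //.
    - exact/measurable_EFinP.
    - rewrite (_ : (fun x => _) = (fun x => - limn_esup (fun k =>
          - ((v k x - f x) ^+ 2)%:E))%E); last first.
        by apply/funext => x; rewrite limn_esupN oppeK.
      apply: measurableT_comp => //; apply: measurable_fun_limn_esup => k.
      exact: measurableT_comp.
    - apply: filterS vw => x h Dx.
      suff /cvg_limn_einf_sup[-> _] : ((v k x - f x) ^+ 2)%:E @[k --> \oo] --> ((w x - f x) ^+ 2)%:E by [].
      apply: cvg_EFin; first exact: nearW.
      rewrite expr2; apply: cvgM; apply: cvgB (h Dx) (cvg_cst _).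
  apply: le_trans (fatou mu mD mvf _) _.
    by move=> k x Dx; rewrite lee_fin sqr_ge0.
  rewrite limn_einf_lim; apply: lime_le; first exact: is_cvg_einfs.
  near=> k; apply: (@le_trans _ _ (\int[mu]_(x in D) ((v k x - f x) ^+ 2)%:E)%E).
    by apply: ereal_inf_lbound; exists k => /=.
  rewrite -(@fineK _ (integral _ _ _)) ?lee_fin; first by near: k.
  by apply: integrable_fin_num => //; case: (hvf k).
have wf : rintegrable mu D (fun x => (w x - f x) ^+ 2).
  apply/integrableP; split; first exact/measurable_EFinP.
  apply: le_lt_trans (ltry e); apply: le_trans le1.
  rewrite (_ : integral _ _ _ = (\int[mu]_(x in D) ((w x - f x) ^+ 2)%:E)%E)//.
  by apply: eq_integral => x _ /=; rewrite ger0_norm ?sqr_ge0.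
split; last first.
  by rewrite -lee_fin fineK//; exact: integrable_fin_num.
have : sq (fun x => (w x - f x) + f x).
  by apply: square_integrableD => //; split => //; exact: measurable_funB.
by congr sq; apply/funext => x; rewrite subrK.
Unshelve. all: by end_near. Qed.

Lemma riesz_fischer (u : nat -> T -> R) : (forall k, sq (u k)) ->
  (forall e, 0 < e -> exists n, forall j k, (n <= j)%N -> (n <= k)%N ->
    I (fun x => (u j x - u k x) ^+ 2) <= e) ->
  exists2 w : T -> R, sq w & I (fun x => (w x - u k x) ^+ 2) @[k --> \oo] --> 0.
Proof.
move=> hu hC.
have e0 k : 0 < 8^-1 ^+ k :> R by rewrite exprn_gt0 ?invr_gt0.
have [N hN] := choice (fun k => hC _ (e0 k)).
(* The sum makes [M] nondecreasing and at least [N k]; the summand [k] makes it unbounded, so that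
   tails of the sequence contain tails of the subsequence. *)
pose M k := (k + \sum_(i < k.+1) N i)%N.
have NM k : (N k <= M k)%N by rewrite /M big_ord_recr/= addnA leq_addl.
have MM k : (M k <= M k.+1)%N by rewrite /M leq_add// [leqRHS]big_ord_recr leq_addr.
have MM' := homo_leq leqnn leq_trans MM.
have [k|w mw vw] := @riesz_fischer_fast (fun k => u (M k)) (fun k => hu _).
  by apply: hN; rewrite ?NM// (leq_trans (NM k)).
have key e : 0 < e -> exists n, forall j, (n <= j)%N ->
    sq w /\ I (fun x => (w x - u j x) ^+ 2) <= e.
  move=> ep; have [n hn] := hC _ ep; exists n => j nj.
  apply: fatou_sqr vw _ => //.
  by exists n => // k /= mk; apply: hn => //; apply: leq_trans mk (leq_addr _ _).
have [n hn] := key _ ltr01; have [hw _] := hn n (leqnn n); exists w => //.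
apply/cvgrPdist_le => e ep; have [n' hn'] := key _ ep.
exists n' => // k /= /hn'[_]; rewrite sub0r normrN ger0_norm//.
exact: rint_sqr_ge0.
Qed.

End riesz_fischer.

(** * Boxes and translations *)

Section row_vectors.
Context {R : realType} {n : nat}.
Local Notation V := 'rV[R]_n.
Local Notation mu := (@lebesgue_row R n).
Implicit Types (a b x y z : V) (f g : V -> R).

Definition obox a b : set V := [set x | forall i, a 0 i < x 0 i < b 0 i].

Lemma measurable_coord (i : 'I_n) : measurable_fun setT (fun x : V => x 0 i).
Proof. exact: measurable_row_coord. Qed.

Lemma measurable_box (B : 'I_n -> set R) : (forall i, measurable (B i)) ->
  measurable [set x : V | forall i, B i (x 0 i)].
Proof.
move=> mB; rewrite (_ : [set x : V | _] =
    \big[setI/setT]_(i < n) (@row_coord _ R n i @^-1` B i)); last first.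
  apply/seteqP; split => y /=.
    by move=> H; rewrite -bigcap_seq => i _; exact: H.
  by move=> H i; move: H; rewrite -bigcap_seq => /(_ i); apply; rewrite /= mem_index_enum.
apply: bigsetI_measurable => i _; rewrite -[X in measurable X]setTI.
exact: measurable_row_coord.
Qed.

Lemma oboxE a b : obox a b = [set x | forall i, `]a 0 i, b 0 i[%classic (x 0 i)].
Proof. by apply/seteqP; split => x h i; have := h i; rewrite /= in_itv. Qed.

Lemma measurable_obox a b : measurable (obox a b).
Proof. by rewrite oboxE; exact: (@measurable_box (fun i => `]a 0 i, b 0 i[%classic)). Qed.

Lemma oboxI a b a' b' : obox a b `&` obox a' b' =
  obox (\row_i Num.max (a 0 i) (a' 0 i)) (\row_i Num.min (b 0 i) (b' 0 i)).
Proof.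
apply/seteqP; split => x.
  move=> [h h'] i; rewrite !mxE gt_max lt_min.
  by case/andP: (h i) => -> ->; case/andP: (h' i) => -> ->.
move=> h; split => i; have := h i; rewrite !mxE gt_max lt_min.
  by case/andP => /andP[-> _] /andP[-> _].
by case/andP => /andP[_ ->] /andP[_ ->].
Qed.

Lemma obox_ball x (e : R) : 0 < e -> obox (x - const_mx e) (x + const_mx e) = ball x e.
Proof.
move=> e0; apply/seteqP; split => y.
  move=> h; split => // i j; rewrite ord1; have := h j.
  by rewrite !mxE /ball /= distrC ltr_distl.
move=> [_ h] i; have := h 0 i; rewrite !mxE /ball /= distrC ltr_distl => /andP[-> ->] //.
Qed.

(** Links the sup-norm topology to the product sigma-algebra: an open set is the union of the
    countably many boxes with rational corners that it contains. *)
Lemma open_measurable_row (A : set V) : open A -> measurable A.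
Proof.
move=> oA.
pose F (p : 'rV[rat]_n * 'rV[rat]_n) : set V :=
  let B := obox (map_mx ratr p.1) (map_mx ratr p.2) in
  if `[< B `<=` A >] then B else set0.
have mF p : measurable (F p).
  by rewrite /F; case: asboolP => // _; exact: measurable_obox.
suff -> : A = \bigcup_p F p by apply: countable_bigcupT_measurable.
apply/seteqP; split => x; last first.
  by move=> [p _]; rewrite /F; case: asboolP => // h /h.
move=> Ax; have [e /= e0 xeA] := (nbhs_ballP x A).1 (open_nbhs_nbhs (conj oA Ax)).
have hq i : exists q : rat, ratr q \in `](x 0 i - e), (x 0 i)[.
  by apply: rat_in_itvoo; rewrite ltrBlDr ltrDl.
have hr i : exists q : rat, ratr q \in `](x 0 i), (x 0 i + e)[.
  by apply: rat_in_itvoo; rewrite ltrDl.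
have [q hq'] := choice hq; have [r hr'] := choice hr.
exists (\row_i q i, \row_i r i) => //.
have xB : obox (map_mx ratr (\row_i q i)) (map_mx ratr (\row_i r i)) x.
  move=> i; rewrite !mxE; have := hq' i; have := hr' i; rewrite !in_itv /=.
  by move=> /andP[-> _] /andP[_ ->].
rewrite /F /= asboolT// => y By; apply: xeA.
rewrite -obox_ball// => i; have := By i; rewrite !mxE.
have := hq' i; have := hr' i; rewrite !in_itv /=.
by move=> /andP[h1 h2] /andP[h3 h4] /andP[h5 h6]; rewrite (lt_trans h3 h5) (lt_trans h6 h2).
Qed.

Lemma continuous_measurable_row f : continuous f -> measurable_fun setT f.
Proof.
move=> cf; apply: (measurability _ (RGenOInfty.measurableE R)) => /= _ [_ [a ->] <-].
rewrite setTI; apply: open_measurable_row.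
by apply: open_comp => // x _; exact: cf.
Qed.

Definition oboxes : set (set V) := [set A | exists a b, A = obox a b].

Lemma oboxes_setI : setI_closed oboxes.
Proof.
move=> _ _ [a [b ->]] [a' [b' ->]]; rewrite oboxI.
by exists (\row_i Num.max (a 0 i) (a' 0 i)), (\row_i Num.min (b 0 i) (b' 0 i)).
Qed.

Lemma obox_cover : \bigcup_k obox (const_mx (- k%:R)) (const_mx k%:R) = setT.
Proof.
rewrite -subTset => x _.
have [k hk] : exists k : nat, `|x| < k%:R.
  by exists (Num.truncn `|x|).+1; rewrite truncnS_gt.
exists k => // i; rewrite !mxE -ltr_norml; apply: le_lt_trans hk.
rewrite /Num.norm /= mx_normrE.
exact: (le_bigmax _ (fun ij : 'I_1 * 'I_n => `|x ij.1 ij.2|) (0, i)).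
Qed.

(** A half-space x_i > c is a countable union of boxes. With [oboxes_setI] this makes the boxes a
    generating pi-system, on which translation invariance and the vanishing of integrals need only
    be checked. *)
Lemma measurable_oboxes : @measurable _ V = <<s oboxes >>.
Proof.
apply/seteqP; split.
  apply: smallest_sub; first exact: smallest_sigma_algebra.
  move=> A; rewrite -bigcup_seq => -[i _ [B mB <-]].
  suff : measurable_fun setT (fun x : g_sigma_algebraType oboxes => x 0 i) by apply.
  apply: (measurability _ (RGenOInfty.measurableE R)) => /= _ [_ [c ->] <-].
  rewrite setTI (_ : _ @^-1` _ = \bigcup_k obox
    (\row_j (if j == i then Num.max c (- k%:R) else - k%:R)) (const_mx k%:R)).
    apply: sigma_algebra_bigcup => k; apply: sub_sigma_algebra.
    by exists (\row_j (if j == i then Num.max c (- k%:R) else - k%:R)), (const_mx k%:R).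
  apply/seteqP; split => [x /= xc|x [k _ /(_ i)]]; last first.
    by rewrite !mxE eqxx gt_max /= in_itv /= andbT => /andP[/andP[]].
  have : [set: V] x by []; rewrite -obox_cover => -[k _ hk]; exists k => // j.
  have := hk j; rewrite !mxE; case: eqP => // -> /andP[h ->]; rewrite gt_max h andbT andbT.
  by move: xc; rewrite in_itv/= andbT.
apply: smallest_sub; first exact: sigma_algebra_measurable.
by move=> _ [a [b ->]]; exact: measurable_obox.
Qed.

Lemma mu_obox a b : mu (obox a b) = (\prod_(i < n) lebesgue_measure `]a 0%R i, b 0%R i[%classic)%E.
Proof. by rewrite oboxE (@lebesgue_row_box _ _ (fun i => `]a 0 i, b 0 i[%classic)). Qed.

Lemma mu_obox_fin a b : (mu (obox a b) < +oo)%E.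
Proof.
rewrite mu_obox.
suff [] : (0 <= \prod_(i < n) lebesgue_measure `]a 0%R i, b 0%R i[%classic /\
  \prod_(i < n) lebesgue_measure `]a 0%R i, b 0%R i[%classic < +oo)%E by [].
elim/big_ind : _.
- by rewrite lee01 ltry.
- move=> x y [x0 xoo] [y0 yoo]; split; first exact: mule_ge0.
  by rewrite lte_mul_pinfty// ge0_fin_numE.
- move=> i _; split; first exact: measure_ge0.
  by rewrite lebesgue_measure_itv /=; case: ifP => _; rewrite ?ltry// -EFinD ltry.
Qed.

Lemma bounded_sub_obox (A : set V) : bounded_set A ->
  exists k : nat, A `<=` obox (const_mx (- k%:R)) (const_mx k%:R).
Proof.
move=> [M [_ hM]]; pose k := (Num.truncn `|M + 1|).+1.
have Mk : M + 1 < k%:R by apply: le_lt_trans (ler_norm _) _; rewrite truncnS_gt.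
exists k => x Ax i; rewrite !mxE -ltr_norml; apply: le_lt_trans Mk.
apply: le_trans (hM (M + 1) _ x Ax); last by rewrite ltrDl.
rewrite [leRHS]/Num.norm /= mx_normrE.
exact: (le_bigmax _ (fun ij : 'I_1 * 'I_n => `|x ij.1 ij.2|) (0, i)).
Qed.

Lemma bounded_measure_fin (A : set V) : measurable A -> bounded_set A -> (mu A < +oo)%E.
Proof.
move=> mA /bounded_sub_obox[k Ak]; apply: le_lt_trans (mu_obox_fin (const_mx (- k%:R)) (const_mx k%:R)).
by apply: le_measure => //; rewrite inE//; exact: measurable_obox.
Qed.

Definition translate z x : V := x + z.

Lemma measurable_translate z : measurable_fun setT (translate z).
Proof.
apply: measurable_row => i; rewrite (_ : _ \o _ = fun x : V => x 0 i + z 0 i).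
  by apply: measurable_funD => //; exact: measurable_coord.
by apply/funext => x; rewrite /row_coord /translate /= mxE.
Qed.

Lemma translate_obox z a b : translate z @^-1` obox a b = obox (a - z) (b - z).
Proof.
apply/seteqP; split => x h i; have := h i; rewrite !mxE; by rewrite ltrBlDr ltrBrDr.
Qed.

(** Translation preserves the side lengths of a box; uniqueness of measures on the pi-system of
    boxes does the rest. *)
Lemma mu_translate z (A : set V) : measurable A -> mu (translate z @^-1` A) = mu A.
Proof.
move=> mA.
have := @measure_unique _ R _ oboxes (fun k => obox (const_mx (- k%:R)) (const_mx k%:R))
  measurable_oboxes oboxes_setI _ obox_cover (pushforward mu (translate z)) mu _ _ A mA.
apply.
- by move=> k; exists (const_mx (- k%:R)), (const_mx k%:R).
- exact: measurable_translate.
- move=> mz _ [a [b ->]]; rewrite /= /pushforward translate_obox !mu_obox.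
  apply: eq_bigr => i _; rewrite !lebesgue_measure_itv /= !mxE !lte_fin ltrD2r.
  case: ifP => // _; rewrite -!EFinD; congr EFin; ring.
- by move=> mz k; rewrite /= /pushforward translate_obox mu_obox_fin.
Qed.

Lemma ge0_integral_translate z (f : V -> \bar R) : measurable_fun setT f ->
  (forall x, 0 <= f x)%E -> (\int[mu]_x f (x + z)%R = \int[mu]_x f x)%E.
Proof.
move=> mf f0; transitivity (\int[pushforward mu (translate z)]_x f x)%E.
  by rewrite (ge0_integral_pushforward (measurable_translate z)).
apply: eq_measure_integral => [|mz A mA _]; first exact: measurable_translate.
exact: mu_translate.
Qed.

End row_vectors.

(** * Smooth functions and test functions *)

Section smooth_real.
Context {R : realType}.
Implicit Types F f : R -> R.

Definition smooth1 F := forall k t, derivable (derive1n k F) t 1.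

Lemma smooth1_derive F : smooth1 F -> smooth1 (derive1 F).
Proof. by move=> sF k t; have := sF k.+1 t; rewrite derive1Sn. Qed.

Lemma smooth1_continuous F : smooth1 F -> continuous F.
Proof.
move=> sF t; apply/differentiable_continuous/derivable1_diffP.
exact: (sF 0%N t).
Qed.

Lemma smooth1_primitive F f : (forall t, is_derive (t : R) (1 : R) F (f t)) -> smooth1 f -> smooth1 F.
Proof.
move=> dF sf [|k] t; first by have [] := dF t.
rewrite derive1Sn (_ : derive1 F = f); first exact: sf.
by apply/funext => s; rewrite derive1E; have [_ ->] := dF s.
Qed.

(** For t < 0 the interval is empty. The definition thus gives an antiderivative only when f
    vanishes on the negative half-line, as [beta] and its primitive do. *)
Definition primitive f t : R := \int[lebesgue_measure]_(s in `[0, t]) f s.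

Lemma is_derive_primitive f : continuous f -> (forall t, t <= 0 -> f t = 0) ->
  forall t, is_derive (t : R) (1 : R) (primitive f) (f t).
Proof.
move=> cf f0 t.
(* Starting the integral at -oo makes every t, including t <= 0, an interior point for the
   fundamental theorem of calculus. *)
have PE : primitive f = fun y => \int[lebesgue_measure]_(s in [set` Interval -oo%O (BRight y)]) f s.
  apply/funext => y; rewrite /primitive Rintegral_mkcond [RHS]Rintegral_mkcond.
  apply: eq_Rintegral => s _; rewrite !patchE !mem_setE !in_itv /=.
  by case: (leP 0 s) => //= s0; rewrite f0 ?if_same// ltW.
have itf : (@lebesgue_measure R).-integrable [set` Interval -oo%O (BRight (t + 1))] (EFin \o f).
  apply/(integrable_mkcond _ _) => //.
  have := (integrable_mkcond (mu := @lebesgue_measure R) _ (measurable_itv _)).1 (@continuous_compact_integrable R f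
    `[0, t + 1] (@segment_compact _ _ _) (continuous_subspaceT cf)).
  apply: eq_integrable => // s _.
  rewrite !patchE !mem_setE !in_itv /=.
  by case: (leP 0 s) => //= s0; rewrite f0 ?if_same// ltW.
have [||d1 d2] := @continuous_FTC1 R f -oo%O t (t + 1) _ itf _ (cf t).
- by rewrite ltrDl.
- by rewrite ltNyr.
by rewrite PE; apply: DeriveDef; [exact: d1|rewrite -derive1E; exact: d2].
Qed.

Lemma primitive_le0 f t : (forall t, t <= 0 -> f t = 0) -> t <= 0 -> primitive f t = 0.
Proof.
move=> f0 t0; rewrite /primitive -[RHS](mul0r (fine (lebesgue_measure `[0, t]))).
rewrite -Rintegral_cst//; apply: eq_Rintegral => s; rewrite inE /= in_itv /= => /andP[_ st].
by rewrite f0// (le_trans st).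
Qed.

(** Allowing both orders of a and b spares a case distinction on the sign of the increment wherever
    it is applied. *)
Lemma MVT_is_derive F f a b : (forall t, is_derive (t : R) (1 : R) F (f t)) ->
  exists2 c, Num.min a b <= c <= Num.max a b & F b - F a = f c * (b - a).
Proof.
move=> dF.
have cF : continuous F.
  by move=> t; apply/differentiable_continuous/derivable1_diffP; have [] := dF t.
have [ab|ab] := leP a b.
  have [|c + ->] := MVT_segment ab (fun t _ => dF t).
    exact: continuous_subspaceT.
  by rewrite in_itv /= => h; exists c.
have [|c + E] := MVT_segment (ltW ab) (fun t _ => dF t).
  exact: continuous_subspaceT.
rewrite in_itv /= => h; exists c => //.
by rewrite -opprB E -mulrN opprB.
Qed.

End smooth_real.

Section smooth_row.
Context {R : realType} {n : nat}.
Local Notation V := 'rV[R]_n.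
Implicit Types (f g : V -> R) (x v : V).

Lemma derive_line f x v : 'D_v f x = derive1 (fun h : R => f (h *: v + x)) 0.
Proof.
rewrite derive1E /derive; set g1 := fun h => h^-1 *: _; set g2 := fun h => h^-1 *: _.
suff -> : g1 = g2 by [].
by rewrite funeqE /g1 /g2 => h /=; rewrite addr0 scale0r add0r [_%:A]mulr1.
Qed.

Lemma derivable_comp1 (F : R -> R) f x v : derivable f x v -> derivable F (f x) 1 ->
  derivable (F \o f) x v /\ 'D_v (F \o f) x = derive1 F (f x) * 'D_v f x.
Proof.
move=> /derivable1P df dF.
have dF' : derivable F (f (0 *: v + x)) 1 by rewrite scale0r add0r.
split.
  pose g (h : R) := f (h *: v + x).
  have dg := ((derivable1_diffP g 0).1 df).
  have dFg := ((derivable1_diffP F (g 0)).1 dF').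
  apply/derivable1P; apply: (derivable1_diffP (F \o g) 0).2.
  exact: (differentiable_comp dg dFg).
have E := derive1_comp df dF'; rewrite (derive_line f) (derive_line (F \o f)).
by rewrite [LHS]E scale0r add0r.
Qed.

Definition smooth f := forall k, is_Ck k f.

Lemma smoothP f : smooth f <-> forall s, continuous (iter_partial s f) /\
  forall i x, derivable (iter_partial s f) x (delta_mx 0 i).
Proof.
split=> [sf s|sf k s]; first by split; [apply: (sf (size s) s).1|apply: (sf (size s).+1 s).2].
by have [h1 h2] := sf s; split.
Qed.

Lemma smooth_continuous f : smooth f -> continuous f.
Proof. by move=> /smoothP /(_ [::])[]. Qed.

Lemma smooth_derivable f i x : smooth f -> derivable f x (delta_mx 0 i).
Proof. by move=> /smoothP /(_ [::])[]. Qed.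

Lemma smooth_partial f i : smooth f -> smooth (partial i f).
Proof.
move=> /smoothP sf; apply/smoothP => s; have := sf (rcons s i).
by rewrite /iter_partial foldr_rcons.
Qed.

(** Smoothness concerns all iterated partial derivatives. An invariant class of functions avoids
    explicit formulas for higher derivatives of products and compositions. *)
Lemma smooth_coind (P : (V -> R) -> Prop) :
  (forall f, P f -> continuous f) ->
  (forall f, P f -> forall i x, derivable f x (delta_mx 0 i)) ->
  (forall f, P f -> forall i, P (partial i f)) ->
  forall f, P f -> smooth f.
Proof.
move=> h1 h2 h3 f Pf; apply/smoothP => s.
have Ps : P (iter_partial s f) by elim: s => [//|i s IH] /=; exact: h3.
by split; [exact: h1|exact: h2].
Qed.

(* The terms produced by iterated differentiation of sums, products and
   compositions of smooth functions: a class closed under [partial]. *)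
Inductive smooth_expr : (V -> R) -> Prop :=
| SmoothBase f : smooth f -> smooth_expr f
| SmoothCst (c : R) : smooth_expr (fun=> c)
| SmoothCoord (i : 'I_n) : smooth_expr (fun x => x 0 i)
| SmoothAdd f g : smooth_expr f -> smooth_expr g -> smooth_expr (fun x => f x + g x)
| SmoothMul f g : smooth_expr f -> smooth_expr g -> smooth_expr (fun x => f x * g x)
| SmoothComp F f : smooth1 F -> smooth_expr f -> smooth_expr (F \o f).

Lemma derive_coord (i j : 'I_n) x :
  is_derive x (delta_mx 0 i) (fun x : V => x 0 j) ((i == j)%:R : R).
Proof.
have d : differentiable (fun x : V => x 0 j) x by exact: differentiable_coord.
apply: DeriveDef; first exact: diff_derivable.
rewrite derive_line derive1E.
rewrite (_ : (fun h : R => _) = (fun h => h * (i == j)%:R + x 0 j)); last first.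
  by apply/funext => h; rewrite !mxE /= (eq_sym j).
have h : is_derive (0 : R) (1 : R) (fun h : R => h * (i == j)%:R + x 0 j)
    ((0 : R) *: (0 : R) + (i == j)%:R *: (1 : R) + 0).
  by apply: is_deriveD; apply: is_deriveM.
by rewrite derive_val scale0r add0r addr0 [_ *: _]mulr1.
Qed.

Lemma smooth_expr_continuous f : smooth_expr f -> continuous f.
Proof.
elim=> {f} [f /smooth_continuous//|c|i|f g _ cf _ cg|f g _ cf _ cg|F f sF _ cf] x.
- exact: cst_continuous.
- exact: coord_continuous.
- exact: (cvgD (cf x) (cg x)).
- exact: (cvgM (cf x) (cg x)).
- by apply: continuous_comp (cf x) _; exact: smooth1_continuous.
Qed.

Lemma smooth_expr_derivable f : smooth_expr f -> forall i x, derivable f x (delta_mx 0 i).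
Proof.
elim=> {f} [f sf|c|j|f g _ cf _ cg|f g _ cf _ cg|F f sF _ cf] i x.
- exact: smooth_derivable.
- exact: derivable_cst.
- by have [] := derive_coord i j x.
- by apply: derivableD; [exact: cf|exact: cg].
- by apply: derivableM; [exact: cf|exact: cg].
- by have [] := derivable_comp1 (cf i x) (sF 0%N _).
Qed.

Lemma partialD f g i : smooth_expr f -> smooth_expr g ->
  partial i (fun x => f x + g x) = fun x => partial i f x + partial i g x.
Proof.
move=> sf sg; apply/funext => x.
by apply: deriveD; apply: smooth_expr_derivable.
Qed.

Lemma partialM f g i : smooth_expr f -> smooth_expr g ->
  partial i (fun x => f x * g x) = fun x => f x * partial i g x + g x * partial i f x.
Proof.
move=> sf sg; apply/funext => x.
by apply: deriveM; apply: smooth_expr_derivable.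
Qed.

Lemma partial_comp F f i : smooth1 F -> smooth_expr f ->
  partial i (F \o f) = fun x => derive1 F (f x) * partial i f x.
Proof.
move=> sF sf; apply/funext => x.
by have [] := derivable_comp1 (@smooth_expr_derivable _ sf i x) (sF 0%N _).
Qed.

Lemma smooth_expr_partial f : smooth_expr f -> forall i, smooth_expr (partial i f).
Proof.
elim=> {f} [f sf|c|j|f g sf cf sg cg|f g sf cf sg cg|F f sF sf cf] i.
- by apply: SmoothBase; exact: smooth_partial.
- rewrite (_ : partial _ _ = fun=> 0); first exact: SmoothCst.
  by apply/funext => x; exact: derive_cst.
- rewrite (_ : partial _ _ = fun=> (i == j)%:R); first exact: SmoothCst.
  by apply/funext => x; have [_ <-] := derive_coord i j x.
- by rewrite partialD//; apply: SmoothAdd.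
- by rewrite partialM//; apply: SmoothAdd; apply: SmoothMul.
- rewrite partial_comp//; apply: SmoothMul => //.
  by apply: (SmoothComp (F := derive1 F)) => //; exact: smooth1_derive.
Qed.

Lemma smooth_exprP f : smooth_expr f -> smooth f.
Proof.
apply: smooth_coind; [exact: smooth_expr_continuous|exact: smooth_expr_derivable|].
exact: smooth_expr_partial.
Qed.

End smooth_row.

Section test_functions.
Context {R : realType} {n : nat}.
Local Notation V := 'rV[R]_n.
Local Notation mu := (@lebesgue_row R n).
Implicit Types (f g phi psi : V -> R) (x v : V) (Omega : set V).

Lemma test_smooth Omega phi : test_function Omega phi -> smooth phi.
Proof. by case. Qed.

Lemma test_continuous Omega phi : test_function Omega phi -> continuous phi.
Proof. by move=> /test_smooth/smooth_continuous. Qed.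

Lemma sub_support_test Omega phi psi : test_function Omega phi -> smooth psi ->
  [set x | psi x != 0] `<=` closure [set x | phi x != 0] -> test_function Omega psi.
Proof.
move=> [_ cp sub] sm h.
have h' : closure [set x | psi x != 0] `<=` closure [set x | phi x != 0].
  by move=> x /(closure_subset h); rewrite -(closure_id _).1//; exact: closed_closure.
split => //; last exact: subset_trans h' sub.
exact: subclosed_compact (@closed_closure _ _) cp h'.
Qed.

Lemma test_comp Omega (F : R -> R) phi : smooth1 F -> F 0 = 0 ->
  test_function Omega phi -> test_function Omega (F \o phi).
Proof.
move=> sF F0 tphi; apply: (sub_support_test tphi).
  by apply: smooth_exprP; apply: SmoothComp => //; exact/SmoothBase/(test_smooth tphi).
move=> x /= h; apply: subset_closure => /=; apply: contraNneq h => ->.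
by rewrite F0.
Qed.

Lemma testM Omega f phi : smooth f -> test_function Omega phi ->
  test_function Omega (fun x => f x * phi x).
Proof.
move=> sf tphi; apply: (sub_support_test tphi).
  by apply: smooth_exprP; apply: SmoothMul; apply: SmoothBase => //; exact: test_smooth tphi.
move=> x /= h; apply: subset_closure => /=; apply: contraNneq h => ->.
by rewrite mulr0.
Qed.

Lemma testZ Omega (k : R) phi : test_function Omega phi ->
  test_function Omega (fun x => k * phi x).
Proof. by apply: testM; apply: smooth_exprP; exact: SmoothCst. Qed.

Lemma testD Omega phi psi : test_function Omega phi -> test_function Omega psi ->
  test_function Omega (fun x => phi x + psi x).
Proof.
move=> tphi tpsi.
have [_ c1 s1] := tphi; have [_ c2 s2] := tpsi.
have sub : closure [set x | phi x + psi x != 0] `<=`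
    closure [set x | phi x != 0] `|` closure [set x | psi x != 0].
  rewrite -closureU; apply: closure_subset => x /=; case: (eqVneq (phi x) 0) => [->|]; last by left.
  by rewrite add0r; right.
split.
- by apply: smooth_exprP; apply: SmoothAdd; apply: SmoothBase; apply: test_smooth; eassumption.
- by apply: subclosed_compact (@closed_closure _ _) (compactU c1 c2) sub.
- by move=> x /sub[/s1|/s2].
Qed.

(** Off its closed support [phi] vanishes on a whole neighbourhood, hence so does its derivative. *)
Lemma test_partial Omega i phi : test_function Omega phi -> test_function Omega (partial i phi).
Proof.
move=> tphi; apply: (sub_support_test tphi); first exact/smooth_partial/(test_smooth tphi).
move=> x /=; apply: contraNP => ncl.
have nx : \forall y \near x, phi y = 0.
  have : open_nbhs x (~` closure [set x | phi x != 0]).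
    by split => //; exact/closed_openC/closed_closure.
  move=> /open_nbhs_nbhs; apply: filterS => y /= h.
  by apply: contra_notP h => /eqP h; exact: subset_closure.
have E : \near x, (cst 0 : V -> R) x = phi x by apply: filterS nx => y ->.
by rewrite /partial -(near_eq_derive _ E) derive_cst.
Qed.

Lemma test_zero Omega phi x : test_function Omega phi -> ~ Omega x -> phi x = 0.
Proof.
move=> [_ _ sub]; apply: contra_notP => /eqP h.
by apply: sub; exact: subset_closure.
Qed.

Lemma test_bounded Omega phi : test_function Omega phi ->
  exists2 C : R, 0 <= C & forall x, `|phi x| <= C.
Proof.
move=> tphi; have [sm cp _] := tphi.
have := continuous_compact (continuous_subspaceT (test_continuous tphi)) cp.
move=> /compact_bounded[M [_ hM]].
exists (`|M| + 1); first by rewrite addr_ge0.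
move=> x; case: (pselect (closure [set x | phi x != 0] x)) => [xc|xc].
  apply: (hM (`|M| + 1)); last by exists x.
  by rewrite (le_lt_trans (ler_norm _))// ltrDl.
rewrite (_ : phi x = 0) ?normr0 ?addr_ge0//.
by apply: contra_notP xc => /eqP h; exact: subset_closure.
Qed.

Lemma is_derive_line f x v h : derivable f (x + h *: v) v ->
  is_derive (h : R) (1 : R) (fun h : R => f (x + h *: v)) ('D_v f (x + h *: v)).
Proof.
move=> df.
have E : (fun s : R => s^-1 *: (((fun h : R => f (x + h *: v)) \o shift h) (s *: (1 : R)) - f (x + h *: v)))
  = (fun s : R => s^-1 *: ((f \o shift (x + h *: v)) (s *: v) - f (x + h *: v))).
  apply/funext => s /=; congr (_ *: (f _ - _)).
  by rewrite [_ *: 1]mulr1 scalerDl addrCA.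
by apply: DeriveDef; rewrite /derivable /derive E.
Qed.

(** Two applications of the mean value theorem. The bound is uniform in x because second partial
    derivatives of a test function are bounded on the whole space. *)
Lemma test_translate Omega i phi : test_function Omega phi ->
  exists2 C : R, 0 <= C & forall x (t : R),
    `|phi (x + t *: delta_mx 0 i) - phi x - t * partial i phi x| <= C * t ^+ 2.
Proof.
move=> tphi; have [C C0 hC] := test_bounded (test_partial i (test_partial i tphi)).
exists C => // x t; set e := delta_mx 0 i.
have d1 h := @is_derive_line phi x e h (@smooth_derivable _ _ _ i _ (test_smooth tphi)).
have d2 h := @is_derive_line (partial i phi) x e h
  (@smooth_derivable _ _ _ i _ (test_smooth (test_partial i tphi))).
have [c hc] := MVT_is_derive 0 t d1; have [c' hc'] := MVT_is_derive 0 c d2.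
rewrite scale0r addr0 !subr0 => E2 ->.
rewrite (mulrC t) -mulrBl -/(partial i phi _) E2 normrM normrM.
apply: (@le_trans _ _ (C * `|t| * `|t|)); last by rewrite -mulrA -expr2 real_normK ?num_real.
apply: ler_wpM2r => //; apply: ler_pM => //; first exact: hC.
move: hc; case: (leP 0 t) => t0 /andP[h1 h2].
  by rewrite !ger0_norm.
by rewrite !ler0_norm ?lerN2// ltW.
Qed.

Lemma rint_support (A B : set V) f : A `<=` B -> (forall x, B x -> ~ A x -> f x = 0) ->
  \int[mu]_(x in B) f x = \int[mu]_(x in A) f x.
Proof.
move=> AB fA; rewrite Rintegral_mkcond [RHS]Rintegral_mkcond.
apply: eq_Rintegral => x _; rewrite !patchE.
case: (boolP (x \in A)) => [/set_mem/AB/mem_set ->//|/negP Ax].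
case: (boolP (x \in B)) => // /set_mem Bx; rewrite fA// => Ax'.
by apply: Ax; exact: mem_set.
Qed.

Lemma rintegrable_support (A : set V) f : measurable A -> (forall x, ~ A x -> f x = 0) ->
  rintegrable mu A f -> rintegrable mu setT f.
Proof.
move=> mA fA /(integrable_mkcond (mu := mu) _ mA).1.
apply: eq_integrable => // x _; rewrite patchE.
case: (boolP (x \in A)) => // /negP Ax; rewrite /= fA// => Ax'.
by apply: Ax; exact: mem_set.
Qed.

Lemma rint_translate z f : rintegrable mu setT f ->
  rintegrable mu setT (fun x => f (x + z)) /\
  \int[mu]_x f (x + z) = \int[mu]_x f x.
Proof.
move=> hf; have mf := rintegrable_measurable hf.
have mfz : measurable_fun setT (fun x => f (x + z)).
  by apply: (measurableT_comp mf); exact: measurable_translate.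
have ifz : rintegrable mu setT (fun x => f (x + z)).
  apply/integrableP; split; first exact/measurable_EFinP.
  have -> : (\int[mu]_x `|(EFin \o (fun x => f (x + z)%R)) x| = \int[mu]_x `|(f x)%:E|)%E.
    rewrite -[RHS](ge0_integral_translate z)//.
    by apply: measurableT_comp => //; exact/measurable_EFinP.
  by case/integrableP: hf.
split => //; congr fine.
transitivity (\int[pushforward mu (translate z)]_x (f x)%:E)%E; last first.
  apply: eq_measure_integral => [|mz A mA _]; first exact: measurable_translate.
  exact: mu_translate.
rewrite (integral_pushforward (measurable_translate z))//.
exact/measurable_EFinP.
Qed.

Section bounded_domain.
Variable Omega : set V.
Hypotheses (oO : open Omega) (bO : bounded_set Omega).

Lemma mO : measurable Omega. Proof. exact: open_measurable_row. Qed.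

Lemma finO : (mu Omega < +oo)%E.
Proof. by apply: bounded_measure_fin => //; exact: mO. Qed.

Lemma test_measurable D phi : measurable D -> test_function Omega phi -> measurable_fun D phi.
Proof.
move=> mD /test_continuous/continuous_measurable_row mphi.
exact: measurable_funS mphi.
Qed.

Lemma test_square phi : test_function Omega phi -> square_integrable mu Omega phi.
Proof.
move=> tphi; have [C C0 hC] := test_bounded tphi.
apply: (square_integrable_bounded mO finO _ (fun x _ => hC x)).
by apply: test_measurable => //; exact: mO.
Qed.

Lemma test_rint phi : test_function Omega phi ->
  rintegrable mu setT phi /\ \int[mu]_x phi x = \int[mu]_(x in Omega) phi x.
Proof.
move=> tphi; split.
  apply: (rintegrable_support mO) => [x|]; first exact: test_zero.
  apply: square_integrable_rintegrable; [exact: mO|exact: finO|exact: test_square].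
by apply: rint_support => // x _; exact: test_zero.
Qed.

Lemma test_square_setT phi : test_function Omega phi -> square_integrable mu setT phi.
Proof.
move=> tphi; split; first exact: test_measurable.
apply: (rintegrable_support mO) => [x Ox|]; first by rewrite (test_zero tphi Ox) expr0n.
by case: (test_square tphi).
Qed.

(** By translation invariance phi(x + t e_i) - phi(x) has integral 0, so t int d_i phi equals, up to
    sign, the integral of a remainder of size C t^2 supported in a fixed box. Divide by t and let t
    tend to 0. *)
Lemma rint_partial0 i phi : test_function Omega phi -> \int[mu]_x partial i phi x = 0.
Proof.
move=> tphi; have [C C0 hC] := test_translate i tphi.
have [iphi _] := test_rint tphi; have [idphi _] := test_rint (test_partial i tphi).
have [k hk] := bounded_sub_obox bO.
(* One unit larger than a box containing [Omega], to contain the support of every translate with 0 <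
   t <= 1. *)
pose Q : set V := obox (const_mx (- k.+1%:R)) (const_mx k.+1%:R).
have mQ : measurable Q by exact: measurable_obox.
have OQ : Omega `<=` Q.
  move=> x /hk h j; have := h j; rewrite !mxE -natr1 => /andP[h1 h2]; apply/andP; split; lra.
pose m := fine (mu Q).
have key (t : R) : 0 < t <= 1 -> `|\int[mu]_x partial i phi x| <= C * m * t.
  move=> /andP[t0 t1]; pose g x := phi (x + t *: delta_mx 0 i) - phi x - t * partial i phi x.
  have [iphit Et] := rint_translate (t *: delta_mx 0 i) iphi.
  have i1 : rintegrable mu setT (fun x => phi (x + t *: delta_mx 0 i) - phi x).
    exact: rintegrableB.
  have i2 : rintegrable mu setT (fun x => t * partial i phi x) by exact: rintegrableZ.
  have ig : rintegrable mu setT g by exact: rintegrableB.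
  have Eg : \int[mu]_x g x = - (t * \int[mu]_x partial i phi x).
    by rewrite RintegralB// RintegralB// Et subrr sub0r RintegralZl.
  have gQ x : ~ Q x -> g x = 0.
    move=> nQ; have nO : ~ Omega x by move/OQ.
    rewrite /g (test_zero tphi nO) (test_zero (test_partial i tphi) nO) mulr0 !subr0.
    apply: (test_zero tphi) => /hk h; apply: nQ => j; have := h j.
    rewrite !mxE eqxx /= -natr1; case: (j == i); rewrite ?mulr1 ?mulr0 ?addr0;
      move=> /andP[h1 h2]; apply/andP; split; lra.
  have igQ : rintegrable mu Q g by apply: (integrableS _ mQ _ ig).
  have : `|\int[mu]_x g x| <= C * t ^+ 2 * m.
    rewrite (rint_support (A := Q))//; last by move=> x _; exact: gQ.
    apply: le_trans (le_normr_Rintegral mQ igQ) _.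
    rewrite -Rintegral_cst//; apply: le_Rintegral => //.
    - exact: rintegrable_norm.
    - by apply: rintegrable_cst => //; exact: mu_obox_fin.
    - by move=> x _; exact: hC.
  rewrite Eg normrN normrM gtr0_norm// expr2 => h.
  rewrite -(ler_pM2l t0); apply: le_trans h _; rewrite le_eqVlt; apply/orP; left; apply/eqP; ring.
apply/eqP; rewrite -normr_le0; apply/ler_addgt0Pl => e e0; rewrite addr0.
have m0 : 0 <= C * m by rewrite mulr_ge0// fine_ge0.
pose t := Num.min 1 (e / (C * m + 1)).
have t0 : 0 < t by rewrite lt_min ltr01 divr_gt0// ltr_wpDl.
apply: (le_trans (key t _)).
  by rewrite t0 ge_min lexx.
apply: (@le_trans _ _ ((C * m + 1) * (e / (C * m + 1)))).
  apply: ler_pM => //; first exact: ltW.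
  - by rewrite lerDl.
  - by rewrite ge_min lexx orbT.
by rewrite mulrCA divff ?mulr1// gt_eqF// ltr_wpDl.
Qed.

Lemma test_by_parts i phi psi : test_function Omega phi -> test_function Omega psi ->
  \int[mu]_(x in Omega) (phi x * partial i psi x) =
  - \int[mu]_(x in Omega) (partial i phi x * psi x).
Proof.
move=> tphi tpsi; apply/eqP; rewrite -subr_eq0 opprK.
have tM := testM (test_smooth tphi) tpsi.
have := rint_partial0 i tM; rewrite (test_rint (test_partial i tM)).2.
rewrite partialM; [|exact/SmoothBase/(test_smooth tphi)|exact/SmoothBase/(test_smooth tpsi)].
rewrite RintegralD; [move=> E|exact: mO|..].
- rewrite -E; apply/eqP; congr (_ + _).
  by apply: eq_Rintegral => x _; rewrite mulrC.
- by apply: rintegrableM; [exact: mO|exact: test_square|apply: test_square; exact: test_partial].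
- by apply: rintegrableM; [exact: mO|exact: test_square|apply: test_square; exact: test_partial].
Qed.

End bounded_domain.

End test_functions.

(** * Rellich's theorem for test functions *)

Section translations.
Context {R : realType} {n : nat}.
Local Notation V := 'rV[R]_n.
Local Notation mu := (@lebesgue_row R n).
Implicit Types (f g phi psi : V -> R) (x z : V).
Variable Omega : set V.
Hypotheses (oO : open Omega) (bO : bounded_set Omega).
Local Notation sq := (square_integrable mu setT).
Local Notation nrm := (l2norm mu setT).

Lemma l2norm0 : nrm (fun=> 0) = 0.
Proof.
rewrite /l2norm (_ : \int[mu]_x _ = 0) ?sqrtr0//.
by under eq_Rintegral do rewrite expr0n; rewrite Rintegral_cst// mul0r.
Qed.

Lemma square_translate f z : sq f -> sq (fun x => f (x + z)) /\ nrm (fun x => f (x + z)) = nrm f.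
Proof.
move=> [mf hf].
have mfz : measurable_fun setT (fun x => f (x + z)).
  by apply: (measurableT_comp mf); exact: measurable_translate.
have [h1 h2] := rint_translate z hf.
by split; [split|rewrite /l2norm h2].
Qed.

(** The Taylor remainder vanishes outside a fixed box when |t| <= 1, so its uniform bound passes to
    the L^2 norm. *)
Lemma translate_small i phi : test_function Omega phi ->
  exists2 C : R, 0 <= C & forall t : R, `|t| <= 1 ->
    nrm (fun x => phi (x + t *: delta_mx 0 i) - phi x) <= `|t| * nrm (partial i phi) + C * t ^+ 2.
Proof.
move=> tphi; have [C C0 hC] := test_translate i tphi.
have sphi := test_square_setT oO bO tphi.
have sdphi := test_square_setT oO bO (test_partial i tphi).
have [k hk] := bounded_sub_obox bO.
pose Q : set V := obox (const_mx (- k.+1%:R)) (const_mx k.+1%:R).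
have mQ : measurable Q by exact: measurable_obox.
pose m := fine (mu Q); have m0 : 0 <= m by exact: fine_ge0.
have OQ : Omega `<=` Q.
  move=> x /hk h j; have := h j; rewrite !mxE -natr1 => /andP[h1 h2]; apply/andP; split; lra.
exists (C * Num.sqrt m); first by rewrite mulr_ge0// sqrtr_ge0.
move=> t t1.
pose g x := phi (x + t *: delta_mx 0 i) - phi x - t * partial i phi x.
have [st _] := square_translate (t *: delta_mx 0 i) sphi.
have sd := square_integrableB measurableT st sphi.
have sZ := square_integrableZ measurableT t sdphi.
have sg : sq g by exact: (square_integrableB measurableT sd sZ).
have gQ x : ~ Q x -> g x = 0.
  move=> nQ; have nO : ~ Omega x by move/OQ.
  rewrite /g (test_zero tphi nO) (test_zero (test_partial i tphi) nO) mulr0 !subr0.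
  apply: (test_zero tphi) => /hk h; apply: nQ => j; have := h j; move: t1; rewrite ler_norml.
  rewrite !mxE eqxx /= -natr1; case: (j == i); rewrite ?mulr1 ?mulr0 ?addr0;
    move=> /andP[h1 h2] /andP[h3 h4]; apply/andP; split; lra.
have ng : nrm g <= C * Num.sqrt m * t ^+ 2.
  have igQ : rintegrable mu Q (fun x => g x ^+ 2) by apply: (integrableS _ mQ _ sg.2).
  have : \int[mu]_x g x ^+ 2 <= (C * t ^+ 2) ^+ 2 * m.
    rewrite (rint_support (A := Q))//; last by move=> x _ /gQ ->; rewrite expr0n.
    rewrite -Rintegral_cst//; apply: le_Rintegral => //.
    - by apply: rintegrable_cst => //; exact: mu_obox_fin.
    - move=> x _; rewrite -(real_normK (num_real (g x))) lerXn2r ?nnegrE ?(mulr_ge0 C0 (sqr_ge0 t))//.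
      exact: hC.
  move=> /ler_wsqrtr h; apply: le_trans h _.
  rewrite sqrtrM ?sqr_ge0// sqrtr_sqr (ger0_norm (mulr_ge0 C0 (sqr_ge0 t))).
  by rewrite mulrAC.
have -> : (fun x => phi (x + t *: delta_mx 0 i) - phi x) = (fun x => t * partial i phi x + g x).
  by apply/funext => x; rewrite /g [RHS]addrC subrK.
apply: le_trans (l2normD measurableT sZ sg) _; apply: lerD => //.
rewrite /l2norm (_ : \int[mu]_x ((t * partial i phi x) ^+ 2) = t ^+ 2 * \int[mu]_x (partial i phi x ^+ 2)).
  by rewrite sqrtrM ?sqr_ge0// sqrtr_sqr.
by rewrite -RintegralZl//; [apply: eq_Rintegral => x _; rewrite exprMn|case: sdphi].
Qed.

(* Iterating a translation removes the quadratic error of [translate_small]. *)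
Lemma translate_iter phi z k : sq phi ->
  nrm (fun x => phi (x + k%:R *: z) - phi x) <= k%:R * nrm (fun x => phi (x + z) - phi x).
Proof.
move=> sphi; elim: k => [|k IH].
  rewrite (_ : (fun x => _) = fun=> 0); last first.
    by apply/funext => x; rewrite scale0r addr0 subrr.
  by rewrite l2norm0 mul0r.
have [s1 _] := square_translate z sphi; have sz := square_integrableB measurableT s1 sphi.
have [s2 _] := square_translate (k%:R *: z) sphi.
have sk := square_integrableB measurableT s2 sphi.
have [s3 E] := square_translate (k%:R *: z) sz.
have -> : (fun x => phi (x + k.+1%:R *: z) - phi x) =
  (fun x => (phi (x + k%:R *: z + z) - phi (x + k%:R *: z)) + (phi (x + k%:R *: z) - phi x)).
  apply/funext => x; rewrite addrA subrK -addrA -[in X in _ = phi (_ + (_ + X)) - _](scale1r z).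
  by rewrite -scalerDl natr1.
apply: le_trans (l2normD measurableT s3 sk) _.
by rewrite E -natr1 mulrDl mul1r addrC lerD2r.
Qed.

Lemma translate_axis i phi (t : R) : test_function Omega phi ->
  nrm (fun x => phi (x + t *: delta_mx 0 i) - phi x) <= `|t| * nrm (partial i phi).
Proof.
move=> tphi; have [C C0 hC] := translate_small i tphi.
have sphi := test_square_setT oO bO tphi.
apply/ler_addgt0Pl => e e0.
(* Large enough for a step t/k of length at most 1 and for an accumulated error k C (t/k)^2 = C t^2
   / k of at most e. *)
pose k := (Num.truncn (`|t| + C * t ^+ 2 / e)).+1.
have k0 : 0 < k%:R :> R by rewrite ltr0n.
have kb : `|t| + C * t ^+ 2 / e < k%:R.
  have := truncn_itv (x := `|t| + C * t ^+ 2 / e); rewrite addr_ge0 ?divr_ge0 ?(mulr_ge0 C0 (sqr_ge0 t)) ?(ltW e0)//.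
  by move=> /(_ isT) /andP[].
have r0 : 0 <= C * t ^+ 2 / e by rewrite divr_ge0 ?(mulr_ge0 C0 (sqr_ge0 t)) ?(ltW e0).
have tk : `|t / k%:R| <= 1.
  rewrite normrM normfV (gtr0_norm k0) ler_pdivrMr// mul1r.
  by apply: le_trans (ltW kb); rewrite lerDl.
have := translate_iter (t / k%:R *: delta_mx 0 i) k sphi.
rewrite scalerA (_ : k%:R * (t / k%:R) = t); last by rewrite mulrCA divff ?mulr1// gt_eqF.
move/le_trans; apply; apply: (le_trans (ler_wpM2l (ltW k0) (hC _ tk))).
rewrite mulrDr mulrA normrM normfV (gtr0_norm k0).
rewrite (_ : k%:R * (`|t| / k%:R) = `|t|); last by rewrite mulrCA divff ?mulr1// gt_eqF.
rewrite addrC lerD2r.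
rewrite (_ : k%:R * (C * (t / k%:R) ^+ 2) = C * t ^+ 2 / k%:R); last first.
  have kk : (k%:R : R) != 0 by rewrite gt_eqF.
  by move: (k%:R : R) kk => K kk; field.
rewrite ler_pdivrMr// -ler_pdivrMl// mulrC; apply: le_trans (ltW kb).
by rewrite lerDr.
Qed.

(** The translation by [z] is carried out one coordinate at a time, in [n] moves of length at most
    [h]. *)
Lemma translate_bound phi z (A h : R) : test_function Omega phi ->
  (forall i, nrm (partial i phi) <= A) -> (forall i, `|z 0 i| <= h) ->
  nrm (fun x => phi (x + z) - phi x) <= n%:R * (h * A).
Proof.
move=> tphi hA hh; have sphi := test_square_setT oO bO tphi.
have key (s : seq 'I_n) :
    nrm (fun x => phi (x + \sum_(i <- s) z 0 i *: delta_mx 0 i) - phi x) <= \sum_(i <- s) (h * A).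
  elim: s => [|i s IH].
    rewrite big_nil (_ : (fun x => _) = fun=> 0); last first.
      by apply/funext => x; rewrite ?big_nil addr0 subrr.
    by rewrite l2norm0 big_nil.
  rewrite big_cons; set w := \sum_(j <- s) z 0 j *: delta_mx 0 j in IH *.
  set v := z 0 i *: delta_mx 0 i.
  have [s1 _] := square_translate v sphi; have sz := square_integrableB measurableT s1 sphi.
  have [s2 _] := square_translate w sphi; have sw := square_integrableB measurableT s2 sphi.
  have [s3 E] := square_translate w sz.
  have -> : (fun x => phi (x + (v + w)) - phi x) =
    (fun x => (phi (x + w + v) - phi (x + w)) + (phi (x + w) - phi x)).
    by apply/funext => x; rewrite [RHS]addrA subrK -addrA (addrC v).
  apply: le_trans (l2normD measurableT s3 sw) _; rewrite E big_cons; apply: lerD => //.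
  apply: le_trans (translate_axis i (z 0 i) tphi) _.
  by apply: ler_pM => //; exact: l2norm_ge0.
have := key (index_enum 'I_n); rewrite -row_sum_delta.
rewrite (_ : \sum_(i < n) (h * A) = n%:R * (h * A)) //.
by rewrite sumr_const card_ord mulr_natl.
Qed.

Lemma variance_section (Q : set V) f x : measurable Q -> (mu Q < +oo)%E ->
  square_integrable mu Q f ->
  (\int[mu]_(y in Q) (((f x - f y) ^+ 2)%R%:E) =
   (fine (mu Q) * f x ^+ 2 + ((-2 * \int[mu]_(y in Q) f y) * f x +
    \int[mu]_(y in Q) (f y ^+ 2)))%R%:E)%E.
Proof.
move=> mQ Qoo sf; have i1 := square_integrable_rintegrable mQ Qoo sf; have [mf i2] := sf.
set m := fine (mu Q); set a := Rintegral mu Q f; set b := Rintegral mu Q (fun x => f x ^+ 2).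
have ic k : rintegrable mu Q (fun=> k) by exact: rintegrable_cst.
have ie : rintegrable mu Q (fun y => f x ^+ 2 + ((-2 * f x) * f y + f y ^+ 2)).
  by apply: rintegrableD => //; apply: rintegrableD => //; exact: rintegrableZ.
transitivity (\int[mu]_(y in Q) ((f x ^+ 2 + ((-2 * f x) * f y + f y ^+ 2))%R%:E))%E.
  by apply: eq_integral => y _; congr EFin; ring.
rewrite -(@fineK _ (integral _ _ _)); last exact: integrable_fin_num.
congr EFin; rewrite -/(Rintegral mu Q (fun y => f x ^+ 2 + ((-2 * f x) * f y + f y ^+ 2))).
rewrite RintegralD//; [|exact: ic|by apply: rintegrableD => //; exact: rintegrableZ].
rewrite RintegralD//; last exact: rintegrableZ.
rewrite (RintegralZl (-2 * f x) mQ i1) (Rintegral_cst mu mQ (f x ^+ 2)) -/m -/a -/b.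
by move: (f x) => y; clearbody m a b; ring.
Qed.

(** It recovers the L^2 norm on a cube from squared differences and a single average: the Poincare
    inequality of the cube before any gradient appears. *)
Lemma variance_identity (Q : set V) f : measurable Q -> (mu Q < +oo)%E ->
  square_integrable mu Q f ->
  (\int[mu]_(x in Q) \int[mu]_(y in Q) (((f x - f y) ^+ 2)%R%:E) =
   (2 * fine (mu Q) * \int[mu]_(x in Q) (f x ^+ 2) - 2 * (\int[mu]_(x in Q) f x) ^+ 2)%R%:E)%E.
Proof.
move=> mQ Qoo sf; have i1 := square_integrable_rintegrable mQ Qoo sf; have [mf i2] := sf.
have inner x := variance_section x mQ Qoo sf; move: inner.
set m := fine (mu Q); set a := Rintegral mu Q f; set b := Rintegral mu Q (fun x => f x ^+ 2) => inner.
have ic k : rintegrable mu Q (fun=> k) by exact: rintegrable_cst.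
under eq_integral do rewrite inner.
have ie : rintegrable mu Q (fun x => m * f x ^+ 2 + ((-2 * a) * f x + b)).
  by apply: rintegrableD => //; [exact: rintegrableZ|apply: rintegrableD => //; exact: rintegrableZ].
rewrite -(@fineK _ (integral _ _ _)); last exact: integrable_fin_num.
congr EFin; rewrite -/(Rintegral mu Q (fun x => m * f x ^+ 2 + ((-2 * a) * f x + b))).
rewrite RintegralD//; [|exact: rintegrableZ|apply: rintegrableD => //; exact: rintegrableZ].
rewrite (RintegralD mQ (rintegrableZ mQ (-2 * a) i1) (ic b)).
rewrite (RintegralZl m mQ i2) (RintegralZl (-2 * a) mQ i1) (Rintegral_cst mu mQ b) -/m -/a -/b.
by clearbody m a b; ring.
Qed.

Definition sbox (h : R) : set V := [set z | forall i, `|z 0 i| < h].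

Lemma sboxE h : sbox h = obox (const_mx (- h)) (const_mx h).
Proof. by apply/seteqP; split => z hz i; have := hz i; rewrite !mxE ltr_norml. Qed.

Lemma measurable_sbox h : measurable (sbox h).
Proof. by rewrite sboxE; exact: measurable_obox. Qed.

Lemma mu_sbox (h : R) : 0 <= h -> mu (sbox h) = ((2 * h) ^+ n)%:E.
Proof.
move=> h0; rewrite sboxE mu_obox.
transitivity (\prod_(i < n) (2 * h)%:E)%E.
  apply: eq_bigr => i _; rewrite lebesgue_measure_itv /= !mxE lte_fin.
  case: ltP => hh; first by rewrite -EFinD; congr EFin; ring.
  by congr EFin; lra.
by rewrite prodEFin prodr_const card_ord.
Qed.

Definition sqdiff phi (x y : V) : \bar R := ((phi x - phi y) ^+ 2)%:E.

Lemma measurable_pair_add : measurable_fun setT (fun p : V * V => p.1 + p.2).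
Proof.
apply: measurable_row => i.
rewrite (_ : _ \o _ = fun p : V * V => p.1 0 i + p.2 0 i); last first.
  by apply/funext => p; rewrite /row_coord /= mxE.
apply: measurable_funD.
  exact: (measurableT_comp (measurable_coord i) measurable_fst).
exact: (measurableT_comp (measurable_coord i) measurable_snd).
Qed.

(* Its integral over the space is controlled by the gradient, and it dominates
   the variance of [phi] on every cube of side [h]. *)
Definition local_energy (h : R) phi (x : V) : \bar R :=
  (\int[mu]_z (sqdiff phi x (x + z) * (\1_(sbox h) z)%:E))%E.

Lemma measurable_sqdiff_add phi h : measurable_fun setT phi ->
  measurable_fun setT (fun p : V * V => sqdiff phi p.1 (p.1 + p.2) * (\1_(sbox h) p.2)%:E)%E.
Proof.
move=> mp; apply: emeasurable_funM.
  apply/measurable_EFinP; apply: measurable_funX; apply: measurable_funB.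
    by apply: measurableT_comp => //; exact: measurable_fst.
  by apply: measurableT_comp => //; exact: measurable_pair_add.
apply/measurable_EFinP; apply: (measurableT_comp _ measurable_snd).
by apply: measurable_indic; exact: measurable_sbox.
Qed.

Lemma sqdiff_ge0 phi x y : (0 <= sqdiff phi x y)%E.
Proof. by rewrite lee_fin sqr_ge0. Qed.

Lemma local_energy_ge0 h phi x : (0 <= local_energy h phi x)%E.
Proof.
by apply: integral_ge0 => z _; rewrite mule_ge0 ?sqdiff_ge0// lee_fin.
Qed.

Lemma measurable_local_energy h phi : measurable_fun setT phi ->
  measurable_fun setT (local_energy h phi).
Proof.
move=> mp.
have := @measurable_fun_fubini_tonelli_F _ _ V V R mu
  (fun p => sqdiff phi p.1 (p.1 + p.2) * (\1_(sbox h) p.2)%:E)%E (measurable_sqdiff_add h mp).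
by apply => p; rewrite mule_ge0 ?sqdiff_ge0// lee_fin.
Qed.

(** After exchanging the integrals, for fixed [z] the inner one is the squared L^2 norm of phi(x +
    z) - phi(x), bounded by [translate_bound], and [z] ranges over a cube of measure (2h)^n. *)
Lemma local_energy_bound phi (A h : R) : 0 <= h -> test_function Omega phi ->
  (forall i, nrm (partial i phi) <= A) ->
  (\int[mu]_x local_energy h phi x <= ((n%:R * (h * A)) ^+ 2 * (2 * h) ^+ n)%:E)%E.
Proof.
move=> h0 tphi hA; have mp : measurable_fun setT phi by exact: test_measurable tphi.
have sphi := test_square_setT oO bO tphi.
have -> : (\int[mu]_x local_energy h phi x =
    \int[mu]_z \int[mu]_x (sqdiff phi x (x + z) * (\1_(sbox h) z)%:E))%E.
  apply: (@fubini_tonelli _ _ V V R mu mu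
    (fun p => sqdiff phi p.1 (p.1 + p.2) * (\1_(sbox h) p.2)%:E)%E) => [|p].
    exact: measurable_sqdiff_add.
  by rewrite mule_ge0 ?sqdiff_ge0// lee_fin.
apply: (@le_trans _ _ (\int[mu]_z (((n%:R * (h * A)) ^+ 2 * \1_(sbox h) z)%:E))%E).
  apply: ge0_le_integral => //.
  - move=> z _; apply: integral_ge0 => x _; rewrite mule_ge0 ?sqdiff_ge0// lee_fin//.
  - have := @measurable_fun_fubini_tonelli_G _ _ V V R mu
      (fun p => sqdiff phi p.1 (p.1 + p.2) * (\1_(sbox h) p.2)%:E)%E (measurable_sqdiff_add h mp).
    by apply => p; rewrite mule_ge0 ?sqdiff_ge0// lee_fin.
  - apply/measurable_EFinP; apply: measurable_funM => //.
    by apply: measurable_indic; exact: measurable_sbox.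
  move=> z _; rewrite indicE; case: (boolP (z \in sbox h)) => [/set_mem hz|_]; last first.
    rewrite mulr0 integral0_eq// => x _; by rewrite mule0.
  rewrite mulr1; under eq_integral do rewrite mule1.
  have [s1 _] := square_translate z sphi; have [_ sz] := square_integrableB measurableT s1 sphi.
  rewrite (_ : integral _ _ _ = (\int[mu]_x (phi (x + z) - phi x) ^+ 2)%:E); last first.
    rewrite -[RHS]/((fine _)%:E) fineK; last exact: integrable_fin_num.
    by apply: eq_integral => x _; rewrite /sqdiff; congr EFin; ring.
  rewrite lee_fin -l2norm_sqr.
  have hb := translate_bound tphi hA (fun i => ltW (hz i)).
  by rewrite lerXn2r ?nnegrE ?l2norm_ge0// (le_trans _ hb)// l2norm_ge0.
rewrite (_ : integral _ _ _ = (((n%:R * (h * A)) ^+ 2)%:E * mu (sbox h))%E).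
  by rewrite mu_sbox.
under eq_integral do rewrite EFinM.
rewrite ge0_integralZl//; last 2 first.
- by apply/measurable_EFinP; apply: measurable_indic; exact: measurable_sbox.
- by rewrite lee_fin sqr_ge0.
by rewrite integral_indic ?setIT//; exact: measurable_sbox.
Qed.

(** Substitute y = x + z: the cube [Q] moved by -x lies in [sbox h]. *)
Lemma cube_energy (Q : set V) phi x h : measurable_fun setT phi -> measurable Q ->
  (forall y, Q y -> sbox h (y - x)) ->
  (\int[mu]_(y in Q) sqdiff phi x y <= local_energy h phi x)%E.
Proof.
move=> mp mQ hQ; rewrite integral_mkcond.
have mx : measurable_fun setT (sqdiff phi x).
  by apply/measurable_EFinP; apply: measurable_funX; apply: measurable_funB.
have mr : measurable_fun setT ((sqdiff phi x) \_ Q).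
  by apply/(measurable_restrictT _ _).1 => //; exact: measurable_funS mx.
rewrite -(ge0_integral_translate x)//; last first.
  by move=> y; rewrite patchE; case: ifP => // _; exact: sqdiff_ge0.
apply: ge0_le_integral => //.
- by move=> y _; rewrite patchE; case: ifP => // _; exact: sqdiff_ge0.
- by apply: (measurableT_comp mr); exact: measurable_translate.
- apply: emeasurable_funM.
    rewrite (_ : (fun y => sqdiff phi x (x + y)) = sqdiff phi x \o translate x); last first.
      by apply/funext => y; rewrite /translate /= addrC.
    by apply: (measurableT_comp mx); exact: measurable_translate.
  by apply/measurable_EFinP; apply: measurable_indic; exact: measurable_sbox.
move=> z _; rewrite patchE indicE; case: ifPn => [/set_mem /hQ|_].
  by rewrite addrK => hz; rewrite mem_set// mule1 (addrC x).
by rewrite mule_ge0 ?sqdiff_ge0// lee_fin.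
Qed.

End translations.

(** * Compactness in L^2 from averages over a grid *)

Section rellich.
Context {R : realType} {n : nat}.
Local Notation V := 'rV[R]_n.
Local Notation mu := (@lebesgue_row R n).
Implicit Types (f g phi psi : V -> R) (x y z : V).

(** Half-open sides make the cubes pairwise disjoint without leaving gaps; the finite index type
    provides finitely many averages. *)
Definition cube (a h : R) (L : nat) (c : {ffun 'I_n -> 'I_L}) : set V :=
  [set x | forall i, `[a + (c i)%:R * h, a + (c i).+1%:R * h[%classic (x 0 i)].

Section grid.
Variables (a h : R) (L : nat).
Hypothesis h0 : 0 < h.
Implicit Type c : {ffun 'I_n -> 'I_L}.

Lemma measurable_cube c : measurable (cube a h c).
Proof. by apply: (measurable_box (B := fun i => `[a + (c i)%:R * h, a + (c i).+1%:R * h[%classic)). Qed.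

Lemma mu_cube c : mu (cube a h c) = (h ^+ n)%:E.
Proof.
rewrite (@lebesgue_row_box _ _ (fun i => `[a + (c i)%:R * h, a + (c i).+1%:R * h[%classic))//.
transitivity (\prod_(i < n) h%:E)%E; last by rewrite prodEFin prodr_const card_ord.
apply: eq_bigr => i _; rewrite lebesgue_measure_itv /= lte_fin.
rewrite ltrD2l ltr_pM2r// ltr_nat leqnn -EFinD -natr1; congr EFin; ring.
Qed.

Lemma cube_inj c c' x : cube a h c x -> cube a h c' x -> c = c'.
Proof.
move=> hc hc'; apply/ffunP => i; apply/val_inj => /=.
have := hc i; have := hc' i; rewrite /= !in_itv /= => /andP[h1 h2] /andP[h3 h4].
have := le_lt_trans h1 h4; have := le_lt_trans h3 h2.
rewrite !ltrD2l !ltr_pM2r// !ltr_nat !ltnS => u v.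
by apply/eqP; rewrite eqn_leq u v.
Qed.

Lemma trivIset_cube (D : set {ffun 'I_n -> 'I_L}) : trivIset D (@cube a h L).
Proof.
apply/trivIsetP => c c' _ _ cc'; rewrite -subset0 => x [h1 h2].
by move/eqP: cc'; apply; exact: (cube_inj h1 h2).
Qed.

Lemma cube_cover x : (forall i, a <= x 0 i < a + L%:R * h) -> exists c, cube a h c x.
Proof.
move=> hx.
have tr i : let m := Num.truncn ((x 0 i - a) / h) in
    [&& (m < L)%N, a + m%:R * h <= x 0 i & x 0 i < a + m.+1%:R * h].
  have /andP[h1 h2] := hx i.
  have := truncn_itv (x := (x 0 i - a) / h); rewrite divr_ge0 ?subr_ge0 ?(ltW h0)// => /(_ isT).
  rewrite ler_pdivlMr// ltr_pdivrMr// => /andP[h3 h4] m.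
  rewrite -lerBrDl h3 -ltrBlDl h4 !andbT -(ltr_nat R) -(ltr_pM2r h0).
  by apply: le_lt_trans h3 _; rewrite ltrBlDl.
have lt i : (Num.truncn ((x 0 i - a) / h)%R < L)%N by case/and3P: (tr i).
exists [ffun i => Ordinal (lt i)] => i; rewrite /= in_itv /= ffunE /=.
by case/and3P: (tr i) => _ -> ->.
Qed.

End grid.

Section compactness.
Variable Omega : set V.
Hypotheses (oO : open Omega) (bO : bounded_set Omega).
Local Notation nrm := (l2norm mu setT).

(* A Poincare inequality on each cube, summed over the grid: up to an error of
   order h, the L^2 norm is controlled by finitely many averages. *)
Lemma grid_inequality (a h A : R) (L : nat) phi : 0 < h ->
  (forall x, Omega x -> forall i, a <= x 0 i < a + L%:R * h) ->
  test_function Omega phi -> (forall i, nrm (partial i phi) <= A) ->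
  2 * h ^+ n * (\int[mu]_x (phi x ^+ 2)) <=
  (n%:R * (h * A)) ^+ 2 * (2 * h) ^+ n +
  2 * \sum_(c : {ffun 'I_n -> 'I_L}) (\int[mu]_(x in cube a h c) phi x) ^+ 2.
Proof.
move=> h0 hO tphi hA; have sphi := test_square_setT oO bO tphi.
have mp : measurable_fun setT phi by exact: test_measurable tphi.
have mc (c : {ffun 'I_n -> 'I_L}) := measurable_cube a h c.
have fc (c : {ffun 'I_n -> 'I_L}) : (mu (cube a h c) < +oo)%E by rewrite mu_cube// ltry.
have sc (c : {ffun 'I_n -> 'I_L}) : square_integrable mu (cube a h c) phi.
  split; first exact: measurable_funS mp.
  exact: (integrableS measurableT (mc c) (@subsetT _ _) sphi.2).
pose D := \big[setU/set0]_(c : {ffun 'I_n -> 'I_L}) cube a h c.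
have mD : measurable D by apply: bigsetU_measurable => c _; exact: mc.
have OD : Omega `<=` D.
  move=> x /hO/(cube_cover h0)[c hc]; rewrite /D -bigcup_seq; exists c => //=.
  exact: mem_index_enum.
have E1 : \int[mu]_x (phi x ^+ 2) =
    \sum_(c : {ffun 'I_n -> 'I_L}) \int[mu]_(x in cube a h c) (phi x ^+ 2).
  rewrite (rint_support (A := D))//; last first.
    by move=> x _ nD; rewrite (test_zero tphi) ?expr0n// => /OD.
  apply: EFin_inj; rewrite -sumEFin /Rintegral fineK; last first.
    by apply: integrable_fin_num => //; exact: (integrableS measurableT mD (@subsetT _ _) sphi.2).
  rewrite /D (@ge0_integral_bigsetU _ _ _ mu _ (@cube a h L) (fun x => (phi x ^+ 2)%:E) (index_enum _))//.
  - apply: eq_bigr => c _; rewrite fineK//; apply: integrable_fin_num => //.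
    by case: (sc c).
  - exact: index_enum_uniq.
  - exact: trivIset_cube.
  - apply/measurable_EFinP; apply: measurable_funX; apply: measurable_funS mp => //.
  - by move=> x _; rewrite lee_fin sqr_ge0.
(* The cubes are disjoint and each inner integral is at most the local energy at x, so the sum is at
   most the total local energy. *)
have E2 : (\sum_(c : {ffun 'I_n -> 'I_L}) \int[mu]_(x in cube a h c) \int[mu]_(y in cube a h c)
    (((phi x - phi y) ^+ 2)%R%:E) <= ((n%:R * (h * A)) ^+ 2 * (2 * h) ^+ n)%:E)%E.
  apply: le_trans (local_energy_bound oO bO (ltW h0) tphi hA).
  have me := measurable_local_energy h mp.
  apply: (@le_trans _ _ (\int[mu]_(x in D) local_energy h phi x)%E); last first.
    by apply: ge0_subset_integral => // x _; exact: local_energy_ge0.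
  rewrite /D (@ge0_integral_bigsetU _ _ _ mu _ (@cube a h L) (local_energy h phi) (index_enum _))//.
  - apply: lee_sum => c _; apply: ge0_le_integral => //.
    + by move=> x _; apply: integral_ge0 => y _; rewrite lee_fin sqr_ge0.
    + have [mf _] := sc c.
      rewrite (funext (fun x => variance_section x (mc c) (fc c) (sc c))).
      apply/measurable_EFinP; apply: measurable_funD.
        by apply: measurable_funM => //; exact: measurable_funX.
      by apply: measurable_funD => //; exact: measurable_funM.
    + exact: measurable_funS me.
    + move=> x cx; apply: cube_energy => // y cy i.
      have := cx i; have := cy i; rewrite /= !in_itv /= !mxE -natr1 => /andP[h1 h2] /andP[h3 h4].
      by rewrite ltr_norml; apply/andP; split; lra.
  - exact: index_enum_uniq.
  - exact: trivIset_cube.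
  - exact: measurable_funS me.
  - by move=> x _; exact: local_energy_ge0.
move: E2; under eq_bigr do rewrite variance_identity//.
rewrite sumEFin lee_fin E1 => hE; rewrite -lerBlDr; apply: le_trans hE.
rewrite !mulr_sumr -sumrB; apply: ler_sum => c _.
by rewrite mu_cube.
Qed.

(** Compactness of [-C, C] gives [b] a cluster point along [U], and an ultrafilter converges to each
    of its cluster points. *)
Lemma ultra_cauchy (U : set_system nat) (b : nat -> R) (C e : R) : UltraFilter U ->
  (forall k, `|b k| <= C) -> 0 < e -> exists2 S, U S & forall j k, S j -> S k -> `|b j - b k| <= e.
Proof.
move=> UU hb e0.
have PU : ProperFilter (b @ U) by exact: fmap_proper_filter.
have IU : (b @ U) `[- C, C]%classic.
  rewrite /nbhs /= (_ : b @^-1` `[- C, C]%classic = setT); first exact: filterT.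
  by apply/seteqP; split => // k _; rewrite /= in_itv /= -ler_norml; exact: hb.
have [l [_ hl]] := @segment_compact R (- C) C _ PU IU.
have e2 : 0 < e / 2 by rewrite divr_gt0.
exists [set k | `|l - b k| < e / 2].
  have [//|nU] := in_ultra_setVsetC [set k | `|l - b k| < e / 2] UU.
  have h1 : (b @ U) (~` ball l (e / 2)) by exact: nU.
  have h2 : nbhs l (ball l (e / 2)) by exact: nbhsx_ballx.
  by have [y [h3 h4]] := hl _ _ h1 h2; case: h3.
move=> j k /= h1 h2; rewrite (_ : b j - b k = (l - b k) - (l - b j)); last by ring.
by apply: le_trans (ler_normB _ _) _; rewrite (splitr e) lerD// ltW.
Qed.

Lemma ultra_cauchy_fin (J : finType) (U : set_system nat) (b : J -> nat -> R) (C e : R) :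
  UltraFilter U -> (forall c k, `|b c k| <= C) -> 0 < e ->
  exists2 S, U S & forall j k, S j -> S k -> forall c, `|b c j - b c k| <= e.
Proof.
move=> UU hb e0.
have h c : exists S, U S /\ forall j k, S j -> S k -> `|b c j - b c k| <= e.
  by have [S US hS] := ultra_cauchy UU (hb c) e0; exists S.
have [S hS] := choice h.
exists [set k | forall c, S c k] => [|j k hj hk c]; last exact: (hS c).2.
by apply: filter_forall => c; exact: (hS c).1.
Qed.

(* Along an ultrafilter all the averages over all the grids converge at once, so
   that no diagonal extraction is needed. *)
Lemma test_precompact (A : R) (phi : nat -> V -> R) : 0 <= A -> (forall k, test_function Omega (phi k)) ->
  (forall k, nrm (phi k) <= A) -> (forall k i, nrm (partial i (phi k)) <= A) ->
  exists2 sigma : nat -> nat, (forall k, (sigma k < sigma k.+1)%N) &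
    forall e, 0 < e -> exists m, forall j k, (m <= j)%N -> (m <= k)%N ->
      \int[mu]_x ((phi (sigma j) x - phi (sigma k) x) ^+ 2) <= e.
Proof.
move=> A0 tphi h0 h1.
have [U [UU ooU]] := @ultraFilterLemma nat \oo _.
have key m : exists S, U S /\ forall j k, S j -> S k ->
    \int[mu]_x ((phi j x - phi k x) ^+ 2) <= m.+1%:R^-1.
  set e := m.+1%:R^-1; have e0 : 0 < e by rewrite invr_gt0.
  have [K hK] := bounded_sub_obox bO.
  have [L [h [hp hO hh]]] : exists L h, [/\ 0 < h,
      (forall x, Omega x -> forall i, - K%:R <= x 0 i < - K%:R + L%:R * h) &
      (n%:R * (h * (2 * A))) ^+ 2 * 2 ^+ n <= e].
    (* The energy error for side [h] is h^2 D, with [2 * A] because the grid inequality is applied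
       to differences of two members. The choice h^2 = e / (D + 1) makes it at most e and also
       covers D = 0. *)
    pose D : R := (n%:R * (2 * A)) ^+ 2 * 2 ^+ n.
    have D0 : 0 <= D by rewrite mulr_ge0 ?sqr_ge0// exprn_ge0.
    have D1 : 0 < D + 1 by rewrite ltr_wpDl.
    pose h := Num.sqrt (e / (D + 1)).
    have h2 : h ^+ 2 = e / (D + 1) by rewrite sqr_sqrtr// divr_ge0// ltW.
    have hp : 0 < h by rewrite sqrtr_gt0 divr_gt0.
    exists (Num.truncn (2 * K%:R / h)).+1, h; split => //.
      move=> x /hK xK i; have := xK i; rewrite !mxE => /andP[x1 x2]; rewrite (ltW x1)/=.
      apply: lt_trans x2 _; rewrite -ltrBlDl opprK (_ : K%:R + K%:R = 2 * K%:R); last ring.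
      by rewrite -ltr_pdivrMr// truncnS_gt.
    rewrite (_ : _ * _ = h ^+ 2 * D); last by rewrite /D; ring.
    by rewrite h2 mulrAC ler_pdivrMr// ler_wpM2l ?(ltW e0)// lerDl.
  pose b (c : {ffun 'I_n -> 'I_L}) k := \int[mu]_(x in cube (- K%:R) h c) phi k x.
  have sk k := test_square_setT oO bO (tphi k).
  have cubeP (c : {ffun 'I_n -> 'I_L}) k : [/\ measurable (cube (- K%:R) h c),
      (mu (cube (- K%:R) h c) < +oo)%E & square_integrable mu (cube (- K%:R) h c) (phi k)].
    have mQ := measurable_cube (- K%:R) h c.
    split => //; first by rewrite mu_cube// ltry.
    split; first exact: measurable_funS (sk k).1.
    exact: (integrableS measurableT mQ (@subsetT _ _) (sk k).2).
  have hb c k : `|b c k| <= A * Num.sqrt (h ^+ n).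
    have [mQ Qoo sQ] := cubeP c k.
    apply: le_trans (le_normr_Rintegral mQ (square_integrable_rintegrable mQ Qoo sQ)) _.
    apply: le_trans (rint_norm_l2norm mQ Qoo sQ) _.
    have -> : fine (mu (cube (- K%:R) h c)) = h ^+ n by exact: (congr1 fine (mu_cube _ hp c)).
    rewrite ler_wpM2r ?sqrtr_ge0// (le_trans _ (h0 k))//.
    rewrite /l2norm ler_wsqrtr// /Rintegral fine_le//.
    - by apply: integrable_fin_num => //; exact: sQ.2.
    - by apply: integrable_fin_num => //; exact: (sk k).2.
    - apply: ge0_subset_integral => //; last by move=> x _; rewrite lee_fin sqr_ge0.
      by apply/measurable_EFinP; apply: measurable_funX; exact: (sk k).1.
  pose N : R := #|{ffun 'I_n -> 'I_L}|%:R.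
  (* Over all [N] cubes the squared differences of averages then sum to at most e h^n / 2. The grid
     inequality becomes 2 h^n int psi^2 <= e h^n + e h^n. *)
  pose eta := Num.sqrt (e * h ^+ n / (2 * (N + 1))).
  have eta0 : 0 < eta.
    rewrite sqrtr_gt0 divr_gt0 ?mulr_gt0 ?exprn_gt0//.
    by rewrite ltr_wpDl// ler0n.
  have [S US hS] := ultra_cauchy_fin UU hb eta0.
  exists S; split => // j k Sj Sk.
  pose psi x := phi j x - phi k x.
  have psiE : psi = (fun x => phi j x + -1 * phi k x).
    by apply/funext => x; rewrite mulN1r.
  have tpsi : test_function Omega psi by rewrite psiE; exact: testD (testZ _ _).
  have dpsi i : nrm (partial i psi) <= 2 * A.
    have -> : partial i psi = (fun x => partial i (phi j) x - partial i (phi k) x).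
      apply/funext => x; apply: deriveB.
        exact: smooth_derivable (test_smooth (tphi j)).
      exact: smooth_derivable (test_smooth (tphi k)).
    apply: le_trans (l2normB measurableT _ _) _.
    - exact: (test_square_setT oO bO (test_partial i (tphi j))).
    - exact: (test_square_setT oO bO (test_partial i (tphi k))).
    by rewrite mulrDl mul1r lerD.
  have := grid_inequality hp hO tpsi dpsi.
  have hn : 0 < h ^+ n by rewrite exprn_gt0.
  have : \sum_(c : {ffun 'I_n -> 'I_L}) (\int[mu]_(x in cube (- K%:R) h c) psi x) ^+ 2 <= N * eta ^+ 2.
    rewrite /N mulr_natl -sumr_const; apply: ler_sum => c _.
    have [mQ Qoo sj] := cubeP c j; have [_ _ sk'] := cubeP c k.
    rewrite RintegralB//; [|exact: square_integrable_rintegrable..].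
    have := hS _ _ Sj Sk c; rewrite -/(b c j) -/(b c k) => hc.
    by rewrite -(real_normK (num_real (b c j - b c k))) lerXn2r ?nnegrE ?(ltW eta0).
  have -> : eta ^+ 2 = e * h ^+ n / (2 * (N + 1)).
    by rewrite sqr_sqrtr// divr_ge0 ?mulr_ge0 ?(ltW e0) ?(ltW hn)// addr_ge0// ler0n.
  have N0 : 0 <= N by exact: ler0n.
  have Ne : N * (e * h ^+ n / (2 * (N + 1))) <= e * h ^+ n / 2.
    rewrite (_ : e * h ^+ n / (2 * (N + 1)) = e * h ^+ n / 2 / (N + 1)); last first.
      have nz : N + 1 != 0 by rewrite gt_eqF// ltr_wpDl.
      by clearbody N; field.
    have q0 : 0 <= e * h ^+ n / 2 by rewrite divr_ge0// mulr_ge0// ltW.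
    by rewrite mulrCA ler_piMr// ler_pdivrMr ?mul1r ?lerDl// ltr_wpDl.
  move=> h2 h3.
  have h4 : (n%:R * (h * (2 * A))) ^+ 2 * (2 * h) ^+ n <= e * h ^+ n.
    by have := ler_wpM2r (ltW hn) hh; rewrite -mulrA -[2 ^+ n * _]exprMn.
  rewrite -(ler_pM2l hn) -(ler_pM2l (ltr0n R 2)) mulrA.
  apply: le_trans h3 _; apply: le_trans (lerD h4 (ler_wpM2l (ler0n R 2) (le_trans h2 Ne))) _.
  by move: (h ^+ n) => q; lra.
have [S hS] := choice key.
(* [U] contains every tail and is stable under finite intersections, so a single index beyond [K]
   lies in [S 0], ..., [S m]. *)
have pick m K : exists k, (K < k)%N /\ forall i, (i <= m)%N -> S i k.
  have : U [set k | forall i : 'I_m.+1, S i k].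
    by apply: filter_forall => i; exact: (hS i).1.
  have /ooU UK : \oo [set k | (K < k)%N] by exists K.+1.
  move=> UT; have [k [/= h2 h3]] := filter_ex (filterI UK UT).
  by exists k; split => // i im; have := h3 (Ordinal (im : (i < m.+1)%N)).
have [g hg] := choice (fun p : nat * nat => pick p.1 p.2).
pose sigma := fix s m := if m is m'.+1 then g (m, s m') else g (0, 0)%N.
have sS m : forall i, (i <= m)%N -> S i (sigma m).
  by case: m => [|m]; [exact: (hg (0, 0)%N).2|exact: (hg (m.+1, sigma m)).2].
exists sigma => [k|e e0]; first exact: (hg (k.+1, sigma k)).1.
pose m := Num.truncn e^-1; exists m => j k mj mk.
apply: le_trans ((hS m).2 _ _ (sS _ _ mj) (sS _ _ mk)) _.
by rewrite -[leRHS]invrK lef_pV2 ?posrE ?invr_gt0 ?ltr0n// ltW// truncnS_gt.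
Qed.

End compactness.
End rellich.

(** * Inequalities for powers *)

Section powers.
Context {R : realType}.
Implicit Types (x y t h r p : R).

(* Young's inequality, i.e. convexity of the r-th power at y. *)
Lemma powR_tangent r x y : 1 < r -> 0 <= x -> 0 <= y ->
  r * y `^ (r - 1) * x <= x `^ r + (r - 1) * y `^ r.
Proof.
move=> r1 x0 y0; have r0 : 0 < r by lra.
have q0 : 0 < r - 1 by lra.
have /(_ _) := @conjugate_powR R x (y `^ (r - 1)) r (r / (r - 1)) x0 (powR_ge0 _ _) r0 (divr_gt0 r0 q0).
have rn : r != 0 by rewrite gt_eqF.
have qn : r - 1 != 0 by rewrite gt_eqF.
rewrite -powRrM (_ : (r - 1) * (r / (r - 1)) = r); last by field.
move=> H; have {}H : x * y `^ (r - 1) <= x `^ r / r + y `^ r / (r / (r - 1)).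
  by apply: H; field; rewrite rn qn.
rewrite -(ler_pM2l r0) in H; apply: le_trans (_ : r * (x * y `^ (r - 1)) <= _).
  by rewrite mulrAC mulrA.
apply: le_trans H _; rewrite le_eqVlt; apply/orP; left; apply/eqP.
by field; rewrite rn qn.
Qed.

Lemma powR_sub_le r x y : 1 < r -> 0 <= x -> 0 <= y ->
  y `^ r - x `^ r <= r * y `^ (r - 1) * (y - x).
Proof.
move=> r1 x0 y0; have := powR_tangent r1 x0 y0.
have : y * y `^ (r - 1) = y `^ r by apply: mulr_powRB1 => //; lra.
by move: (y `^ (r - 1)) => w <-; nra.
Qed.

Lemma powR_le1D r p x : 0 <= r -> r <= p -> 0 <= x -> x `^ r <= 1 + x `^ p.
Proof.
move=> r0 rp x0; have := powR_ge0 x p; case: (lerP x 1) => x1.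
  have : x `^ r <= 1 `^ r by rewrite ge0_ler_powR ?nnegrE.
  by rewrite powR1; lra.
by have := ler_powR (ltW x1) rp; lra.
Qed.

Lemma powR_mixed p x y : 1 < p -> 0 <= x -> 0 <= y -> x `^ (p - 1) * y <= x `^ p + y `^ p.
Proof.
move=> p1 x0 y0; have p0 : 0 < p by lra.
have := powR_ge0 x p; have := powR_ge0 y p; case: (lerP y x) => xy.
  have : x `^ (p - 1) * y <= x `^ p.
    by rewrite -(mulr_powRB1 x0 p0) mulrC ler_wpM2r// powR_ge0.
  lra.
have : x `^ (p - 1) * y <= y `^ p.
  rewrite -(mulr_powRB1 y0 p0) mulrC ler_wpM2l// ge0_ler_powR ?nnegrE ?(ltW xy)//; lra.
lra.
Qed.

Lemma powR_add_le p x y : 0 <= p -> 0 <= x -> 0 <= y ->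
  (x + y) `^ p <= 2 `^ p * (x `^ p + y `^ p).
Proof.
move=> p0 x0 y0; have hx := powR_ge0 x p; have hy := powR_ge0 y p.
have h2 := powR_ge0 (2 : R) p.
wlog xy : x y x0 y0 hx hy / x <= y.
  move=> W; case: (lerP x y) => xy; first exact: W.
  by rewrite addrC (addrC (x `^ p)); apply: W => //; exact: ltW.
apply: (@le_trans _ _ ((2 * y) `^ p)).
  by rewrite ge0_ler_powR ?nnegrE ?addr_ge0 ?mulr_ge0//; lra.
by rewrite powRM// ler_wpM2l// lerDr.
Qed.

Definition excess t := Num.max (t - 1) 0.

Lemma excessE t : (1 <= t /\ excess t = t - 1) \/ (t < 1 /\ excess t = 0).
Proof.
rewrite /excess; case: (lerP (t - 1) 0) => h; last by left; split; lra.
by case: (lerP 1 t) => h'; [left; split; lra|right].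
Qed.

Lemma excess_ge0 t : 0 <= excess t.
Proof. by rewrite /excess le_max lexx orbT. Qed.

Lemma excess_le t : excess t <= `|t|.
Proof. by have [[h ->]|[h ->]] := excessE t; rewrite ?normr_ge0//; apply: le_trans (ler_norm t); lra. Qed.

Lemma excess_second_order t h :
  `|excess (t + h) ^+ 2 - excess t ^+ 2 - 2 * excess t * h| <= 2 * h ^+ 2.
Proof.
rewrite ler_norml; have [[h1 ->]|[h1 ->]] := excessE t; have [[h2 ->]|[h2 ->]] := excessE (t + h);
  by apply/andP; split; nra.
Qed.

(** Write a and b for the excess at t and t + h. Convexity at t makes the remainder nonnegative, and
    convexity at t + h bounds it by p (b^{p-1} - a^{p-1}) h. As p > 2, the power p - 1 is convex
    too, and its tangent inequality gives the second factor [h]. *)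
Lemma excess_powR_second_order p t h : 2 < p ->
  `|excess (t + h) `^ p - excess t `^ p - p * excess t `^ (p - 1) * h| <=
  p * (p - 1) * (`|t| + `|h|) `^ (p - 2) * h ^+ 2.
Proof.
move=> p2.
have key (s k : R) : 0 <= excess (s + k) `^ p - excess s `^ p - p * excess s `^ (p - 1) * k.
  have a0 := excess_ge0 s; have b0 := excess_ge0 (s + k).
  have := powR_sub_le (ltac:(lra) : 1 < p) b0 a0.
  have q0 := powR_ge0 (excess s) (p - 1).
  have : 0 <= p * excess s `^ (p - 1) * (excess (s + k) - excess s - k).
    have [[h1 e1]|[h1 e1]] := excessE s.
      by rewrite mulr_ge0// ?mulr_ge0//; [lra|]; have [[h2 ->]|[h2 ->]] := excessE (s + k); lra.
    by rewrite e1 powR0 ?mulr0 ?mul0r//; lra.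
  by move: (excess s `^ (p - 1)) (excess (s + k)) (excess s) => A b c; lra.
rewrite ger0_norm//; set a := excess t; set b := excess (t + h).
have h1 := key t h; have := key (t + h) (- h); rewrite addrK -/a -/b => h2.
have ab : `|b - a| <= `|h|.
  rewrite /a /b; have [[u1 ->]|[u1 ->]] := excessE t; have [[u2 ->]|[u2 ->]] := excessE (t + h);
  rewrite ler_norml; have := ler_norm h; have := ler_norm (- h); rewrite normrN => v1 v2; apply/andP; split; lra.
have a0 : 0 <= a by exact: excess_ge0. have b0 : 0 <= b by exact: excess_ge0.
have hm : b <= `|t| + `|h| by apply: le_trans (excess_le _) (ler_normD _ _).
have ha : a <= `|t| + `|h| by apply: le_trans (excess_le _) _; rewrite lerDl.
set m := `|t| + `|h| in hm ha *.
have m0 : 0 <= m by exact: le_trans ha.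
have diff (c d : R) : 0 <= c -> 0 <= d -> d <= m -> `|d - c| <= `|h| ->
    d `^ (p - 1) - c `^ (p - 1) <= (p - 1) * m `^ (p - 2) * `|h|.
  move=> c0 d0 dm dc; have := powR_sub_le (ltac:(lra) : 1 < p - 1) c0 d0.
  rewrite (_ : p - 1 - 1 = p - 2); last ring.
  move=> H; apply: le_trans H _.
  have mo : d `^ (p - 2) <= m `^ (p - 2) by rewrite ge0_ler_powR ?nnegrE//; lra.
  apply: le_trans (_ : (p - 1) * d `^ (p - 2) * `|h| <= _).
    rewrite ler_wpM2l ?mulr_ge0 ?powR_ge0//; first lra.
    by apply: le_trans dc; exact: ler_norm.
  by rewrite ler_wpM2r// ler_wpM2l//; lra.
have d1 := diff _ _ a0 b0 hm ab; have := diff b a b0 a0 ha; rewrite distrC => /(_ ab) d2.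
apply: le_trans (_ : p * ((b `^ (p - 1) - a `^ (p - 1)) * h) <= _).
  by move: h1 h2; move: (a `^ (p-1)) (b `^ (p-1)) (a `^ p) (b `^ p) => A1 B1 A B; lra.
rewrite -[leRHS]mulrA -[leRHS]mulrA ler_wpM2l//; first lra.
apply: le_trans (_ : (p - 1) * m `^ (p - 2) * `|h| * `|h| <= _); last first.
  by rewrite -[X in X <= _]mulrA -expr2 real_normK ?num_real// -mulrA.
apply: le_trans (ler_norm _) _; rewrite normrM ler_wpM2r// ler_norml.
by apply/andP; split => //; move: d2; lra.
Qed.

(** The factor v^2 is absorbed by the power p - 2, which leaves s^2 times p-th powers that do not
    depend on s and are integrable for Sobolev functions. *)
Lemma excess_powR_scaled p t v (s : R) : 2 < p -> `|s| <= 1 ->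
  `|excess (t + s * v) `^ p - excess t `^ p - p * excess t `^ (p - 1) * (s * v)| <=
  p * (p - 1) * 2 `^ p * (`|t| `^ p + `|v| `^ p) * s ^+ 2.
Proof.
move=> p2 s1; apply: le_trans (excess_powR_second_order t (s * v) p2) _.
have sv : `|s * v| <= `|v| by rewrite normrM ler_piMl.
have m0 : 0 <= `|t| + `|v| by rewrite addr_ge0.
have h1 : (`|t| + `|s * v|) `^ (p - 2) <= (`|t| + `|v|) `^ (p - 2).
  have p20 : 0 <= p - 2 by lra.
  by rewrite (ge0_ler_powR p20) ?nnegrE ?lerD2l// addr_ge0.
have h2 : v ^+ 2 <= (`|t| + `|v|) ^+ 2.
  by rewrite -(real_normK (num_real v)) lerXn2r ?nnegrE// lerDr.
have h3 : (`|t| + `|v|) ^+ 2 * (`|t| + `|v|) `^ (p - 2) = (`|t| + `|v|) `^ p.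
  rewrite expr2 -mulrA (_ : p - 2 = p - 1 - 1); last ring.
  by rewrite mulr_powRB1//; [rewrite mulr_powRB1//; lra|lra].
have h4 := powR_add_le (ltac:(lra) : 0 <= p) (normr_ge0 t) (normr_ge0 v).
have h5 : v ^+ 2 * (`|t| + `|s * v|) `^ (p - 2) <= 2 `^ p * (`|t| `^ p + `|v| `^ p).
  by apply: le_trans h4; rewrite -h3; apply: ler_pM; rewrite ?sqr_ge0 ?powR_ge0.
have pp : 0 <= p * (p - 1) by nra.
rewrite exprMn.
have := ler_wpM2l (mulr_ge0 pp (sqr_ge0 s)) h5.
by congr (_ <= _); ring.
Qed.

Lemma lipschitz_second_order (F f : R -> R) (L t h : R) :
  (forall t : R, is_derive (t : R) (1 : R) F (f t)) -> (forall s t, `|f s - f t| <= L * `|s - t|) ->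
  `|F (t + h) - F t - f t * h| <= L * h ^+ 2.
Proof.
move=> dF Lf; have [c hc ->] := MVT_is_derive (t) (t + h) dF.
rewrite (_ : t + h - t = h); last ring.
rewrite -mulrBl normrM.
have L0 : 0 <= L by have := Lf 1 0; rewrite subr0 normr1 mulr1; apply: le_trans.
have ct : `|c - t| <= `|h|.
  move: hc; rewrite ler_norml; case: (leP t (t + h)) => th /andP[c1 c2];
  have := ler_norm h; have := ler_norm (- h); rewrite normrN => *; apply/andP; split; lra.
rewrite -(real_normK (num_real h)) expr2 mulrA ler_wpM2r//.
by apply: le_trans (Lf _ _) _; rewrite ler_wpM2l.
Qed.

Lemma quadratic_bound (a b N : R) : 0 <= a -> 0 <= b -> 0 <= N -> N ^+ 2 <= a + b * N ->
  N <= a + b + 1.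
Proof.
move=> a0 b0 N0 h; rewrite leNgt; apply/negP => hh.
have N1 : 1 <= N by lra.
nra.
Qed.

(* The system satisfied by q = int (u-1)_+^p, j = J(u), f = J'(u)(cutoff u),
   D = int |grad u|^2, U = int u^2 and N = |u|_{H^1}. *)
Lemma coercive_system (K m r l k C : R) : 0 <= K -> 0 <= m -> 0 < r -> 0 <= l -> 0 <= k -> 0 <= C ->
  exists A : R, forall q j f D P U N, 0 <= N -> - f <= K * N -> j = 2^-1 * D + P ->
    - (l * (m + q) + k * q) <= P -> j <= K -> U <= C * D -> N ^+ 2 = U + D ->
    r * 2 * q <= j - 2^-1 * f + m + r * (m + q) -> N <= A.
Proof.
move=> K0 m0 r0 hl hk C0.
(* Half of [r * 2 * q] cancels [r * q], leaving r q <= K + m + r m + (K/2) N. Then [F1] and [F2]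
   come from D = 2 (j - P) and N^2 <= (C + 1) D. *)
pose E1 := (K + m + r * m) / r; pose E2 := K / 2 / r.
have E10 : 0 <= E1 by rewrite divr_ge0 ?(ltW r0)// !addr_ge0// mulr_ge0// ltW.
have E20 : 0 <= E2 by rewrite divr_ge0 ?(ltW r0)// divr_ge0.
have lk : 0 <= l + k by rewrite addr_ge0.
pose F1 := (C + 1) * 2 * (K + l * m + (l + k) * E1).
pose F2 := (C + 1) * 2 * ((l + k) * E2).
have c0 : 0 <= (C + 1) * 2 by lra.
have F10 : 0 <= F1 by rewrite (mulr_ge0 c0)// addr_ge0 ?(mulr_ge0 lk)// addr_ge0// mulr_ge0.
have F20 : 0 <= F2 by rewrite (mulr_ge0 c0)// mulr_ge0.
exists (F1 + F2 + 1) => q j f D P U N N0 fv JE PE Ju hU hN hE.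
have hq : q <= E1 + E2 * N.
  rewrite -(ler_pM2l r0) mulrDr /E1 /E2 mulrC -(mulrC _ r) divfK ?gt_eqF//.
  rewrite (_ : r * (K / 2 / r * N) = K / 2 * N); last by field; rewrite gt_eqF.
  lra.
have hD : D <= 2 * (K + l * m + (l + k) * (E1 + E2 * N)).
  by have := ler_wpM2l lk hq; lra.
apply: quadratic_bound => //.
have C1 : 0 <= C + 1 by rewrite addr_ge0.
rewrite hN; apply: le_trans (_ : (C + 1) * D <= _); first by rewrite mulrDl mul1r lerD2r.
apply: le_trans (ler_wpM2l C1 hD) _.
by rewrite le_eqVlt /F1 /F2; apply/orP; left; apply/eqP; ring.
Qed.

End powers.

(** * The fundamental lemma of the calculus of variations *)

(** The primitive of [beta] is such a step. It enters the functional, and it also builds the bumps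
    of the fundamental lemma and the derivative of the smooth [cutoff]. *)
Definition smooth_step {R : realType} (B : R -> R) :=
  [/\ smooth1 B, forall t, t <= 0 -> B t = 0, forall t, 1 <= t -> B t = 1 &
      forall t, 0 <= B t <= 1].

Section fundamental_lemma.
Context {R : realType} {n : nat}.
Local Notation V := 'rV[R]_n.
Local Notation mu := (@lebesgue_row R n).
Implicit Types (f g phi psi : V -> R) (x a b : V) (Omega : set V).

Definition cbox a b : set V := [set x | forall i, a 0 i <= x 0 i <= b 0 i].

Lemma cboxE a b : cbox a b = [set x | forall i, `[a 0 i, b 0 i]%classic (x 0 i)].
Proof. by apply/seteqP; split => x h i; have := h i; rewrite /= in_itv. Qed.

Lemma compact_cbox a b : compact (cbox a b).
Proof.
rewrite cboxE; apply: (@rV_compact _ _ (fun i => `[a 0 i, b 0 i]%classic)) => i.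
exact: segment_compact.
Qed.

Lemma closed_cbox a b : closed (cbox a b).
Proof. by apply: compact_closed (@compact_cbox a b); exact: norm_hausdorff. Qed.

Lemma obox_cbox a b : obox a b `<=` cbox a b.
Proof. by move=> x h i; have /andP[/ltW -> /ltW ->] := h i. Qed.

(** The corners are rational and enumerated by a sequence, so that statements valid almost
    everywhere on each box can be combined. *)
Lemma open_obox_cover (A : set V) : open A ->
  exists a b : nat -> V, forall x, A x ->
    exists k, obox (a k) (b k) x /\ cbox (a k) (b k) `<=` A.
Proof.
move=> oA.
pose p k : 'rV[rat]_n * 'rV[rat]_n := odflt (0, 0) (unpickle k).
exists (fun k => map_mx ratr (p k).1), (fun k => map_mx ratr (p k).2) => x Ax.
have [e /= e0 xeA] := (nbhs_ballP x A).1 (open_nbhs_nbhs (conj oA Ax)).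
have hq i : exists q : rat, ratr q \in `](x 0 i - e), (x 0 i)[.
  by apply: rat_in_itvoo; rewrite ltrBlDr ltrDl.
have hr i : exists q : rat, ratr q \in `](x 0 i), (x 0 i + e)[.
  by apply: rat_in_itvoo; rewrite ltrDl.
have [q hq'] := choice hq; have [r hr'] := choice hr.
exists (pickle (\row_i q i, \row_i r i)); rewrite /p pickleK /=; split.
  move=> i; rewrite !mxE; have := hq' i; have := hr' i; rewrite !in_itv /=.
  by move=> /andP[-> _] /andP[_ ->].
move=> y By; apply: xeA; rewrite -obox_ball// => i; have := By i; rewrite !mxE.
have := hq' i; have := hr' i; rewrite !in_itv /=.
by move=> /andP[h1 h2] /andP[h3 h4] /andP[h5 h6]; rewrite (lt_le_trans h3 h5) (le_lt_trans h6 h2).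
Qed.

Section bump.
Variables (B : R -> R) (stB : smooth_step B).

Definition bump_side (k : R) a b (i : 'I_n) x : R :=
  B (k * (x 0 i - a 0 i)) * B (k * (b 0 i - x 0 i)).

(** A smooth approximation of the indicator of [obox a b], to which it converges pointwise as k
    tends to infinity. *)
Definition bump (k : R) a b x : R := \prod_(i < n) bump_side k a b i x.

Lemma smooth_expr_prod (J : Type) (s : seq J) (F : J -> V -> R) :
  (forall j, smooth_expr (F j)) -> smooth_expr (fun x => \prod_(j <- s) F j x).
Proof.
move=> hF; elim: s => [|j s IH].
  rewrite (_ : (fun _ => _) = fun=> 1); first exact: SmoothCst.
  by apply/funext => x; rewrite big_nil.
rewrite (_ : (fun _ => _) = fun x => F j x * \prod_(i <- s) F i x).
  exact: SmoothMul.
by apply/funext => x; rewrite big_cons.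
Qed.

Lemma bump_smooth k a b : smooth (bump k a b).
Proof.
have [sB _ _ _] := stB.
apply: smooth_exprP; apply: smooth_expr_prod => i; apply: SmoothMul.
- apply: (SmoothComp (F := B)) => //; apply: SmoothMul; first exact: SmoothCst.
  by apply: SmoothAdd; [exact: SmoothCoord|exact: SmoothCst].
- apply: (SmoothComp (F := B)) => //; apply: SmoothMul; first exact: SmoothCst.
  apply: SmoothAdd; first exact: SmoothCst.
  rewrite (_ : (fun _ => _) = fun x => -1 * x 0 i); last by apply/funext => x; rewrite mulN1r.
  by apply: SmoothMul; [exact: SmoothCst|exact: SmoothCoord].
Qed.

Lemma bump_out k a b x : 0 < k -> ~ obox a b x -> bump k a b x = 0.
Proof.
move=> k0 nx; have [_ B0 _ _] := stB.
have [i hi] : exists i, ~~ (a 0 i < x 0 i < b 0 i).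
  by apply: contra_notP nx => h i; apply: contra_notT h => h; exists i.
rewrite /bump (bigD1 i)//= /bump_side.
move: hi; rewrite negb_and -!leNgt => /orP[h|h].
  by rewrite [B _]B0 ?mul0r// pmulr_rle0// subr_le0.
by rewrite [X in _ * X * _]B0 ?mulr0 ?mul0r// pmulr_rle0// subr_le0.
Qed.

Lemma bump_bound k a b x : 0 <= bump k a b x <= 1.
Proof.
have [_ _ _ B01] := stB.
rewrite /bump; elim/big_ind: _ => //; first by rewrite ler01 lexx.
- by move=> u v /andP[u0 u1] /andP[v0 v1]; rewrite mulr_ge0//= mulr_ile1.
- move=> i _; rewrite /bump_side.
  have /andP[u0 u1] := B01 (k * (x 0 i - a 0 i)).
  have /andP[v0 v1] := B01 (k * (b 0 i - x 0 i)).
  by rewrite mulr_ge0//= mulr_ile1.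
Qed.

Lemma bump_in a b x : obox a b x -> \forall k \near \oo, bump k.+1%:R a b x = 1.
Proof.
move=> hx; have [_ _ B1 _] := stB.
have : \forall k \near \oo, forall i : 'I_n, bump_side k.+1%:R a b i x = 1.
  apply: filter_forall => i; have /andP[h1 h2] := hx i.
  near=> k.
  have hk : (x 0 i - a 0 i)^-1 <= k%:R by near: k; exact: nbhs_infty_ger.
  have hk' : (b 0 i - x 0 i)^-1 <= k%:R by near: k; exact: nbhs_infty_ger.
  rewrite /bump_side !B1 ?mulr1//.
    rewrite -ler_pdivrMr ?subr_gt0// div1r (le_trans hk')// ler_nat//.
  rewrite -ler_pdivrMr ?subr_gt0// div1r (le_trans hk)// ler_nat//.
by apply: filterS => k h; rewrite /bump big1.
Unshelve. all: by end_near. Qed.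

Lemma test_bump Omega k a b : 0 < k -> cbox a b `<=` Omega ->
  test_function Omega (bump k a b).
Proof.
move=> k0 sub.
have h : closure [set x | bump k a b x != 0] `<=` cbox a b.
  rewrite (closure_id (cbox a b)).1; last exact: closed_cbox.
  apply: closure_subset => x /= nz; apply: obox_cbox.
  by apply: contra_notP (negP nz) => h; apply/eqP; exact: bump_out.
split; [exact: bump_smooth| |exact: subset_trans h sub].
exact: subclosed_compact (@closed_closure _ _) (@compact_cbox a b) h.
Qed.

Variable Omega : set V.
Hypotheses (oO : open Omega) (bO : bounded_set Omega).

Let mOm : measurable Omega := mO oO.

(** Test with the bumps of the box and let their slope tend to infinity; dominated convergence
    replaces them by the indicator. *)
Lemma box_integral0 g a b : rintegrable mu Omega g -> cbox a b `<=` Omega ->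
  (forall phi, test_function Omega phi -> \int[mu]_(x in Omega) (g x * phi x) = 0) ->
  (\int[mu]_(x in obox a b) (g x)%:E = 0)%E.
Proof.
move=> ig sub h.
have mg := rintegrable_measurable ig.
have mb k : measurable_fun Omega (bump k a b).
  exact: measurable_funS (continuous_measurable_row (smooth_continuous (bump_smooth k a b))).
have ob : obox a b `<=` Omega by apply: subset_trans sub; exact: obox_cbox.
pose f_ k x := (g x * bump k.+1%:R a b x)%:E.
have f_cvg x : Omega x -> f_ ^~ x @ \oo --> (g x * \1_(obox a b) x)%:E.
  move=> Ox; apply: cvg_near_cst; rewrite indicE.
  case: (pselect (obox a b x)) => hx.
    by rewrite mem_set//; apply: filterS (bump_in hx) => k E; rewrite /f_ E.
  rewrite memNset//; apply: nearW => k; rewrite /f_ bump_out ?mulr0//.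
have [||||_ _] := @dominated_convergence _ _ _ mu Omega mOm f_ _ (fun x => `|g x|%:E) _ _
  (aeW _ f_cvg).
- move=> k; apply/measurable_EFinP; exact: measurable_funM.
- apply/measurable_EFinP; apply: (measurable_funM mg).
  by apply: measurable_indic; exact: measurable_obox.
- exact: rintegrable_norm.
- apply: aeW => x k Ox; rewrite /f_ lee_fin normrM ler_piMr//.
  by have /andP[h0 h1] := bump_bound k.+1%:R a b x; rewrite ger0_norm.
have -> : [sequence (\int[mu]_(x in Omega) f_ n0 x)%E]_n0 = fun=> 0%E.
  apply/funext => k /=; rewrite -(@fineK _ (integral _ _ _)).
    by rewrite -[fine _]/(\int[mu]_(x in Omega) _) h//; exact: test_bump.
  apply: integrable_fin_num => //; apply: (rintegrable_le mOm _ _ (rintegrable_norm ig)).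
    exact: measurable_funM.
  move=> x Ox; rewrite normrM ler_piMr//.
  by have /andP[h0 h1] := bump_bound k.+1%:R a b x; rewrite ger0_norm.
move=> c0.
have <- : (\int[mu]_(x in Omega) (g x * \1_(obox a b) x)%:E = 0)%E.
  by rewrite -(cvg_lim _ c0)// lim_cst.
rewrite integral_mkcond [RHS]integral_mkcond; apply: eq_integral => x _.
rewrite !patchE indicE; case: (boolP (x \in obox a b)) => hx.
  by rewrite mem_set ?mulr1//; apply: ob; exact: set_mem.
by rewrite mulr0 if_same.
Unshelve. all: by end_near. Qed.

(** On each box of a countable cover the integrals of [g] over all smaller boxes vanish. Dynkin's
    theorem extends this to all measurable subsets, so [g] is 0 almost everywhere there. *)
Lemma fundamental_lemma g : rintegrable mu Omega g ->
  (forall phi, test_function Omega phi -> \int[mu]_(x in Omega) (g x * phi x) = 0) ->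
  {ae mu, forall x, Omega x -> g x = 0}.
Proof.
move=> ig h.
have [a [b cover]] := open_obox_cover oO.
suff key k : {ae mu, forall x, cbox (a k) (b k) `<=` Omega -> obox (a k) (b k) x -> g x = 0}.
  have := ae_foralln key; apply: filterS => x hx Ox.
  by have [k [h1 h2]] := cover x Ox; exact: (hx k).
case: (pselect (cbox (a k) (b k) `<=` Omega)) => sub; last first.
  by apply: aeW => x.
pose Q := obox (a k) (b k); have mQ : measurable Q by exact: measurable_obox.
have QO : Q `<=` Omega by apply: subset_trans sub; exact: obox_cbox.
have igQ : rintegrable mu Q g by apply: (integrableS _ _ _ ig).
have key A : measurable A -> (\int[mu]_(x in Q `&` A) (g x)%:E = 0)%E.
  move=> mA; apply: (@dynkin_induction _ _ oboxes [set A | (\int[mu]_(x in Q `&` A) (g x)%:E = 0)%E]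
    measurable_oboxes oboxes_setI) => /=; last by rewrite -measurable_oboxes.
  - by rewrite setIT; exact: box_integral0.
  - move=> _ [a' [b' ->]]; rewrite /= /Q oboxI; apply: box_integral0 => //.
    move=> x hx; apply: sub => i; have := hx i; rewrite !mxE ge_max le_min.
    by move=> /andP[/andP[-> _] /andP[-> _]].
  - move=> S mS E.
    have := @integral_setU _ _ _ mu (Q `&` S) (Q `&` ~` S) (EFin \o g).
    rewrite -setIUr setUv setIT E add0e => <-//.
    + exact: box_integral0.
    + exact: measurableI.
    + by apply: measurableI => //; exact: measurableC.
    + exact: (measurable_int _ igQ).
    + apply/disj_setPS => x [[_ Sx] [_ nSx]]; exact: nSx.
  - move=> F mF tF E; rewrite setI_bigcupr integral_bigcup.
    + by rewrite eseries0// => i _ _; exact: E.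
    + by apply: trivIset_setIl.
    + by move=> i; exact: measurableI.
    + by apply: (integrableS _ _ _ igQ) => //; [apply: bigcup_measurable => i _; exact: measurableI|rewrite -setI_bigcupr; exact: subIsetl].
have : ae_eq mu Q (EFin \o g) (cst 0%E).
  apply: integral_ae_eq => //.
  move=> E EQ mE; rewrite integral0 -(key E mE); congr integral.
  by rewrite setIC; exact/esym/setIidl.
by apply: filterS => x hx _ /hx [].
Qed.

End bump.

End fundamental_lemma.

(** * The function beta, its primitive and its Lipschitz constant *)

Section bump.
Context {R : realType}.
Variable beta : R -> R.
Hypothesis hb : smooth_bump beta.

Let sb : smooth1 beta. Proof. by case: hb. Qed.
Let cb : continuous beta. Proof. exact: smooth1_continuous. Qed.
Let b02 t : 0 <= beta t <= 2. Proof. by case: hb. Qed.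
Let b0 t : t <= 0 \/ 1 <= t -> beta t = 0. Proof. by case: hb => _ _ h _ _; exact: h. Qed.

Lemma bump_primitive_derive (t : R) : is_derive (t : R) (1 : R) (primitive beta) (beta t).
Proof. by apply: is_derive_primitive => // s s0; apply: b0; left. Qed.

Lemma bump_smooth_step : smooth_step (primitive beta).
Proof.
have db := bump_primitive_derive.
have z t : t <= 0 -> primitive beta t = 0.
  by move=> t0; apply: primitive_le0 => // s s0; apply: b0; left.
have P1 : primitive beta 1 = 1 by case: hb.
have P2 t : 1 <= t -> primitive beta t = 1.
  move=> t1; have [c hc] := MVT_is_derive 1 t db.
  rewrite b0; last by right; move: hc; rewrite min_l// => /andP[].
  by rewrite mul0r P1 => /eqP; rewrite subr_eq0 => /eqP.
split => //; first exact: (smooth1_primitive db).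
move=> t; case: (lerP t 0) => t0; first by rewrite z// lexx ler01.
case: (lerP 1 t) => t1; first by rewrite P2// lexx ler01.
apply/andP; split.
  have [c _] := MVT_is_derive 0 t db; rewrite (z 0)// !subr0 => ->.
  by rewrite mulr_ge0 ?(ltW t0)//; case/andP: (b02 c).
have [c _] := MVT_is_derive t 1 db; rewrite P1 => E.
by rewrite -subr_ge0 E mulr_ge0 ?subr_ge0 ?(ltW t1)//; case/andP: (b02 c).
Qed.

Lemma bump_primitive0 : primitive0 beta = primitive beta.
Proof.
apply/funext => t; rewrite /primitive0 (_ : \int[lebesgue_measure]_(s in `[t, 0]) beta s = 0) ?subr0//.
rewrite (@eq_Rintegral _ _ _ _ _ (fun=> 0)); first by rewrite Rintegral_cst// mul0r.
by move=> s; rewrite inE/= in_itv/= => /andP[_ s0]; apply: b0; left.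
Qed.

(** The derivative is bounded on [0, 1] by compactness. Outside, [beta] is 0, so both arguments can
    first be clamped to [0, 1], which does not increase distances. *)
Lemma bump_lipschitz : exists L, forall s t, `|beta s - beta t| <= L * `|s - t|.
Proof.
have db (t : R) : is_derive (t : R) (1 : R) beta (derive1 beta t).
  rewrite derive1E; apply: derivableP.
  exact: (@sb 0%N t).
have cd : continuous (fun t => `|derive1 beta t|).
  move=> t; apply: (@continuous_comp _ _ _ (derive1 beta)); last exact: norm_continuous.
  exact: (smooth1_continuous (smooth1_derive sb)).
have [c _ hc] := EVT_max (@ler01 R) (continuous_subspaceT cd).
exists `|derive1 beta c|.
pose clamp (t : R) := Num.max 0 (Num.min t 1).
have clampE t : [\/ t <= 0 /\ clamp t = 0, 0 <= t <= 1 /\ clamp t = t | 1 <= t /\ clamp t = 1].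
  rewrite /clamp; have [t0|t0] := leP t 0; last have [t1|t1] := leP t 1.
  - by constructor 1; rewrite min_l ?max_l//; lra.
  - by constructor 2; rewrite (ltW t0) max_r// ltW.
  - by constructor 3; rewrite (ltW t1) max_r.
have bc t : beta t = beta (clamp t).
  have [[h ->]|[h ->]|[h ->]] := clampE t => //.
    by rewrite !b0//; left.
  by rewrite !b0//; right.
have c01 t : 0 <= clamp t <= 1 by have [[h ->]|[h ->]|[h ->]] := clampE t; rewrite ?lexx ?ler01.
move=> s t; rewrite (bc s) (bc t).
have [d hd ->] := MVT_is_derive (clamp t) (clamp s) db.
rewrite normrM; apply: ler_pM => //.
  apply: hc; rewrite in_itv/=; have /andP[s0 s1] := c01 s; have /andP[t0 t1] := c01 t.
  move: hd => /andP[d1 d2]; apply/andP; split.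
    by apply: le_trans d1; rewrite le_min t0.
  by apply: le_trans d2 _; rewrite ge_max t1.
have [[h1 ->]|[h1 ->]|[h1 ->]] := clampE s; have [[h2 ->]|[h2 ->]|[h2 ->]] := clampE t;
  have := ler_norm (s - t); have := ler_norm (- (s - t)); rewrite normrN ler_norml => v1 v2;
  apply/andP; split; lra.
Qed.

End bump.

(** If S = 0 the base of the power [kappa_star] is 0, so [kappa_star] is 0, against 0 < kappa <
    kappa_star. This also disposes of an empty set of quotients, whose infimum is 0 by
    convention. *)
Lemma sobolev_const_gt0 (R : realType) (n : nat) (Omega : set 'rV[R]_n) (M kappa : R) :
  (3 <= n)%N -> 0 < kappa -> kappa < kappa_star Omega M -> 0 < sobolev_const Omega.
Proof.
move=> n3 k0 kM.
have n3' : 3 <= n%:R :> R by rewrite (ler_nat R 3).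
have : 0 <= sobolev_const Omega.
  rewrite /sobolev_const; set E := [set _ | _ in _].
  have [->|/set0P E0] := eqVneq E set0; first by rewrite inf0.
  apply: lb_le_inf => // _ [u _ <-].
  rewrite divr_ge0 ?powR_ge0//; apply: Rintegral_ge0 => x _.
  by apply: sumr_ge0 => i _; exact: sqr_ge0.
rewrite le_eqVlt => /predU1P[S0|//]; move: kM.
rewrite /kappa_star -S0 powR0; last by rewrite gt_eqF//; lra.
rewrite mul0r powR0; first by move/(lt_trans k0); rewrite ltxx.
by rewrite gt_eqF// divr_gt0//; lra.
Qed.

Section convergence_in_mean.
Context d (T : measurableType d) (R : realType).
Variables (mu : {measure set T -> \bar R}) (D : set T).
Hypothesis mD : measurable D.
Local Notation sq := (square_integrable mu D).
Local Notation I f := (\int[mu]_(x in D) f x).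

Lemma cvg0_le (u v : nat -> R) : (forall k, 0 <= u k <= v k) -> v @ \oo --> 0 -> u @ \oo --> 0.
Proof. by move=> uv v0; apply: squeeze_cvgr (cvg_cst _) v0; exact: nearW. Qed.

Lemma rint_cvgM (v : nat -> T -> R) (u w : T -> R) : (forall k, sq (v k)) -> sq u -> sq w ->
  I (fun x => (u x - v k x) ^+ 2) @[k --> \oo] --> 0 ->
  I (fun x => v k x * w x) @[k --> \oo] --> I (fun x => u x * w x).
Proof.
move=> hv hu hw h.
apply/cvgrPdist_lt => e e0.
have e1 : 0 < (e / (l2norm mu D w + 1)) ^+ 2.
  by rewrite exprn_gt0// divr_gt0// ltr_wpDl// l2norm_ge0.
move/cvgrPdist_lt : h => /(_ _ e1); apply: filterS => k.
rewrite sub0r normrN => hk.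
rewrite -RintegralB//; [|exact: rintegrableM..].
under eq_Rintegral do rewrite -mulrBl.
have huv := square_integrableB mD hu (hv k).
apply: le_lt_trans (rint_norm_le mD huv hw) _.
have hl : l2norm mu D (fun x => u x - v k x) < e / (l2norm mu D w + 1).
  rewrite -[ltRHS]ger0_norm; last by rewrite divr_ge0 ?addr_ge0 ?l2norm_ge0 ?ltW.
  rewrite -sqrtr_sqr ltr_sqrt//; apply: le_lt_trans hk; exact: ler_norm.
move: hl; rewrite ltr_pdivlMr; last by rewrite ltr_wpDl ?l2norm_ge0.
apply: le_lt_trans; apply: ler_wpM2l; first exact: l2norm_ge0.
by rewrite lerDl.
Qed.

End convergence_in_mean.

(** * The space $H^1_0$ *)

Section sobolev_space.
Context {R : realType} {n : nat}.
Local Notation V := 'rV[R]_n.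
Local Notation mu := (@lebesgue_row R n).
Variables (Omega : set V) (oO : open Omega) (bO : bounded_set Omega).
Variables (B : R -> R) (stB : smooth_step B).
Implicit Types (u v w f g phi psi : V -> R) (G H : V -> V).
Local Notation sq := (square_integrable mu Omega).
Local Notation I f := (\int[mu]_(x in Omega) f x).
Local Notation wgrad := (weak_gradient Omega).

Let mOm : measurable Omega := mO oO.

Lemma wgrad_sq u G i : wgrad u G -> sq (fun x => G x 0 i).
Proof. by case=> /(_ i). Qed.

(** The difference of two weak gradients integrates to 0 against every test function, so the
    fundamental lemma applies. *)
Lemma wgrad_unique u G H : wgrad u G -> wgrad u H ->
  forall i, {ae mu, forall x, Omega x -> G x 0 i = H x 0 i}.
Proof.
move=> hG hH i.
have sG := wgrad_sq i hG; have sH := wgrad_sq i hH.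
have := @fundamental_lemma _ _ _ stB _ oO (fun x => G x 0 i - H x 0 i).
move=> /(_ _ _)/wrap[].
- by apply: square_integrable_rintegrable => //; [exact: finO|exact: square_integrableB].
- move=> phi tphi; have sphi := test_square oO bO tphi.
  under eq_Rintegral do rewrite mulrBl.
  rewrite RintegralB//; [|exact: rintegrableM..].
  have [_ /(_ i _ tphi) E1] := hG; have [_ /(_ i _ tphi) E2] := hH.
  by rewrite -[X in X - _]opprK -E1 -[X in _ - X]opprK -E2 subrr.
by apply: filterS => x h Ox; apply/eqP; rewrite -subr_eq0 h.
Qed.

Lemma wgrad_lin (a : R) u v G H : sq u -> sq v -> wgrad u G -> wgrad v H ->
  wgrad (fun x => a * u x + v x) (fun x => a *: G x + H x).
Proof.
move=> su sv hG hH; split=> [i|i phi tphi].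
  rewrite (_ : (fun _ => _) = fun x => a * G x 0 i + H x 0 i); last first.
    by apply/funext => x; rewrite !mxE.
  exact: (square_integrableD mOm (square_integrableZ mOm a (wgrad_sq i hG)) (wgrad_sq i hH)).
have sphi := test_square oO bO tphi.
have sdphi := test_square oO bO (test_partial i tphi).
have sG := wgrad_sq i hG; have sH := wgrad_sq i hH.
have [_ /(_ i _ tphi) E1] := hG; have [_ /(_ i _ tphi) E2] := hH.
have lin f g h : sq f -> sq g -> sq h ->
    I (fun x => (a * f x + g x) * h x) = a * I (fun x => f x * h x) + I (fun x => g x * h x).
  move=> sf sg sh; rewrite -RintegralZl//; last exact: rintegrableM.
  rewrite -RintegralD//; [|by apply: rintegrableZ => //; exact: rintegrableM|exact: rintegrableM].
  by apply: eq_Rintegral => x _; ring.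
rewrite (lin u v)// E1 E2 mulrN -opprD -(lin (fun x => G x 0 i))//.
by congr (- _); apply: eq_Rintegral => x _; rewrite !mxE.
Qed.

Lemma H1_sq u : H1 Omega u -> sq u. Proof. by case. Qed.

Lemma gradP u : H1 Omega u -> wgrad u (grad Omega u).
Proof. by move=> [_ [G hG]]; apply: (@xgetPex _ (fun=> 0) [set G | wgrad u G]); exists G. Qed.

Lemma H1_lin a u v : H1 Omega u -> H1 Omega v -> H1 Omega (fun x => a * u x + v x).
Proof.
move=> hu hv; split.
  exact: (square_integrableD mOm (square_integrableZ mOm a (H1_sq hu)) (H1_sq hv)).
exists (fun x => a *: grad Omega u x + grad Omega v x).
by apply: wgrad_lin; [exact: H1_sq|exact: H1_sq|exact: gradP|exact: gradP].
Qed.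

Fact dirichlet_key : unit. Proof. by []. Qed.
(* Locked, so that arithmetic tactics do not unfold it. *)
Definition dirichlet := locked_with dirichlet_key (fun u v =>
  \sum_(i < n) I (fun x => grad Omega u x 0 i * grad Omega v x 0 i)).

Lemma dirichlet_unlock u v :
  dirichlet u v = \sum_(i < n) I (fun x => grad Omega u x 0 i * grad Omega v x 0 i).
Proof. by rewrite /dirichlet unlock. Qed.

(** [grad] is an arbitrary choice; this allows every computation to use whichever weak gradient is
    at hand. *)
Lemma dirichletE u v G H : H1 Omega u -> H1 Omega v -> wgrad u G -> wgrad v H ->
  dirichlet u v = \sum_(i < n) I (fun x => G x 0 i * H x 0 i).
Proof.
move=> hu hv hG hH; rewrite dirichlet_unlock; apply: eq_bigr => i _.
have hgu := gradP hu; have hgv := gradP hv.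
have m1 := rintegrable_measurable (rintegrableM mOm (wgrad_sq i hgu) (wgrad_sq i hgv)).
have m2 := rintegrable_measurable (rintegrableM mOm (wgrad_sq i hG) (wgrad_sq i hH)).
apply: ae_eq_rint => //.
have := wgrad_unique hgu hG i; have := wgrad_unique hgv hH i.
by apply: filterS2 => x h1 h2 Ox; rewrite h1// h2.
Qed.

Lemma dirichlet_sym u v : dirichlet u v = dirichlet v u.
Proof.
by rewrite !dirichlet_unlock; apply: eq_bigr => i _; apply: eq_Rintegral => x _; rewrite mulrC.
Qed.

Lemma dirichlet_linl a u v w : H1 Omega u -> H1 Omega v -> H1 Omega w ->
  dirichlet (fun x => a * u x + v x) w = a * dirichlet u w + dirichlet v w.
Proof.
move=> hu hv hw.
rewrite (dirichletE (H1_lin a hu hv) hw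
  (wgrad_lin a (H1_sq hu) (H1_sq hv) (gradP hu) (gradP hv)) (gradP hw)).
rewrite !dirichlet_unlock big_distrr -big_split /=; apply: eq_bigr => i _.
have su := wgrad_sq i (gradP hu); have sv := wgrad_sq i (gradP hv).
have sw := wgrad_sq i (gradP hw).
rewrite -RintegralZl//; last exact: rintegrableM.
rewrite -RintegralD//; [|by apply: rintegrableZ => //; exact: rintegrableM|exact: rintegrableM].
by apply: eq_Rintegral => x _; rewrite !mxE; ring.
Qed.

Lemma dirichlet_ge0 u : 0 <= dirichlet u u.
Proof.
by rewrite dirichlet_unlock; apply: sumr_ge0 => i _; apply: Rintegral_ge0 => x _; rewrite -expr2 sqr_ge0.
Qed.

Lemma sqr_grad_rintegrable u : H1 Omega u -> rintegrable mu Omega (sqr_grad Omega u).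
Proof.
move=> hu; apply: rintegrable_sum => // i.
by case: (wgrad_sq i (gradP hu)).
Qed.

Lemma rint_sqr_grad u : H1 Omega u -> I (sqr_grad Omega u) = dirichlet u u.
Proof.
move=> hu; rewrite dirichlet_unlock rint_sum//; last by move=> i; case: (wgrad_sq i (gradP hu)).
Qed.

Lemma H1_normE u : H1 Omega u ->
  H1_norm Omega u = Num.sqrt (I (fun x => u x ^+ 2) + dirichlet u u).
Proof. by move=> hu; rewrite /H1_norm rint_sqr_grad. Qed.

Lemma H1_norm_sqr u : H1 Omega u ->
  H1_norm Omega u ^+ 2 = I (fun x => u x ^+ 2) + dirichlet u u.
Proof.
by move=> hu; rewrite H1_normE// sqr_sqrtr// addr_ge0 ?rint_sqr_ge0 ?dirichlet_ge0.
Qed.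

Lemma H1_norm_ge0 u : 0 <= H1_norm Omega u. Proof. exact: sqrtr_ge0. Qed.

Lemma H1Z a u : H1 Omega u -> H1 Omega (fun x => a * u x).
Proof.
move=> hu; have := H1_lin (a - 1) hu hu.
by congr H1; apply/funext => x; ring.
Qed.

Lemma H1D u v : H1 Omega u -> H1 Omega v -> H1 Omega (fun x => u x + v x).
Proof.
move=> hu hv; have := H1_lin 1 hu hv.
by congr H1; apply/funext => x; ring.
Qed.

Lemma H1B u v : H1 Omega u -> H1 Omega v -> H1 Omega (fun x => u x - v x).
Proof.
move=> hu hv; have := H1_lin (-1) hv hu.
by congr H1; apply/funext => x; ring.
Qed.

Lemma dirichletDl u v w : H1 Omega u -> H1 Omega v -> H1 Omega w ->
  dirichlet (fun x => u x + v x) w = dirichlet u w + dirichlet v w.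
Proof.
move=> hu hv hw; have := dirichlet_linl 1 hu hv hw; rewrite mul1r => <-.
by congr (dirichlet _ w); apply/funext => x; rewrite mul1r.
Qed.

Lemma dirichletZl a u w : H1 Omega u -> H1 Omega w ->
  dirichlet (fun x => a * u x) w = a * dirichlet u w.
Proof.
move=> hu hw; have := dirichlet_linl (a - 1) hu hu hw.
rewrite (_ : (fun x => (a - 1) * u x + u x) = fun x => a * u x).
  by move=> ->; ring.
by apply/funext => x; ring.
Qed.

Lemma dirichletBl u v w : H1 Omega u -> H1 Omega v -> H1 Omega w ->
  dirichlet (fun x => u x - v x) w = dirichlet u w - dirichlet v w.
Proof.
move=> hu hv hw; have := dirichlet_linl (-1) hv hu hw; rewrite mulN1r addrC => <-.
by congr (dirichlet _ w); apply/funext => x; rewrite mulN1r addrC.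
Qed.

Lemma dirichlet_sqrD u v : H1 Omega u -> H1 Omega v ->
  dirichlet (fun x => u x + v x) (fun x => u x + v x) =
  dirichlet u u + 2 * dirichlet u v + dirichlet v v.
Proof.
move=> hu hv; have huv := H1D hu hv.
rewrite (dirichletDl hu hv huv) (dirichlet_sym u (fun x => u x + v x)) (dirichletDl hu hv hu).
by rewrite (dirichlet_sym v (fun x => u x + v x)) (dirichletDl hu hv hv) (dirichlet_sym v u); ring.
Qed.

Lemma dirichlet_sqrZ a u : H1 Omega u ->
  dirichlet (fun x => a * u x) (fun x => a * u x) = a ^+ 2 * dirichlet u u.
Proof.
move=> hu; have hau := H1Z a hu.
by rewrite (dirichletZl a hu hau) (dirichlet_sym u (fun x => a * u x)) (dirichletZl a hu hu); ring.
Qed.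

Lemma dirichlet_cauchy_schwarz u v : H1 Omega u -> H1 Omega v ->
  dirichlet u v ^+ 2 <= dirichlet u u * dirichlet v v.
Proof.
move=> hu hv; apply: nonneg_quadratic => t; have htv := H1Z t hv.
have := dirichlet_ge0 (fun x => u x + t * v x).
rewrite (dirichlet_sqrD hu htv) (dirichlet_sqrZ t hv).
by rewrite (dirichlet_sym u (fun x => t * v x)) (dirichletZl t hv hu) (dirichlet_sym v u) mulrA.
Qed.

Lemma H1_normD u v : H1 Omega u -> H1 Omega v ->
  H1_norm Omega (fun x => u x + v x) <= H1_norm Omega u + H1_norm Omega v.
Proof.
move=> hu hv; rewrite (H1_normE hu) (H1_normE hv) (H1_normE (H1D hu hv)).
have su := H1_sq hu; have sv := H1_sq hv.
rewrite (rint_sqrD mOm su sv) (dirichlet_sqrD hu hv).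
set a := Rintegral mu Omega (fun x => u x ^+ 2).
set b := Rintegral mu Omega (fun x => u x * v x).
set c := Rintegral mu Omega (fun x => v x ^+ 2).
have a0 : 0 <= a by exact: rint_sqr_ge0.
have c0 : 0 <= c by exact: rint_sqr_ge0.
have := dirichlet_ge0 u; have := dirichlet_ge0 v; have := dirichlet_cauchy_schwarz hu hv.
have := rint_cauchy_schwarz mOm su sv; rewrite -/a -/b -/c.
move: (dirichlet u u) (dirichlet u v) (dirichlet v v) => a' b' c'.
clearbody a b c => h1 h2 h3 h4.
have -> : a + 2 * b + c + (a' + 2 * b' + c') = (a + a') + 2 * (b + b') + (c + c') by ring.
apply: sqrt_triangle; try exact: addr_ge0.
(* The cross term that makes the two Cauchy-Schwarz inequalities add up: (b b')^2 <= (a c')(c a'),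
   followed by the arithmetic-geometric inequality. *)
have : (2 * b * b') <= a * c' + c * a'.
  have [/le_trans-> //|bb0] := leP (2 * b * b') 0; first by rewrite addr_ge0 ?mulr_ge0.
  rewrite -ler_sqr ?nnegrE ?(ltW bb0) ?addr_ge0 ?mulr_ge0//.
  have : b ^+ 2 * b' ^+ 2 <= (a * c) * (a' * c') by apply: ler_pM; rewrite ?sqr_ge0.
  have := sqr_ge0 (a * c' - c * a'); nra.
nra.
Qed.

Lemma H1_normN u : H1 Omega u -> H1_norm Omega (fun x => - u x) = H1_norm Omega u.
Proof.
move=> hu; have hn := H1Z (-1) hu.
rewrite (_ : (fun x => - u x) = fun x => -1 * u x); last by apply/funext => x; rewrite mulN1r.
rewrite (H1_normE hu) (H1_normE hn) (dirichlet_sqrZ (-1) hu) sqrrN expr1n mul1r.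
by congr (Num.sqrt (_ + _)); apply: eq_Rintegral => x _; ring.
Qed.

Lemma H1_normB u v w : H1 Omega u -> H1 Omega v -> H1 Omega w ->
  H1_norm Omega (fun x => u x - w x) <=
  H1_norm Omega (fun x => u x - v x) + H1_norm Omega (fun x => v x - w x).
Proof.
move=> hu hv hw; apply: le_trans (H1_normD (H1B hu hv) (H1B hv hw)).
by rewrite le_eqVlt; apply/orP; left; apply/eqP; congr H1_norm; apply/funext => x; ring.
Qed.

Lemma H1_normZ a u : H1 Omega u -> H1_norm Omega (fun x => a * u x) = `|a| * H1_norm Omega u.
Proof.
move=> hu; have hn := H1Z a hu; have [_ iu] := H1_sq hu.
rewrite (H1_normE hu) (H1_normE hn) (dirichlet_sqrZ a hu).
rewrite (_ : I (fun x => (a * u x) ^+ 2) = a ^+ 2 * I (fun x => u x ^+ 2)).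
  by rewrite -mulrDr sqrtrM ?sqr_ge0// sqrtr_sqr.
by rewrite -RintegralZl//; apply: eq_Rintegral => x _; rewrite exprMn.
Qed.

#[local] Opaque H1_norm.

Lemma test_wgrad phi : test_function Omega phi -> wgrad phi (fun x => \row_i partial i phi x).
Proof.
move=> tphi; split=> [i|i psi tpsi].
  rewrite (_ : (fun _ => _) = partial i phi); last by apply/funext => x; rewrite mxE.
  exact: (test_square oO bO (test_partial i tphi)).
rewrite (test_by_parts oO bO)//; congr (- _).
by apply: eq_Rintegral => x _; rewrite mxE.
Qed.

Lemma test_H1 phi : test_function Omega phi -> H1 Omega phi.
Proof. by move=> tphi; split; [exact: (test_square oO bO tphi)|eexists; exact: test_wgrad]. Qed.

Lemma H10_H1 u : H10 Omega u -> H1 Omega u. Proof. by case. Qed.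

Lemma H10_sq u : H10 Omega u -> sq u. Proof. by move=> /H10_H1/H1_sq. Qed.

Lemma H10_approx u e : H10 Omega u -> 0 < e ->
  exists2 phi, test_function Omega phi & H1_norm Omega (fun x => u x - phi x) < e.
Proof.
move=> [_ [phi [tphi]]] /cvgrPdist_lt h e0.
have [k _ /(_ k (leqnn k)) hk] := h e e0.
exists (phi k) => //; apply: le_lt_trans hk.
by rewrite sub0r normrN ler_norm.
Qed.

Lemma harmonic_cvg (u : nat -> R) : (forall k, 0 <= u k < k.+1%:R^-1) -> u @ \oo --> 0.
Proof.
move=> hu; apply: (@cvg0_le _ _ (fun k => k.+1%:R^-1)); last exact: cvg_harmonic.
by move=> k; have /andP[-> /ltW ->] := hu k.
Qed.

(** A closure is closed: approximants in H^1_0 are as good as test functions, at the price of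
    halving the error. *)
Lemma approx_H10 u : H1 Omega u -> (forall e, 0 < e ->
  exists2 phi, H10 Omega phi & H1_norm Omega (fun x => u x - phi x) < e) -> H10 Omega u.
Proof.
move=> hu h; split=> //.
have {}h k : exists phi, test_function Omega phi /\
    H1_norm Omega (fun x => u x - phi x) < k.+1%:R^-1.
  have e0 : 0 < k.+1%:R^-1 / 2 :> R by rewrite divr_gt0// invr_gt0.
  have [v hv huv] := h _ e0; have [phi tphi hphi] := H10_approx hv e0.
  exists phi; split => //.
  apply: le_lt_trans (H1_normB hu (H10_H1 hv) (test_H1 tphi)) _.
  by have := ltrD huv hphi; rewrite -splitr.
have [phi hphi] := choice h; exists phi; split => [k|]; first by case: (hphi k).
by apply: harmonic_cvg => k; rewrite H1_norm_ge0; case: (hphi k).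
Qed.

Lemma H10_lin a u v : H10 Omega u -> H10 Omega v -> H10 Omega (fun x => a * u x + v x).
Proof.
move=> hu hv; apply: approx_H10; first exact: H1_lin (H10_H1 hu) (H10_H1 hv).
move=> e e0.
have e1 : 0 < e / (`|a| + 1) by rewrite divr_gt0// ltr_wpDl.
have e2 : 0 < e / 2 by rewrite divr_gt0.
have e3 : 0 < e / 2 / (`|a| + 1) by rewrite divr_gt0// ltr_wpDl.
have [f tf hf] := H10_approx hu e3; have [g tg hg] := H10_approx hv e2.
have tfg := testD (testZ a tf) tg.
exists (fun x => a * f x + g x).
  split; first exact: test_H1.
  exists (fun=> (fun x => a * f x + g x)); split => // .
  rewrite (_ : _ \- _ = fun x => 0 * f x); last by apply/funext => x /=; ring.
  by rewrite (H1_normZ 0 (test_H1 tf)) normr0 mul0r; exact: cvg_cst.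
have hu1 := H10_H1 hu; have hv1 := H10_H1 hv.
have huf := H1B hu1 (test_H1 tf); have hvg := H1B hv1 (test_H1 tg).
have := H1_normD (H1Z a huf) hvg; rewrite (H1_normZ a huf).
rewrite (_ : (fun x => _) = fun x => a * u x + v x - (a * f x + g x)); last first.
  by apply/funext => x; ring.
move/le_lt_trans; apply; rewrite [ltRHS]splitr; apply: ler_ltD => //.
apply: (@le_trans _ _ ((`|a| + 1) * (e / 2 / (`|a| + 1)))).
  by apply: ler_pM; rewrite ?H1_norm_ge0 ?lerDl// ltW.
by rewrite mulrCA divff ?mulr1// gt_eqF// ltr_wpDl.
Qed.

Lemma test_H10 phi : test_function Omega phi -> H10 Omega phi.
Proof.
move=> tphi; split; first exact: test_H1.
exists (fun=> phi); split => //.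
rewrite (_ : _ \- _ = fun x => 0 * phi x); last by apply/funext => x /=; ring.
by rewrite (H1_normZ 0 (test_H1 tphi)) normr0 mul0r; exact: cvg_cst.
Qed.

Lemma H10Z a u : H10 Omega u -> H10 Omega (fun x => a * u x).
Proof.
move=> hu; have := H10_lin (a - 1) hu hu.
by congr H10; apply/funext => x; ring.
Qed.

Lemma H10D u v : H10 Omega u -> H10 Omega v -> H10 Omega (fun x => u x + v x).
Proof.
move=> hu hv; have := H10_lin 1 hu hv.
by congr H10; apply/funext => x; ring.
Qed.

Lemma H10B u v : H10 Omega u -> H10 Omega v -> H10 Omega (fun x => u x - v x).
Proof.
move=> hu hv; have := H10_lin (-1) hv hu.
by congr H10; apply/funext => x; ring.
Qed.

(** * Limits and completeness in H^1_0 *)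

Lemma wgrad_limit (v_ : nat -> V -> R) (G_ : nat -> V -> V) v G :
  (forall k, sq (v_ k)) -> sq v -> (forall i, sq (fun x => G x 0 i)) ->
  (forall k, wgrad (v_ k) (G_ k)) ->
  I (fun x => (v x - v_ k x) ^+ 2) @[k --> \oo] --> 0 ->
  (forall i, I (fun x => (G x 0 i - G_ k x 0 i) ^+ 2) @[k --> \oo] --> 0) ->
  wgrad v G.
Proof.
move=> sv_ sv sG hG_ cv cG; split=> // i phi tphi.
have sphi := test_square oO bO tphi.
have sdphi := test_square oO bO (test_partial i tphi).
have c1 := rint_cvgM mOm sv_ sv sdphi cv.
have c2 := rint_cvgM mOm (fun k => wgrad_sq i (hG_ k)) (sG i) sphi (cG i).
have E k : I (fun x => v_ k x * partial i phi x) = - I (fun x => G_ k x 0 i * phi x).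
  by have [_ /(_ i phi tphi)] := hG_ k.
have c1' : I (fun x => v_ k x * partial i phi x) @[k --> \oo] --> - I (fun x => G x 0 i * phi x).
  by under eq_fun do rewrite E; exact: cvgN.
exact: (cvg_unique _ c1 c1').
Qed.

Lemma H10_limit (v_ : nat -> V -> R) (G_ : nat -> V -> V) v G :
  (forall k, H10 Omega (v_ k)) -> sq v -> (forall i, sq (fun x => G x 0 i)) ->
  (forall k, wgrad (v_ k) (G_ k)) ->
  I (fun x => (v x - v_ k x) ^+ 2) @[k --> \oo] --> 0 ->
  (forall i, I (fun x => (G x 0 i - G_ k x 0 i) ^+ 2) @[k --> \oo] --> 0) ->
  [/\ H10 Omega v, wgrad v G & H1_norm Omega (fun x => v x - v_ k x) @[k --> \oo] --> 0].
Proof.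
move=> hv_ sv sG hG_ cv cG.
have hG := wgrad_limit (fun k => H10_sq (hv_ k)) sv sG hG_ cv cG.
have hv : H1 Omega v by split => //; exists G.
have hd k := H1B hv (H10_H1 (hv_ k)).
have wd k := wgrad_lin (-1) (H10_sq (hv_ k)) sv (hG_ k) hG.
have E k : H1_norm Omega (fun x => v x - v_ k x) =
    Num.sqrt (I (fun x => (v x - v_ k x) ^+ 2) + \sum_(i < n) I (fun x => (G x 0 i - G_ k x 0 i) ^+ 2)).
  rewrite (H1_normE (hd k)); congr (Num.sqrt (_ + _)).
  have wd' : wgrad (fun x => v x - v_ k x) (fun x => -1 *: G_ k x + G x).
    by have := wd k; congr (wgrad _ _); apply/funext => x; ring.
  rewrite (dirichletE (hd k) (hd k) wd' wd'); apply: eq_bigr => i _.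
  by apply: eq_Rintegral => x _; rewrite !mxE; ring.
have cn : H1_norm Omega (fun x => v x - v_ k x) @[k --> \oo] --> 0.
  have -> : (fun k => H1_norm Omega (fun x => v x - v_ k x)) = (fun k => Num.sqrt
    (I (fun x => (v x - v_ k x) ^+ 2) + \sum_(i < n) I (fun x => (G x 0 i - G_ k x 0 i) ^+ 2))).
    by apply/funext.
  set f := (fun k => _); suff : f @ \oo --> Num.sqrt (0 + \sum_(i < n) (0 : R)).
    by rewrite [X in 0 + X]big1// addr0 sqrtr0.
  apply: continuous_cvg; first exact: sqrt_continuous.
  apply: cvgD => //.
  by apply: (@cvg_big R 'I_n +%R 0 xpredT (@add_continuous R) nat \oo) => i _; exact: cG.
split => //; apply: approx_H10 => // e e0.
move/cvgrPdist_lt : cn => /(_ e e0)[k _ /(_ k (leqnn k)) hk].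
exists (v_ k) => //; apply: le_lt_trans hk.
by rewrite sub0r normrN ler_norm.
Qed.

Lemma H1_norm_l2 u : H1 Omega u -> I (fun x => u x ^+ 2) <= H1_norm Omega u ^+ 2.
Proof. by move=> hu; rewrite H1_norm_sqr// lerDl dirichlet_ge0. Qed.

Lemma H1_norm_dirichlet u : H1 Omega u -> dirichlet u u <= H1_norm Omega u ^+ 2.
Proof. by move=> hu; rewrite H1_norm_sqr// lerDr rint_sqr_ge0. Qed.

Lemma dirichlet_grad u v G H i : H1 Omega u -> H1 Omega v -> wgrad u G -> wgrad v H ->
  I (fun x => (G x 0 i - H x 0 i) ^+ 2) <= dirichlet (fun x => u x - v x) (fun x => u x - v x).
Proof.
move=> hu hv hG hH; have hd := H1B hu hv.
have wd := wgrad_lin (-1) (H1_sq hv) (H1_sq hu) hH hG.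
have wd' : wgrad (fun x => u x - v x) (fun x => -1 *: H x + G x).
  by have := wd; congr (wgrad _ _); apply/funext => x; ring.
rewrite (dirichletE hd hd wd' wd') (bigD1 i)//=.
apply: (@le_trans _ _ (I (fun x => (-1 *: H x + G x) 0 i * (-1 *: H x + G x) 0 i))).
  rewrite le_eqVlt; apply/orP; left; apply/eqP.
  by apply: eq_Rintegral => x _; rewrite !mxE; ring.
rewrite lerDl; apply: sumr_ge0 => j _; apply: Rintegral_ge0 => x _.
by rewrite -expr2 sqr_ge0.
Qed.

Lemma H10_complete (y : nat -> V -> R) : (forall k, H10 Omega (y k)) ->
  (forall e, 0 < e -> exists m, forall j k, (m <= j)%N -> (m <= k)%N ->
    H1_norm Omega (fun x => y j x - y k x) <= e) ->
  exists2 v, H10 Omega v & H1_norm Omega (fun x => v x - y k x) @[k --> \oo] --> 0.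
Proof.
move=> hy hC.
have hC2 e : 0 < e -> exists m, forall j k, (m <= j)%N -> (m <= k)%N ->
    H1_norm Omega (fun x => y j x - y k x) ^+ 2 <= e.
  move=> e0; have [|m hm] := hC (Num.sqrt e); first by rewrite sqrtr_gt0.
  exists m => j k mj mk; rewrite -(sqr_sqrtr (ltW e0)).
  by apply: lerXn2r; rewrite ?nnegrE ?H1_norm_ge0 ?sqrtr_ge0 ?hm.
have [|v sv cv] := riesz_fischer mOm (fun k => H10_sq (hy k)).
  move=> e /hC2[m hm]; exists m => j k mj mk; apply: le_trans (hm j k mj mk).
  exact/H1_norm_l2/H1B/H10_H1/hy/H10_H1/hy.
have hG i : exists g : V -> R, sq g /\
    I (fun x => (g x - grad Omega (y k) x 0 i) ^+ 2) @[k --> \oo] --> 0.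
  have [|g sg cg] := riesz_fischer mOm (fun k => wgrad_sq i (gradP (H10_H1 (hy k)))).
    move=> e /hC2[m hm]; exists m => j k mj mk; apply: le_trans (hm j k mj mk).
    have hj := H10_H1 (hy j); have hk := H10_H1 (hy k).
    exact: le_trans (dirichlet_grad i hj hk (gradP hj) (gradP hk)) (H1_norm_dirichlet (H1B hj hk)).
  by exists g.
have [g hg] := choice hG.
pose G x : V := \row_i g i x.
have GE i : (fun x => G x 0 i) = g i by apply/funext => x; rewrite mxE.
have [||hv _ c] := H10_limit (G := G) hy sv _ (fun k => gradP (H10_H1 (hy k))) cv _.
- by move=> i; rewrite GE; case: (hg i).
- move=> i; have [_] := hg i.
  by under [X in _ -> X @ _ --> _]eq_fun do under eq_Rintegral do rewrite mxE.
by exists v.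
Qed.

Lemma cvg_sqr0 (f : nat -> R) : f @ \oo --> 0 -> (fun k => f k ^+ 2) @ \oo --> 0.
Proof.
move=> f0; have := cvgM f0 f0; rewrite mulr0.
rewrite (_ : f \* f = fun k => f k ^+ 2); first by apply.
by apply/funext => k; rewrite expr2.
Qed.

Lemma H1_cvg_l2 u (v_ : nat -> V -> R) : H1 Omega u -> (forall k, H1 Omega (v_ k)) ->
  H1_norm Omega (fun x => u x - v_ k x) @[k --> \oo] --> 0 ->
  I (fun x => (u x - v_ k x) ^+ 2) @[k --> \oo] --> 0.
Proof.
move=> hu hv /cvg_sqr0; apply: cvg0_le => k.
by rewrite rint_sqr_ge0 H1_norm_l2//; exact: H1B.
Qed.

Lemma H1_cvg_grad u G (v_ : nat -> V -> R) (G_ : nat -> V -> V) i :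
  H1 Omega u -> (forall k, H1 Omega (v_ k)) -> wgrad u G -> (forall k, wgrad (v_ k) (G_ k)) ->
  H1_norm Omega (fun x => u x - v_ k x) @[k --> \oo] --> 0 ->
  I (fun x => (G x 0 i - G_ k x 0 i) ^+ 2) @[k --> \oo] --> 0.
Proof.
move=> hu hv hG hG_ /cvg_sqr0; apply: cvg0_le => k.
rewrite rint_sqr_ge0 (le_trans (dirichlet_grad i hu (hv k) hG (hG_ k)))//.
by apply: H1_norm_dirichlet; exact: H1B.
Qed.

(** * The chain rule in H^1_0 *)

Lemma continuous_measurable_comp (F : R -> R) u : continuous F -> measurable_fun Omega u ->
  measurable_fun Omega (fun x => F (u x)).
Proof. by move=> cF mu_; apply: measurableT_comp mu_; exact: continuous_measurable_fun. Qed.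

Lemma sqr_sum_le (a b : R) : (a + b) ^+ 2 <= 2 * a ^+ 2 + 2 * b ^+ 2.
Proof. by have := sqr_ge0 (a - b); nra. Qed.

(** With phi_k tending to u, the delicate term is (F'(u) - F'(phi_k)) g for a component g of grad u.
    Where g^2 <= K, the Lipschitz bound on F' and L^2 convergence make it small; where g^2 > K, |F'|
    <= 1 leaves only the tail of g^2. *)
Lemma H10_comp (F : R -> R) (C : R) u : smooth1 F -> F 0 = 0 -> 0 <= C ->
  (forall t, `|derive1 F t| <= 1) ->
  (forall s t, `|derive1 F s - derive1 F t| <= C * `|s - t|) ->
  H10 Omega u ->
  H10 Omega (fun x => F (u x)) /\
  wgrad (fun x => F (u x)) (fun x => derive1 F (u x) *: grad Omega u x).
Proof.
move=> sF F0 C0 F1 FC hu.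
have [hu1 [phi [tphi cphi]]] := hu.
have hphi k := test_H1 (tphi k).
have dF t : is_derive (t : R) (1 : R) F (derive1 F t).
  by rewrite derive1E; apply: derivableP; exact: (sF 0%N t).
have FL s t : `|F s - F t| <= `|s - t|.
  have [c _ ->] := MVT_is_derive t s dF.
  by rewrite normrM ler_piMl.
have cF := smooth1_continuous sF; have cdF := smooth1_continuous (smooth1_derive sF).
have su := H10_sq hu; have [mu_ _] := su.
have sv : sq (fun x => F (u x)).
  apply: (square_integrable_le mOm _ _ su); first exact: continuous_measurable_comp.
  by move=> x _; have := FL (u x) 0; rewrite F0 !subr0.
have hG := gradP hu1; have sG i := wgrad_sq i hG; pose G := grad Omega u.
pose G' x := derive1 F (u x) *: G x.
have G'E i : (fun x => G' x 0 i) = fun x => derive1 F (u x) * G x 0 i.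
  by apply/funext => x; rewrite mxE.
have mdF : measurable_fun Omega (fun x => derive1 F (u x)) by exact: continuous_measurable_comp.
have sG' i : sq (fun x => G' x 0 i).
  rewrite G'E; apply: (square_integrable_le mOm _ _ (sG i)).
    by apply: measurable_funM => //; case: (sG i).
  by move=> x _; rewrite normrM ler_piMl.
have tF k := test_comp sF F0 (tphi k).
have cu := H1_cvg_l2 hu1 hphi cphi.
have cg i := H1_cvg_grad i hu1 hphi hG (fun k => test_wgrad (tphi k)) cphi.
suff [hv wv _] : [/\ H10 Omega (fun x => F (u x)), wgrad (fun x => F (u x)) G' &
    H1_norm Omega (fun x => F (u x) - (F \o phi k) x) @[k --> \oo] --> 0] by [].
apply: (H10_limit (fun k => test_H10 (tF k)) sv sG' (fun k => test_wgrad (tF k))).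
  apply: cvg0_le cu => k; rewrite rint_sqr_ge0/=; apply: le_Rintegral => //.
  - by have [_] := square_integrableB mOm sv (H10_sq (test_H10 (tF k))).
  - by have [_] := square_integrableB mOm su (H1_sq (hphi k)).
  - move=> x _; rewrite -(real_normK (num_real (_ - _))) -[leRHS](real_normK (num_real _)).
    by rewrite lerXn2r ?nnegrE//; exact: FL.
move=> i; apply/cvgrPdist_lt => e e0.
(* Of the final error, 2 (e/8) comes from the gradients, e/4 from u - phi_k and 8 (e/32) from the
   tail, in total less than e. *)
have e8 : 0 < e / 32 by rewrite divr_gt0.
have [K K0 hK] := tail_small mOm (sG i).2 (fun x _ => sqr_ge0 _) e8.
pose C' := 2 * C ^+ 2 * K.
have C'0 : 0 <= C' by rewrite !mulr_ge0 ?sqr_ge0// ltW.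
have e2 : 0 < e / 4 / (C' + 1) by rewrite !divr_gt0// ltr_wpDl.
have e3 : 0 < e / 8 by rewrite divr_gt0.
move/cvgrPdist_lt : cu => /(_ _ e2) cu; have /cvgrPdist_lt /(_ _ e3) {}cg := cg i.
near=> k.
rewrite sub0r normrN ger0_norm ?rint_sqr_ge0//.
pose g x := G x 0 i; pose p x := partial i (phi k) x.
have sp : sq p by exact: test_square oO bO _ (test_partial i (tphi k)).
have sgp := square_integrableB mOm (sG i) sp.
have sup := square_integrableB mOm su (H1_sq (hphi k)).
have it : rintegrable mu Omega (fun x => g x ^+ 2 * (K < g x ^+ 2)%R%:R).
  have mg2 : measurable_fun Omega (fun x => g x ^+ 2) by apply: measurable_funX; case: (sG i).
  apply: (rintegrable_le mOm _ _ (sG i).2).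
    apply: measurable_funM => //.
    rewrite (_ : (fun _ => _) = (fun b : bool => b%:R : R) \o (fun x => K < g x ^+ 2))//.
    by apply: measurableT_comp => //; exact: measurable_fun_ltr.
  by move=> x _; case: (_ < _); rewrite ?mulr1 ?mulr0 ?normr0 ?sqr_ge0// ger0_norm ?sqr_ge0.
have le1 : I (fun x => (G' x 0 i - (\row_i0 partial i0 (F \o phi k) x) 0 i) ^+ 2) <=
    2 * I (fun x => (g x - p x) ^+ 2) + (C' * I (fun x => (u x - phi k x) ^+ 2) +
    8 * I (fun x => g x ^+ 2 * (K < g x ^+ 2)%R%:R)).
  have i1 := rintegrableZ mOm 2 sgp.2; have i2 := rintegrableZ mOm C' sup.2.
  have i3 := rintegrableZ mOm 8 it; have i23 := rintegrableD mOm i2 i3.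
  rewrite -(RintegralZl 2 mOm sgp.2) -(RintegralZl C' mOm sup.2) -(RintegralZl 8 mOm it).
  rewrite -(RintegralD mOm i2 i3) -(RintegralD mOm i1 i23).
  apply: le_Rintegral => //.
  - by have [_] := square_integrableB mOm (sG' i) (wgrad_sq i (test_wgrad (tF k))).
  - exact: rintegrableD.
  move=> x _; rewrite /G' !mxE partial_comp//; last exact/SmoothBase/(test_smooth (tphi k)).
  rewrite -/(g x) -/(p x).
  rewrite (_ : _ - _ = derive1 F (phi k x) * (g x - p x) +
    (derive1 F (u x) - derive1 F (phi k x)) * g x); last by ring.
  apply: le_trans (sqr_sum_le _ _) _; apply: lerD.
    rewrite ler_pM2l// exprMn ler_piMl ?sqr_ge0//.
    by rewrite -(real_normK (num_real (derive1 F _))) exprn_ile1.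
  rewrite exprMn; have g0 := sqr_ge0 (g x).
  have D2 : (derive1 F (u x) - derive1 F (phi k x)) ^+ 2 <= 4.
    have := F1 (u x); have := F1 (phi k x); rewrite !ler_norml.
    by set s := derive1 F _; set t := derive1 F _; move: s t => s t /andP[? ?] /andP[? ?]; nra.
  have DC : (derive1 F (u x) - derive1 F (phi k x)) ^+ 2 <= C ^+ 2 * (u x - phi k x) ^+ 2.
    rewrite -exprMn -(real_normK (num_real (derive1 F _ - _))).
    rewrite -[leRHS](real_normK (num_real _)) lerXn2r ?nnegrE//.
    by rewrite normrM (ger0_norm C0).
  set d2 := _ ^+ 2 in D2 DC *; have d20 : 0 <= d2 by exact: sqr_ge0.
  set q := (u x - phi k x) ^+ 2 in DC *; have q0 : 0 <= q by exact: sqr_ge0.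
  have h4 : d2 * g x ^+ 2 <= 4 * g x ^+ 2 by apply: ler_wpM2r.
  have hC'q : 0 <= C' * q by exact: mulr_ge0.
  have hK' : g x ^+ 2 <= K -> 2 * (d2 * g x ^+ 2) <= C' * q.
    move=> hgK; rewrite (_ : C' * q = 2 * (C ^+ 2 * q * K)); last by rewrite /C'; ring.
    by apply: ler_wpM2l => //; apply: ler_pM.
  clearbody d2 q C'; move: (g x ^+ 2) g0 h4 hK' => gg g0 h4 hK'.
  case: ltP => hgK; rewrite ?mulr1 ?mulr0 ?addr0; last exact: hK'.
  lra.
apply: (le_lt_trans le1).
have h1 : I (fun x => (g x - p x) ^+ 2) < e / 8.
  have : `|0 - I (fun x => (G x 0 i - (\row_i0 partial i0 (phi k) x) 0 i) ^+ 2)| < e / 8.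
    by near: k; exact: cg.
  rewrite sub0r normrN => /(le_lt_trans (ler_norm _)).
  by under eq_Rintegral do rewrite mxE.
have h2 : I (fun x => (u x - phi k x) ^+ 2) < e / 4 / (C' + 1).
  have : `|0 - I (fun x => (u x - phi k x) ^+ 2)| < e / 4 / (C' + 1) by near: k; exact: cu.
  by rewrite sub0r normrN => /(le_lt_trans (ler_norm _)).
have h2' : C' * I (fun x => (u x - phi k x) ^+ 2) <= e / 4.
  move: h2; rewrite ltr_pdivlMr ?ltr_wpDl// => /ltW; apply: le_trans.
  by rewrite mulrC ler_wpM2l ?rint_sqr_ge0// lerDl.
move: h1 h2' hK; rewrite -/(g _).
set a1 := Rintegral _ _ _; set a2 := C' * _; set a3 := Rintegral _ _ _.
clearbody a1 a2 a3 => {le1} h1 h2' h3.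
lra.
Unshelve. all: by end_near. Qed.

(** * Weak limits and compactness of bounded sequences *)

Lemma dirichlet_parallelogram u v : H1 Omega u -> H1 Omega v ->
  dirichlet (fun x => u x - v x) (fun x => u x - v x) =
  2 * dirichlet u u + 2 * dirichlet v v -
  4 * dirichlet (fun x => 2^-1 * (u x + v x)) (fun x => 2^-1 * (u x + v x)).
Proof.
move=> hu hv; rewrite (dirichlet_sqrZ 2^-1 (H1D hu hv)) (dirichlet_sqrD hu hv).
have hv' := H1Z (-1) hv.
have -> : (fun x => u x - v x) = (fun x => u x + -1 * v x).
  by apply/funext => x; rewrite mulN1r.
rewrite (dirichlet_sqrD hu hv') (dirichlet_sqrZ (-1) hv) (dirichlet_sym u (fun x => -1 * v x)).
rewrite (dirichletZl (-1) hv hu) (dirichlet_sym v u).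
move: (dirichlet u u) (dirichlet u v) (dirichlet v v) => a b c.
by field.
Qed.

Lemma rint_sqr_mid u f g e : sq u -> sq f -> sq g ->
  I (fun x => (u x - f x) ^+ 2) <= e -> I (fun x => (u x - g x) ^+ 2) <= e ->
  I (fun x => (u x - 2^-1 * (f x + g x)) ^+ 2) <= e.
Proof.
move=> su sf sg h1 h2.
have s1 := (square_integrableB mOm su sf).2; have s2 := (square_integrableB mOm su sg).2.
have s3 := (square_integrableB mOm su (square_integrableZ mOm 2^-1 (square_integrableD mOm sf sg))).2.
have z1 := rintegrableZ mOm 2^-1 s1; have z2 := rintegrableZ mOm 2^-1 s2.
apply: (@le_trans _ _ (2^-1 * I (fun x => (u x - f x) ^+ 2) + 2^-1 * I (fun x => (u x - g x) ^+ 2))).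
  rewrite -(RintegralZl 2^-1 mOm s1) -(RintegralZl 2^-1 mOm s2) -(RintegralD mOm z1 z2).
  apply: le_Rintegral => //; first exact: rintegrableD.
  by move=> x _; move: (u x) (f x) (g x) => a b c; have := sqr_ge0 (b - c); lra.
by move: h1 h2; set a := Rintegral _ _ _; set b := Rintegral _ _ _; clearbody a b; lra.
Qed.

Lemma rint_sqr_diff u f g : sq u -> sq f -> sq g ->
  I (fun x => (f x - g x) ^+ 2) <=
  2 * I (fun x => (u x - f x) ^+ 2) + 2 * I (fun x => (u x - g x) ^+ 2).
Proof.
move=> su sf sg.
have s1 := (square_integrableB mOm su sf).2; have s2 := (square_integrableB mOm su sg).2.
have s3 := (square_integrableB mOm sf sg).2.
have z1 := rintegrableZ mOm 2 s1; have z2 := rintegrableZ mOm 2 s2.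
rewrite -(RintegralZl 2 mOm s1) -(RintegralZl 2 mOm s2) -(RintegralD mOm z1 z2).
apply: le_Rintegral => //; first exact: rintegrableD.
move=> x _; move: (u x) (f x) (g x) => a b c.
have := sqr_ge0 (2 * a - b - c); lra.
Qed.

(* A minimising sequence for the Dirichlet integral over the convex sets
   {y : |y - u|_{L^2} <= 1/(m+1)} is Cauchy by the parallelogram identity: this
   replaces weak compactness of bounded sets. *)
Lemma H10_weak_limit (u_ : nat -> V -> R) u (C : R) : (forall k, H10 Omega (u_ k)) -> sq u ->
  (forall k, dirichlet (u_ k) (u_ k) <= C) ->
  I (fun x => (u x - u_ k x) ^+ 2) @[k --> \oo] --> 0 -> H10 Omega u.
Proof.
move=> hu_ su hC cu.
pose K m := [set y : V -> R | H10 Omega y /\ I (fun x => (u x - y x) ^+ 2) <= m.+1%:R^-1].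
pose E m := [set dirichlet y y | y in K m].
have Kd m m' : (m <= m')%N -> K m' `<=` K m.
  move=> mm y [hy hI]; split => //; apply: le_trans hI _.
  by rewrite lef_pV2 ?posrE// ler_nat.
have Ene m : exists2 y, E m y & y <= C.
  have e0 : 0 < m.+1%:R^-1 :> R by [].
  move/cvgrPdist_lt : cu => /(_ _ e0)[k _ /(_ k (leqnn k))].
  rewrite sub0r normrN => /(le_lt_trans (ler_norm _)) /ltW hk.
  by exists (dirichlet (u_ k) (u_ k)) => //; exists (u_ k).
have Elb m : has_lbound (E m) by exists 0 => _ [y _ <-]; exact: dirichlet_ge0.
have hE m : has_inf (E m) by split => //; have [y hy _] := Ene m; exists y.
pose a m := inf (E m).
have aC m : a m <= C by have [y hy hyC] := Ene m; apply: le_trans hyC; exact: ge_inf.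
have aK m y : K m y -> a m <= dirichlet y y.
  by move=> hy; apply: ge_inf => //; exists y.
have a_nd : {homo a : m m' / (m <= m')%N >-> m <= m'}.
  move=> m m' mm; apply: lb_le_inf; first by case: (hE m').
  by move=> _ [y hy <-]; apply: aK; exact: (Kd m m').
have cva : a @ \oo --> sup (range a).
  by apply: nondecreasing_cvgn => //; exists C => _ [m _ <-].
have hsup m : a m <= sup (range a).
  by apply: ub_le_sup; [exists C => _ [k _ <-]|exists m].
have hy m : exists y, K m y /\ dirichlet y y < a m + m.+1%:R^-1.
  have [|_ [y hy <-] hlt] := @inf_adherent _ (E m) m.+1%:R^-1 _ (hE m); first by [].
  by exists y.
have {hy} [y hy] := choice hy.
have Hy k : H10 Omega (y k) by case: (hy k) => -[].
have lim0 : (fun k : nat => k.+1%:R^-1 : R) @ \oo --> 0 by exact: cvg_harmonic.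
have cy : I (fun x => (u x - y k x) ^+ 2) @[k --> \oo] --> 0.
  by apply: cvg0_le lim0 => k; rewrite rint_sqr_ge0; case: (hy k) => -[].
have [|v hv cv] := H10_complete Hy.
  (* The squared norm of y_j - y_k is at most 4/(m+1) for the L^2 part plus 4/(m+1) + 4 (sup a -
     a_m) for the Dirichlet part, below 12 e^2 / 16. *)
  move=> e e0; have e1 : 0 < e ^+ 2 / 16 by rewrite divr_gt0// exprn_gt0.
  move/cvgrPdist_lt : cva => /(_ _ e1) cva.
  move/cvgrPdist_lt : (lim0) => /(_ _ e1) l0.
  have [m _ hm] := filterI cva l0; have /= := hm m (leqnn m).
  rewrite /setI /= sub0r normrN => -[/(le_lt_trans (ler_norm _)) h1 /(le_lt_trans (ler_norm _)) h2].
  exists m => j k mj mk.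
  have hyj := H10_H1 (Hy j); have hyk := H10_H1 (Hy k).
  rewrite -ler_sqr ?nnegrE ?H1_norm_ge0 ?(ltW e0)// (H1_norm_sqr (H1B hyj hyk)).
  rewrite (dirichlet_parallelogram hyj hyk).
  have [Kj dj] := hy j; have [Kk dk] := hy k.
  have [_ Ij] := Kd m j mj _ Kj; have [_ Ik] := Kd m k mk _ Kk.
  (* Convexity keeps the midpoint admissible, so its Dirichlet integral is at least [a m]: this is
     what the parallelogram identity needs. *)
  have Kmid : K m (fun x => 2^-1 * (y j x + y k x)).
    split; first exact/H10Z/H10D.
    exact: (rint_sqr_mid su (H1_sq hyj) (H1_sq hyk)).
  have h3 := aK _ _ Kmid.
  have h4 := rint_sqr_diff su (H1_sq hyj) (H1_sq hyk).
  have h5 := hsup j; have h6 := hsup k.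
  have h7 : j.+1%:R^-1 <= m.+1%:R^-1 :> R by rewrite lef_pV2 ?posrE// ler_nat.
  have h8 : k.+1%:R^-1 <= m.+1%:R^-1 :> R by rewrite lef_pV2 ?posrE// ler_nat.
  move: h1 h2 h3 h4 h5 h6 h7 h8 dj dk Ij Ik.
  move: (a j) (a k) (a m) (sup (range a)) (j.+1%:R^-1) (k.+1%:R^-1) (m.+1%:R^-1) => x1 x2 x3 x4 x5 x6 x7.
  move: (dirichlet (y j) (y j)) (dirichlet (y k) (y k)) (dirichlet (fun x => 2^-1 * _) _) => d1 d2 d3.
  set i1 := Rintegral _ _ _; set i2 := Rintegral _ _ _; set i3 := Rintegral _ _ _.
  clearbody i1 i2 i3; have := sqr_ge0 e; move: (e ^+ 2) => ee; lra.
have hv1 := H10_H1 hv.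
have cg i := H1_cvg_grad i hv1 (fun k => H10_H1 (Hy k)) (gradP hv1)
  (fun k => gradP (H10_H1 (Hy k))) cv.
(* The [y k] tend to [u] in L^2 while their gradients tend to that of [v], which places [u] itself
   in H^1_0 without identifying it with [v]. *)
by have [] := H10_limit Hy su (fun i => wgrad_sq i (gradP hv1))
  (fun k => gradP (H10_H1 (Hy k))) cy cg.
Qed.

(** For a test function in place of [u], the second derivatives are moved onto it and L^2
    convergence suffices. Density and the bound on the Dirichlet integrals give the general case. *)
Lemma dirichlet_weak u (w_ : nat -> V -> R) (C : R) : H10 Omega u ->
  (forall k, H10 Omega (w_ k)) -> (forall k, dirichlet (w_ k) (w_ k) <= C) ->
  I (fun x => w_ k x ^+ 2) @[k --> \oo] --> 0 ->
  dirichlet u (w_ k) @[k --> \oo] --> 0.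
Proof.
move=> hu hw hC cw.
have test0 phi : test_function Omega phi -> dirichlet phi (w_ k) @[k --> \oo] --> 0.
  move=> tphi; have hphi := test_H1 tphi.
  have -> : (fun k => dirichlet phi (w_ k)) = (fun k => \sum_(i < n)
      - I (fun x => w_ k x * partial i (partial i phi) x)).
    apply/funext => k; have hwk := H10_H1 (hw k).
    rewrite (dirichletE hphi hwk (test_wgrad tphi) (gradP hwk)).
    apply: eq_bigr => i _; have [_ /(_ i _ (test_partial i tphi)) ->] := gradP hwk.
    by rewrite opprK; apply: eq_Rintegral => x _; rewrite mxE mulrC.
  suff : (fun k => \sum_(i < n) - I (fun x => w_ k x * partial i (partial i phi) x)) @ \oo -->
      \sum_(i < n) (0 : R) by rewrite big1.
  apply: (@cvg_big R 'I_n +%R 0 xpredT (@add_continuous R) nat \oo) => i _.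
  rewrite -[X in _ --> X]oppr0; apply: cvgN.
  have s0 : sq (fun=> 0) by have := square_integrableZ mOm 0 (H10_sq hu); congr sq; apply/funext => x; rewrite mul0r.
  have -> : 0 = I (fun x => 0 * partial i (partial i phi) x).
    by under eq_Rintegral do rewrite mul0r; rewrite Rintegral_cst// mul0r.
  apply: (rint_cvgM mOm (fun k => H10_sq (hw k)) s0).
    exact: test_square oO bO _ (test_partial i (test_partial i tphi)).
  by under [X in X @ _ --> _]eq_fun do under eq_Rintegral do rewrite sub0r sqrrN.
apply/cvgrPdist_lt => e e0.
have C0 : 0 <= C by apply: le_trans (hC 0%N); exact: dirichlet_ge0.
have e1 : 0 < e / 2 / (Num.sqrt C + 1) by rewrite !divr_gt0// ltr_wpDl// sqrtr_ge0.
have [phi tphi hphi] := H10_approx hu e1.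
have e2 : 0 < e / 2 by rewrite divr_gt0.
move/cvgrPdist_lt : (test0 phi tphi) => /(_ _ e2); apply: filterS => k.
rewrite !sub0r !normrN => h.
have hu1 := H10_H1 hu; have hwk := H10_H1 (hw k); have hp := test_H1 tphi.
have E := dirichletBl hu1 hp hwk.
have -> : dirichlet u (w_ k) = dirichlet (fun x => u x - phi x) (w_ k) + dirichlet phi (w_ k).
  by rewrite E subrK.
apply: le_lt_trans (ler_normD _ _) _; rewrite [ltRHS]splitr; apply: ler_ltD => //.
have CS := dirichlet_cauchy_schwarz (H1B hu1 hp) hwk.
have D1 := H1_norm_dirichlet (H1B hu1 hp).
rewrite -ler_sqr ?nnegrE ?(ltW e2)// real_normK ?num_real//.
apply: (le_trans CS).
have D2 : (Num.sqrt C) ^+ 2 = C by exact: sqr_sqrtr.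
apply: (@le_trans _ _ (H1_norm Omega (fun x => u x - phi x) ^+ 2 * (Num.sqrt C) ^+ 2)).
  by rewrite D2; apply: ler_pM; rewrite ?dirichlet_ge0.
rewrite -exprMn lerXn2r ?nnegrE ?mulr_ge0 ?H1_norm_ge0 ?sqrtr_ge0 ?(ltW e0)//.
move: hphi; rewrite ltr_pdivlMr ?ltr_wpDl ?sqrtr_ge0// => /ltW; apply: le_trans.
by apply: ler_wpM2l; [exact: H1_norm_ge0|rewrite lerDl].
Qed.

Lemma strict_mono_ge (s : nat -> nat) : (forall k, (s k < s k.+1)%N) -> forall k, (k <= s k)%N.
Proof. by move=> h; elim=> // k IH; apply: leq_ltn_trans (h k). Qed.

(** Each member is replaced by a test function at distance less than 1/(k+1) in H^1, which changes
    neither boundedness nor L^2 limits. [H10_weak_limit] then puts the L^2 limit in H^1_0. *)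
Lemma H10_precompact (u_ : nat -> V -> R) (A : R) : (forall k, H10 Omega (u_ k)) ->
  (forall k, H1_norm Omega (u_ k) <= A) ->
  exists (s : nat -> nat) (u : V -> R), [/\ forall k, (s k < s k.+1)%N, H10 Omega u &
    I (fun x => (u x - u_ (s k) x) ^+ 2) @[k --> \oo] --> 0].
Proof.
move=> hu hA; have A0 : 0 <= A by apply: le_trans (hA 0%N); exact: H1_norm_ge0.
have hphi k : exists phi, test_function Omega phi /\
    H1_norm Omega (fun x => u_ k x - phi x) < k.+1%:R^-1.
  have [|phi tphi h] := H10_approx (e := k.+1%:R^-1) (hu k); first by rewrite invr_gt0.
  by exists phi.
have [phi tphi'] := choice hphi.
have tphi k : test_function Omega (phi k) by case: (tphi' k).
have hd k : H1_norm Omega (fun x => u_ k x - phi k x) < k.+1%:R^-1 by case: (tphi' k).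
have Hphi k : H1 Omega (phi k) by exact: test_H1.
have nphi k : H1_norm Omega (phi k) <= A + 1.
  have -> : phi k = fun x => u_ k x - (u_ k x - phi k x) by apply/funext => x; ring.
  have hB := H1B (H10_H1 (hu k)) (Hphi k).
  apply: le_trans (_ : H1_norm Omega (u_ k) + H1_norm Omega (fun x => - (u_ k x - phi k x)) <= _).
    have hN : H1 Omega (fun x => - (u_ k x - phi k x)).
      have := H1Z (-1) hB; congr (H1 _); apply/funext => x; ring.
    exact: H1_normD (H10_H1 (hu k)) hN.
  rewrite (H1_normN hB) lerD// (le_trans (ltW (hd k)))// invf_le1 ?ltr0n// ler1n//.
have supp (f : V -> R) : test_function Omega f -> l2norm mu setT f = Num.sqrt (I (fun x => f x ^+ 2)).
  move=> tf; congr Num.sqrt; apply: rint_support => // x _ nO.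
  by rewrite (test_zero tf nO) expr0n.
have n1 k : l2norm mu setT (phi k) <= A + 1.
  rewrite (supp _ (tphi k)); apply: le_trans (nphi k).
  by rewrite H1_normE// ler_wsqrtr// lerDl dirichlet_ge0.
have n2 k i : l2norm mu setT (partial i (phi k)) <= A + 1.
  rewrite (supp _ (test_partial i (tphi k))); apply: le_trans (nphi k).
  rewrite H1_normE// ler_wsqrtr//.
  have := dirichletE (Hphi k) (Hphi k) (test_wgrad (tphi k)) (test_wgrad (tphi k)).
  rewrite (bigD1 i)//= => ->.
  rewrite (_ : I (fun x => (\row_j partial j (phi k) x) 0 i * (\row_j partial j (phi k) x) 0 i)
    = I (fun x => partial i (phi k) x ^+ 2)); last by apply: eq_Rintegral => x _; rewrite mxE.
  rewrite addrCA lerDl addr_ge0//; first exact: rint_sqr_ge0.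
  apply: sumr_ge0 => j _; apply: Rintegral_ge0 => x _; exact: sqr_ge0.
have [s hs hc] := test_precompact oO bO (addr_ge0 A0 ler01) tphi n1 n2.
have sphi k : sq (phi (s k)) by exact: test_square.
have [|w sw hw] := riesz_fischer mOm sphi.
  move=> e /hc[m hm]; exists m => j k mj mk; apply: le_trans (hm _ _ mj mk).
  rewrite [leRHS](_ : _ = I (fun x => (phi (s j) x - phi (s k) x) ^+ 2))//.
  apply: rint_support => // x _ nO.
  by rewrite (test_zero (tphi _) nO) (test_zero (tphi _) nO) subrr expr0n.
have su k : sq (u_ (s k)) by exact: H10_sq.
have cw : I (fun x => (w x - u_ (s k) x) ^+ 2) @[k --> \oo] --> 0.
  apply: (@cvg0_le _ _ (fun k => 2 * I (fun x => (w x - phi (s k) x) ^+ 2) + 2 * k.+1%:R^-1)).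
    move=> k; rewrite rint_sqr_ge0/=.
    have := rint_sqr_diff (sphi k) sw (su k); move/le_trans; apply; apply: lerD.
      rewrite (_ : I (fun x => (phi (s k) x - w x) ^+ 2) = I (fun x => (w x - phi (s k) x) ^+ 2))//.
      by apply: eq_Rintegral => x _; rewrite -sqrrN opprB.
    rewrite ler_pM2l// (_ : I (fun x => (phi (s k) x - u_ (s k) x) ^+ 2) = I (fun x => (u_ (s k) x - phi (s k) x) ^+ 2)); last first.
      by apply: eq_Rintegral => x _; rewrite -sqrrN opprB.
    apply: le_trans (H1_norm_l2 (H1B (H10_H1 (hu (s k))) (Hphi (s k)))) _.
    have k1 : 0 < k.+1%:R :> R by rewrite ltr0n.
    have h1 : H1_norm Omega (fun x => u_ (s k) x - phi (s k) x) <= k.+1%:R^-1.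
      apply: le_trans (ltW (hd (s k))) _; rewrite lef_pV2 ?posrE ?ltr0n// ler_nat ltnS.
      exact: strict_mono_ge.
    apply: le_trans (_ : k.+1%:R^-1 ^+ 2 <= _).
      by rewrite lerXn2r ?nnegrE ?H1_norm_ge0// invr_ge0 ltW.
    rewrite expr2 ler_piMl ?invr_ge0 ?(ltW k1)// invf_le1// ler1n//.
  rewrite -[X in _ --> X](addr0 0) -{1}(mulr0 2) -[X in _ + X](mulr0 2).
  by apply: cvgD; apply: cvgMr; [exact: hw|exact: cvg_harmonic].
exists s, w; split => //.
apply: (H10_weak_limit (C := A ^+ 2) (fun k => hu (s k)) sw _ cw) => k.
apply: le_trans (H1_norm_dirichlet (H10_H1 (hu (s k)))) _.
by rewrite lerXn2r ?nnegrE ?H1_norm_ge0.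
Qed.

(** * The Sobolev and Poincare inequalities *)

Local Notation p := (@crit_exp R n).
Local Notation S := (sobolev_const Omega).
Hypothesis n3 : (3 <= n)%N.

Lemma dim_ge3 : 3 <= n%:R :> R. Proof. by rewrite (ler_nat R 3). Qed.

Lemma crit_gt2 : 2 < p.
Proof.
have h := dim_ge3; have h2 : 0 < n%:R - 2 :> R by lra.
rewrite /crit_exp ltr_pdivlMr//; lra.
Qed.

Lemma crit_half : p / 2 - 1 = 2 / (n%:R - 2).
Proof.
have h := dim_ge3; have h2 : n%:R - 2 != 0 :> R by rewrite gt_eqF//; lra.
by rewrite /crit_exp; move: (n%:R : R) h2 => N h2; field.
Qed.

Lemma crit_inv : 2^-1 - p^-1 = n%:R^-1.
Proof.
have h := dim_ge3; have h2 : n%:R - 2 != 0 :> R by rewrite gt_eqF//; lra.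
have h3 : n%:R != 0 :> R by rewrite gt_eqF//; lra.
by rewrite /crit_exp; move: (n%:R : R) h2 h3 => N h2 h3; field; rewrite h2 h3.
Qed.

Hypothesis S0 : 0 < S.

Lemma measurable_powR_comp u (r : R) : measurable_fun Omega u -> measurable_fun Omega (fun x => u x `^ r).
Proof. by move=> mu_; apply: (measurableT_comp (measurable_powR r)). Qed.

Lemma measurable_norm_powR u (r : R) : measurable_fun Omega u -> measurable_fun Omega (fun x => `|u x| `^ r).
Proof.
by move=> mu_; apply: measurable_powR_comp; apply: measurableT_comp => //.
Qed.

Lemma sobolev_quotient u : H10 Omega u -> ~ {ae mu, forall x, Omega x -> u x = 0} ->
  S <= dirichlet u u / (I (fun x => `|u x| `^ p)) `^ (2 / p).
Proof.
move=> hu nu; rewrite -(rint_sqr_grad (H10_H1 hu)).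
apply: ge_inf; last by exists u.
exists 0 => _ [v [hv _] <-]; rewrite (rint_sqr_grad (H10_H1 hv)).
by rewrite divr_ge0 ?powR_ge0// dirichlet_ge0.
Qed.

(* A function with a non-integrable p-th power would have quotient 0 because of
   [fine +oo = 0] and [x / 0 = 0], contradicting S > 0. *)
Lemma sobolev_integrable u : H10 Omega u -> rintegrable mu Omega (fun x => `|u x| `^ p).
Proof.
move=> hu; have p2 := crit_gt2; have [mu_ _] := H10_sq hu.
have mup := measurable_norm_powR p mu_.
have q0 : (0 <= \int[mu]_(x in Omega) (`|u x| `^ p)%:E)%E.
  by apply: integral_ge0 => x _; rewrite lee_fin powR_ge0.
apply/integrableP; split; first exact/measurable_EFinP.
rewrite (_ : integral _ _ _ = \int[mu]_(x in Omega) (`|u x| `^ p)%:E)%E; last first.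
  by apply: eq_integral => x _ /=; rewrite ger0_norm// powR_ge0.
rewrite ltNge leye_eq; apply/negP => /eqP qoo.
have [u0|nu] := pselect {ae mu, forall x, Omega x -> u x = 0}.
  move: qoo; rewrite (@ae_eq_integral _ _ _ mu Omega (cst 0%E) (fun x => (`|u x| `^ p)%:E))//.
  - by rewrite integral0.
  - exact/measurable_EFinP.
  - by apply: filterS u0 => x h Dx; rewrite h// normr0 powR0//; rewrite gt_eqF//; lra.
have := sobolev_quotient hu nu.
rewrite /Rintegral qoo /= powR0; first by rewrite invr0 mulr0 leNgt S0.
by rewrite gt_eqF// divr_gt0//; lra.
Qed.

Lemma sobolev_inequality u : H10 Omega u ->
  S * (I (fun x => `|u x| `^ p)) `^ (2 / p) <= dirichlet u u.
Proof.
move=> hu; have p2 := crit_gt2; have iu := sobolev_integrable hu.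
have q0 : 0 <= I (fun x => `|u x| `^ p) by apply: Rintegral_ge0 => x _; exact: powR_ge0.
move: q0; rewrite le_eqVlt => /predU1P[<-|q0].
  rewrite powR0 ?mulr0 ?dirichlet_ge0//; first by rewrite gt_eqF// divr_gt0//; lra.
rewrite -ler_pdivlMr ?powR_gt0//; apply: sobolev_quotient => // u0.
move: q0; rewrite (ae_eq_rint mOm (g := fun=> 0)) ?Rintegral_cst ?mul0r ?ltxx//.
- by case/integrableP : iu => /measurable_EFinP.
- by apply: filterS u0 => x h Dx; rewrite h// normr0 powR0//; rewrite gt_eqF//; lra.
Qed.

Lemma sobolev_power u : H10 Omega u ->
  I (fun x => `|u x| `^ p) <= (dirichlet u u / S) `^ (p / 2).
Proof.
move=> hu; have p2 := crit_gt2; have := sobolev_inequality hu.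
have q0 : 0 <= I (fun x => `|u x| `^ p) by apply: Rintegral_ge0 => x _; exact: powR_ge0.
set q := Rintegral _ _ _ in q0 *; rewrite mulrC -ler_pdivlMr// => h.
have -> : q = (q `^ (2 / p)) `^ (p / 2).
  rewrite -powRrM (_ : 2 / p * (p / 2) = 1) ?powRr1//.
  by field; rewrite gt_eqF//; lra.
have ph : 0 <= p / 2 by lra.
by rewrite (ge0_ler_powR ph) ?nnegrE ?powR_ge0// divr_ge0 ?dirichlet_ge0 ?(ltW S0).
Qed.

(* By homogeneity it is enough to bound the L^2 norm when the Dirichlet integral
   is at most 1, where u^2 <= 1 + |u|^p. *)
Lemma poincare : exists2 C : R, 0 <= C & forall u, H10 Omega u ->
  I (fun x => u x ^+ 2) <= C * dirichlet u u.
Proof.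
have p2 := crit_gt2.
pose C := fine (mu Omega) + S^-1 `^ (p / 2).
have C0 : 0 <= C by rewrite addr_ge0 ?powR_ge0// fine_ge0.
have unit u : H10 Omega u -> dirichlet u u <= 1 -> I (fun x => u x ^+ 2) <= C.
  move=> hu u1; have iu := sobolev_integrable hu.
  have i1 : rintegrable mu Omega (fun x => 1 + `|u x| `^ p).
    by apply: rintegrableD => //; apply: rintegrable_cst => //; exact: finO.
  apply: (@le_trans _ _ (I (fun x => 1 + `|u x| `^ p))).
    apply: le_Rintegral => //; first by case: (H10_sq hu).
    move=> x _; rewrite -(real_normK (num_real (u x))) -powR_mulrn//.
    by apply: powR_le1D => //; lra.
  rewrite RintegralD//; last by apply: rintegrable_cst => //; exact: finO.
  rewrite Rintegral_cst// mul1r lerD2l; apply: le_trans (sobolev_power hu) _.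
  have ph : 0 <= p / 2 by lra.
  rewrite (ge0_ler_powR ph) ?nnegrE ?divr_ge0 ?dirichlet_ge0 ?invr_ge0 ?(ltW S0)//.
  by rewrite ler_piMl// invr_ge0 ltW.
exists C => // u hu; have D0 := dirichlet_ge0 u.
apply/ler_addgt0Pr => e e0.
have C1 : 0 < C + 1 by rewrite ltr_wpDl.
(* The added term allows normalisation even when the Dirichlet integral vanishes; it costs C e / (C
   + 1) <= e. *)
pose d := dirichlet u u + e / (C + 1); have d0 : 0 < d by rewrite ltr_wpDl// divr_gt0.
have := unit _ (H10Z (Num.sqrt d)^-1 hu).
have sd : (Num.sqrt d)^-1 ^+ 2 = d^-1 by rewrite exprVn sqr_sqrtr// ltW.
rewrite (dirichlet_sqrZ _ (H10_H1 hu)) sd.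
rewrite (_ : I (fun x => ((Num.sqrt d)^-1 * u x) ^+ 2) = d^-1 * I (fun x => u x ^+ 2)); last first.
  rewrite -sd -RintegralZl//; last by case: (H10_sq hu).
  by apply: eq_Rintegral => x _; rewrite exprMn.
rewrite ![d^-1 * _]mulrC ler_pdivrMr// mul1r ler_pdivrMr// /d => h.
apply: le_trans (h _) _; first by rewrite lerDl divr_ge0// ltW.
rewrite mulrDr lerD2l mulrCA ler_piMr ?(ltW e0)// ler_pdivrMr// mul1r; lra.
Qed.

(** * The functional and its derivative *)

Variables (beta : R -> R) (L lambda kappa epsilon : R).
Hypothesis dB : forall t : R, is_derive (t : R) (1 : R) B (beta t).
Hypothesis beta02 : forall t, 0 <= beta t <= 2.
Hypothesis beta0 : forall t, t <= 0 \/ 1 <= t -> beta t = 0.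
Hypothesis betaL : forall s t, `|beta s - beta t| <= L * `|s - t|.
Hypothesis PB : primitive0 beta = B.
Hypotheses (l0 : 0 < lambda) (k0 : 0 < kappa) (e0 : 0 < epsilon).
Local Notation J := (J_functional Omega beta lambda kappa epsilon).

Let fOm : (mu Omega < +oo)%E. Proof. exact: finO. Qed.

Definition potential (t : R) := B ((t - 1) / epsilon) - lambda / 2 * excess t ^+ 2 -
  kappa / p * excess t `^ p.

Definition potential' (t : R) := beta ((t - 1) / epsilon) / epsilon - lambda * excess t -
  kappa * excess t `^ (p - 1).

Lemma lipschitz_const_ge0 : 0 <= L.
Proof. by have := betaL 1 0; rewrite subr0 normr1 mulr1; apply: le_trans. Qed.

Lemma excess_continuous : continuous (@excess R).
Proof.
move=> t; apply: (@continuous_max _ _ (fun t : R => t - 1) (fun=> 0)).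
  by apply: continuousB; [exact: cvg_id|exact: cst_continuous].
exact: cst_continuous.
Qed.

Lemma beta_continuous : continuous beta.
Proof.
move=> t; apply/cvgrPdist_le => e ee; have L0 := lipschitz_const_ge0.
have L1 : 0 < L + 1 by rewrite ltr_wpDl.
have eL : 0 < e / (L + 1) by rewrite divr_gt0.
apply: filterS (nbhsx_ballx t _ eL) => s; rewrite /ball /= ltr_pdivlMr// => h.
apply: le_trans (betaL _ _) _; apply: le_trans (ltW h).
by rewrite mulrC ler_wpM2l// lerDl.
Qed.

Lemma measurable_excess u : measurable_fun Omega u -> measurable_fun Omega (fun x => excess (u x)).
Proof. exact: continuous_measurable_comp excess_continuous. Qed.

Lemma measurable_scaled u : measurable_fun Omega u ->
  measurable_fun Omega (fun x => (u x - 1) / epsilon).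
Proof. by move=> mu_; apply: measurable_funM => //; apply: measurable_funB. Qed.

Lemma excess_sq u : sq u -> sq (fun x => excess (u x)).
Proof.
move=> su; apply: (square_integrable_le mOm _ _ su); first by apply: measurable_excess; case: su.
by move=> x _; rewrite ger0_norm ?excess_ge0// excess_le.
Qed.

Lemma excess_powR_rintegrable u : H10 Omega u -> rintegrable mu Omega (fun x => excess (u x) `^ p).
Proof.
move=> hu; have p2 := crit_gt2; apply: (rintegrable_le mOm _ _ (sobolev_integrable hu)).
  by apply: measurable_powR_comp; apply: measurable_excess; case: (H10_sq hu).
move=> x _; rewrite ger0_norm ?powR_ge0//.
have p0 : 0 <= p by lra.
by rewrite (ge0_ler_powR p0) ?nnegrE ?excess_ge0// excess_le.
Qed.

Lemma step_rintegrable u : measurable_fun Omega u ->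
  rintegrable mu Omega (fun x => B ((u x - 1) / epsilon)).
Proof.
move=> mu_; apply: (@rintegrable_bounded _ _ _ mu _ mOm fOm _ 1).
  by apply: continuous_measurable_comp (measurable_scaled mu_); apply: smooth1_continuous; case: stB.
by move=> x _; have [_ _ _ h] := stB; have /andP[h1 h2] := h ((u x - 1) / epsilon); rewrite ger0_norm.
Qed.

Lemma potential_rintegrable u : H10 Omega u -> rintegrable mu Omega (fun x => potential (u x)).
Proof.
move=> hu; have su := H10_sq hu; have [mu_ _] := su.
apply: (rintegrableB mOm); last exact: (rintegrableZ mOm (kappa / p) (excess_powR_rintegrable hu)).
apply: (rintegrableB mOm); first exact: step_rintegrable.
apply: (rintegrableZ mOm (lambda / 2)); exact: (excess_sq su).2.
Qed.

Lemma functionalE u : H10 Omega u ->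
  J u = 2^-1 * dirichlet u u + I (fun x => potential (u x)).
Proof.
move=> hu; rewrite -(rint_sqr_grad (H10_H1 hu)) -(RintegralZl 2^-1 mOm (sqr_grad_rintegrable (H10_H1 hu))).
have iP := potential_rintegrable hu.
have iG := rintegrableZ mOm 2^-1 (sqr_grad_rintegrable (H10_H1 hu)).
rewrite -(RintegralD mOm iG iP); apply: eq_Rintegral => x _.
by rewrite /potential PB /excess !addrA.
Qed.

Lemma excess_pred_rintegrable u v : H10 Omega u -> H10 Omega v ->
  rintegrable mu Omega (fun x => excess (u x) `^ (p - 1) * v x).
Proof.
move=> hu hv; have p2 := crit_gt2; have p1 : 1 < p by lra.
have [mu_ _] := H10_sq hu; have [mv _] := H10_sq hv.
apply: (rintegrable_le mOm _ _ (rintegrableD mOm (excess_powR_rintegrable hu) (sobolev_integrable hv))).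
  by apply: measurable_funM => //; apply: measurable_powR_comp; exact: measurable_excess.
move=> x _; rewrite normrM (ger0_norm (powR_ge0 _ _)).
exact: powR_mixed p1 (excess_ge0 _) (normr_ge0 _).
Qed.

Lemma beta_rintegrable u v : H10 Omega u -> H10 Omega v ->
  rintegrable mu Omega (fun x => beta ((u x - 1) / epsilon) * v x).
Proof.
move=> hu hv; have [mu_ _] := H10_sq hu; have [mv _] := H10_sq hv.
have iv := square_integrable_rintegrable mOm fOm (H10_sq hv).
apply: (rintegrable_le mOm _ _ (rintegrableZ mOm 2 (rintegrable_norm iv))).
  apply: measurable_funM => //.
  exact: continuous_measurable_comp beta_continuous (measurable_scaled mu_).
move=> x _; have /andP[b1 b2] := beta02 ((u x - 1) / epsilon).
by rewrite normrM (ger0_norm b1) ler_wpM2r.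
Qed.

Lemma potential'_rintegrable u v : H10 Omega u -> H10 Omega v ->
  rintegrable mu Omega (fun x => potential' (u x) * v x) /\
  I (fun x => potential' (u x) * v x) = epsilon^-1 * I (fun x => beta ((u x - 1) / epsilon) * v x)
    - lambda * I (fun x => excess (u x) * v x) - kappa * I (fun x => excess (u x) `^ (p - 1) * v x).
Proof.
move=> hu hv.
have i1 := beta_rintegrable hu hv; have i3 := excess_pred_rintegrable hu hv.
have i2 := rintegrableM mOm (excess_sq (H10_sq hu)) (H10_sq hv).
have j1 := rintegrableZ mOm epsilon^-1 i1; have j2 := rintegrableZ mOm lambda i2.
have j3 := rintegrableZ mOm kappa i3.
have j := rintegrableB mOm (rintegrableB mOm j1 j2) j3.
have E : (fun x => epsilon^-1 * (beta ((u x - 1) / epsilon) * v x) - lambda * (excess (u x) * v x)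
   - kappa * (excess (u x) `^ (p - 1) * v x)) = (fun x => potential' (u x) * v x).
  apply/funext => x; rewrite /potential'; ring.
split; first by rewrite -E.
rewrite -E (RintegralB mOm (rintegrableB mOm j1 j2) j3) (RintegralB mOm j1 j2).
by rewrite (RintegralZl _ mOm i1) (RintegralZl _ mOm i2) (RintegralZl _ mOm i3).
Qed.

Definition first_variation u v := dirichlet u v + I (fun x => potential' (u x) * v x).

Lemma potential_second_order t h (s : R) : `|s| <= 1 ->
  `|potential (t + s * h) - potential t - potential' t * (s * h)| <=
  ((L / epsilon ^+ 2 + lambda) * h ^+ 2 +
    (kappa * (p - 1) * 2 `^ p) * (`|t| `^ p + `|h| `^ p)) * s ^+ 2.
Proof.
move=> s1; have p2 := crit_gt2.
have h1 := lipschitz_second_order ((t - 1) / epsilon) (s * h / epsilon) dB betaL.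
have h2 := excess_second_order t (s * h).
have h3 := excess_powR_scaled t h p2 s1.
rewrite /potential /potential' (_ : (t + s * h - 1) / epsilon = (t - 1) / epsilon + s * h / epsilon); last by ring.
move: h1 h2 h3.
set b1 := B _; set b0 := B _; set b' := beta _; set a1 := excess (t + _); set a0 := excess t.
set c1 := a1 `^ p; set c0 := a0 `^ p; set c' := a0 `^ (p - 1); set T := `|t| `^ p + _; set Q := 2 `^ p.
move=> h1 h2 h3.
have -> : b1 - lambda / 2 * a1 ^+ 2 - kappa / p * c1 - (b0 - lambda / 2 * a0 ^+ 2 - kappa / p * c0)
    - (b' / epsilon - lambda * a0 - kappa * c') * (s * h) =
  (b1 - b0 - b' * (s * h / epsilon)) - (lambda / 2 * (a1 ^+ 2 - a0 ^+ 2 - 2 * a0 * (s * h)))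
   - kappa / p * (c1 - c0 - p * c' * (s * h)).
  by field; rewrite !gt_eqF//; lra.
apply: le_trans (ler_normB _ _) _.
have -> : ((L / epsilon ^+ 2 + lambda) * h ^+ 2 + kappa * (p - 1) * Q * T) * s ^+ 2 =
  L * (s * h / epsilon) ^+ 2 + lambda / 2 * (2 * (s * h) ^+ 2) + kappa / p * (p * (p - 1) * Q * T * s ^+ 2).
  by field; rewrite !gt_eqF//; lra.
apply: lerD; last first.
  have kp : 0 <= kappa / p by rewrite ltW// divr_gt0//; lra.
  by rewrite normrM (ger0_norm kp) ler_wpM2l.
apply: le_trans (ler_normB _ _) _; apply: lerD => //.
by rewrite normrM ger0_norm ?divr_ge0 ?(ltW l0)// ler_wpM2l// divr_ge0 ?(ltW l0).
Qed.

(** The quadratic remainder of the potential is dominated by an integrable function independent of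
    s. Rays suffice: the Palais-Smale condition supplies a Frechet derivative, and only its values
    have to be identified. *)
Lemma functional_expansion u v : H10 Omega u -> H10 Omega v ->
  exists2 C : R, 0 <= C & forall s : R, `|s| <= 1 ->
    `|J (fun x => u x + s * v x) - J u - s * first_variation u v| <= C * s ^+ 2.
Proof.
move=> hu hv; have p2 := crit_gt2.
pose bnd x := (L / epsilon ^+ 2 + lambda) * v x ^+ 2 +
  (kappa * (p - 1) * 2 `^ p) * (`|u x| `^ p + `|v x| `^ p).
have ib : rintegrable mu Omega bnd.
  apply: (rintegrableD mOm); first by apply: (rintegrableZ mOm); case: (H10_sq hv).
  by apply: (rintegrableZ mOm); apply: (rintegrableD mOm); exact: sobolev_integrable.
have b0 x : 0 <= bnd x.
  have L0 := lipschitz_const_ge0; apply: addr_ge0.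
    by rewrite mulr_ge0 ?sqr_ge0// addr_ge0 ?(ltW l0)// divr_ge0 ?sqr_ge0.
  apply: mulr_ge0; last by rewrite addr_ge0 ?powR_ge0.
  by rewrite mulr_ge0 ?powR_ge0// mulr_ge0 ?(ltW k0)//; lra.
exists (2^-1 * dirichlet v v + I bnd).
  by rewrite addr_ge0 ?mulr_ge0 ?dirichlet_ge0// Rintegral_ge0.
move=> s s1; have hsv := H10Z s hv; have huv := H10D hu hsv.
rewrite (functionalE huv) (functionalE hu) /first_variation.
rewrite (dirichlet_sqrD (H10_H1 hu) (H10_H1 hsv)) (dirichlet_sqrZ s (H10_H1 hv)).
rewrite (dirichlet_sym u (fun x => s * v x)) (dirichletZl s (H10_H1 hv) (H10_H1 hu)) (dirichlet_sym v u).
have iG := potential_rintegrable huv; have iG0 := potential_rintegrable hu.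
have [ig _] := potential'_rintegrable hu hv.
have igs := rintegrableZ mOm s ig.
have E : I (fun x => potential (u x + s * v x) - potential (u x) - s * (potential' (u x) * v x)) =
    I (fun x => potential (u x + s * v x)) - I (fun x => potential (u x)) - s * I (fun x => potential' (u x) * v x).
  by rewrite (RintegralB mOm (rintegrableB mOm iG iG0) igs) (RintegralB mOm iG iG0) (RintegralZl _ mOm ig).
have ir := rintegrableB mOm (rintegrableB mOm iG iG0) igs.
have bd : `|I (fun x => potential (u x + s * v x) - potential (u x) - s * (potential' (u x) * v x))| <= I bnd * s ^+ 2.
  apply: le_trans (le_normr_Rintegral mOm ir) _.
  rewrite mulrC -(RintegralZl (s ^+ 2) mOm ib); apply: le_Rintegral => //.
  - exact: (rintegrable_norm ir).
  - exact: (rintegrableZ mOm (s ^+ 2) ib).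
  move=> x _; have := potential_second_order (u x) (v x) s1.
  by rewrite [s ^+ 2 * _]mulrC (_ : s * (potential' (u x) * v x) = potential' (u x) * (s * v x)) //; ring.
have := dirichlet_ge0 v; move: bd; rewrite E; move: (dirichlet u u) (dirichlet u v) (dirichlet v v) (Rintegral _ _ bnd).
move: (Rintegral _ _ (fun x => potential (u x + s * v x))) (Rintegral _ _ (fun x => potential (u x)))
  (Rintegral _ _ (fun x => potential' (u x) * v x)) => g1 g0 g' duu duv dvv C.
move=> h1 D0.
rewrite (_ : 2^-1 * _ + g1 - _ - _ = 2^-1 * dvv * s ^+ 2 + (g1 - g0 - s * g')); last by field.
apply: le_trans (ler_normD _ _) _; rewrite mulrDl lerD//.
by rewrite ger0_norm// mulr_ge0 ?sqr_ge0// mulr_ge0.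
Qed.

Lemma bounded_linearZ (l : (V -> R) -> R) (a : R) v : bounded_linear_H10 Omega l -> H10 Omega v ->
  l (fun x => a * v x) = a * l v.
Proof.
move=> [lin _] hv.
have z : H10 Omega (fun=> 0).
  by have := H10Z 0 hv; congr (H10 _); apply/funext => x; rewrite mul0r.
have := lin (-1) _ _ z z; rewrite mulr0 addr0.
move=> lz; have {}lz : l (fun=> 0) = 0 by lra.
have := lin a _ _ hv z; rewrite lz addr0 => <-; congr l.
by apply/funext => x; rewrite addr0.
Qed.

Lemma frechet_first_variation u v l : H10 Omega u -> is_frechet_derivative Omega J u l ->
  H10 Omega v -> l v = first_variation u v.
Proof.
move=> hu [bl fr] hv; have [C C0 hC] := functional_expansion hu hv.
have N0 := H1_norm_ge0 v; set N := H1_norm Omega v in N0.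
have C1 : 0 < C + 1 by rewrite ltr_wpDl.
have N1 : 0 < N + 1 by rewrite ltr_wpDl.
apply/eqP; rewrite -subr_eq0 -normr_eq0 eq_le normr_ge0 andbT.
apply/ler_addgt0Pl => e ee; rewrite addr0.
have e1 : 0 < e / 2 / (N + 1) by rewrite !divr_gt0.
have [d dd hd] := fr _ e1.
(* The three bounds allow, in turn, the expansion along the ray, the Frechet estimate for s v, and C
   s^2 <= s e / 2. *)
pose s := Num.min 1 (Num.min (d / (N + 1)) (e / 2 / (C + 1))).
have sp : 0 < s by rewrite !lt_min ltr01 !divr_gt0.
have s1 : `|s| <= 1 by rewrite gtr0_norm// ge_min lexx.
have sN : s * N < d.
  have : s <= d / (N + 1) by rewrite !ge_min lexx orbT.
  rewrite ler_pdivlMr// => h; apply: lt_le_trans h; rewrite ltr_pM2l//; lra.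
have sC : s * C <= e / 2.
  have : s <= e / 2 / (C + 1) by rewrite !ge_min lexx !orbT.
  rewrite ler_pdivlMr// => h; apply: le_trans h; rewrite ler_pM2l//; lra.
have nsv : H1_norm Omega (fun x => s * v x) = s * N.
  by rewrite (H1_normZ s (H10_H1 hv)) gtr0_norm.
have := hd _ (H10Z s hv); rewrite nsv => /(_ sN).
rewrite (bounded_linearZ s bl hv) => h1; have h2 := hC s s1.
have h3 : e / 2 / (N + 1) * (s * N) <= s * (e / 2).
  rewrite mulrCA ler_pM2l// mulrAC ler_pdivrMr// ler_pM2l ?divr_gt0//; lra.
rewrite -(ler_pM2l sp) -{1}(gtr0_norm sp) -normrM.
have := le_trans h1 h3; move: h2.
rewrite (_ : u \+ (fun x => s * v x) = (fun x => u x + s * v x))//.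
move: (J _) (J u) (l v) (first_variation u v) => j1 j0 lv fv h2 h4.
have h5 : C * s ^+ 2 <= s * (e / 2) by rewrite expr2 mulrC -mulrA ler_pM2l.
move: h4 (le_trans h2 h5); rewrite !ler_norml => /andP[a1 a2] /andP[a3 a4].
by apply/andP; split; lra.
Qed.

(** Boundedness of [l] makes the supremum finite, and normalising [v] gives the inequality. When the
    norm of [v] is 0, boundedness gives l v = 0 directly. *)
Lemma dual_norm_bound l v : bounded_linear_H10 Omega l -> H10 Omega v ->
  `|l v| <= dual_norm Omega l * H1_norm Omega v.
Proof.
move=> bl hv; have [_ [C hC]] := bl.
have N0 := H1_norm_ge0 v; move: N0; rewrite le_eqVlt => /predU1P[N0|N0].
  by have := hC _ hv; rewrite -N0 !mulr0.
set N := H1_norm Omega v in N0 *.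
have lv : `|l v| = N * `|l (fun x => N^-1 * v x)|.
  by rewrite (bounded_linearZ _ bl hv) normrM gtr0_norm ?invr_gt0// mulVKf// gt_eqF.
rewrite lv mulrC ler_pM2r//; apply: ub_le_sup.
  exists `|C| => _ [w [hw w1] <-]; apply: le_trans (hC _ hw) _.
  apply: le_trans (_ : `|C| * H1_norm Omega w <= _).
    by rewrite ler_wpM2r ?H1_norm_ge0// ler_norm.
  by rewrite ler_piMr.
exists (fun x => N^-1 * v x); last by [].
split; first exact: H10Z.
by rewrite (H1_normZ _ (H10_H1 hv)) gtr0_norm ?invr_gt0// mulVf// gt_eqF.
Qed.

(** * Palais-Smale sequences are bounded *)

Lemma is_derive_affine (F : R -> R) (a b c t df : R) : is_derive (a * t + b) (1 : R) F df ->
  is_derive (t : R) (1 : R) (fun t => c * F (a * t + b)) (c * (a * df)).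
Proof.
move=> dF.
have h : is_derive (t : R) (1 : R) (fun t : R => a * t + b) a.
  have h1 := is_deriveZ a (is_derive_id (t : R) (1 : R)).
  have := is_deriveD h1 (is_derive_cst b (t : R) (1 : R)).
  by rewrite addr0 -[a *: 1]/(a * 1) mulr1.
have hF := @is_derive1_comp R F (fun t => a * t + b) t df a dF h.
by have := is_deriveZ c hF; rewrite -[c *: (df * a)]/(c * (df * a)) (mulrC df).
Qed.

Lemma smooth1_affine (F : R -> R) (a b c : R) : smooth1 F -> smooth1 (fun t => c * F (a * t + b)).
Proof.
move=> sF k; elim: k c F sF => [|k IH] c F sF t;
  have dF (G : R -> R) (e s : R) : smooth1 G ->
    is_derive (s : R) (1 : R) (fun t => e * G (a * t + b)) (e * (a * derive1 G (a * s + b)))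
    by move=> sG; apply: is_derive_affine; rewrite derive1E; apply: derivableP; exact: (sG 0%N).
  by have [] := dF F c t sF.
rewrite derive1Sn (_ : derive1 (fun t => c * F (a * t + b)) = fun t => (c * a) * derive1 F (a * t + b)).
  by apply: IH; exact: smooth1_derive.
by apply/funext => s; rewrite derive1E -mulrA; have [_ ->] := dF F c s sF.
Qed.

Lemma primitive_derive t : is_derive (t : R) (1 : R) (primitive B) (B t).
Proof.
have [sB hB0 _ _] := stB; apply: is_derive_primitive => //; exact: smooth1_continuous.
Qed.

(* A smooth approximation of [excess], so that the chain rule applies to it. *)
Definition cutoff (d t : R) := d * primitive B (d^-1 * t - d^-1).

Lemma cutoff_derive (d t : R) : 0 < d ->
  is_derive (t : R) (1 : R) (cutoff d) (B ((t - 1) / d)).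
Proof.
move=> d0; have := is_derive_affine d (primitive_derive (d^-1 * t + - d^-1)).
rewrite mulrA divff ?gt_eqF// mul1r (_ : d^-1 * t - d^-1 = (t - 1) / d) //.
by ring.
Qed.

Lemma cutoff_derive1 (d : R) : 0 < d -> derive1 (cutoff d) = fun t => B ((t - 1) / d).
Proof.
by move=> d0; apply/funext => t; rewrite derive1E; have [_ ->] := cutoff_derive t d0.
Qed.

(** The step lies between 0 and 1 and equals 1 from 1 on, so its primitive loses at most 1 against
    t_+. Rescaling turns this loss into [d] in [cutoff_bounds]. *)
Lemma primitive_bounds t : 0 <= primitive B t <= Num.max t 0 /\ Num.max t 0 <= primitive B t + 1.
Proof.
have [sB hB0 hB1 hB] := stB.
have P0 s : s <= 0 -> primitive B s = 0 by apply: primitive_le0.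
have P00 := P0 0 (lexx 0).
case: (lerP t 0) => t0; first by rewrite P0//; split; lra.
have [c _] := MVT_is_derive 0 t primitive_derive; rewrite P00 !subr0 => E.
have /andP[b1 b2] := hB c.
split; first by rewrite E; apply/andP; split; nra.
case: (lerP t 1) => t1; first by rewrite E; nra.
have [c' hc'] := MVT_is_derive 1 t primitive_derive.
rewrite hB1; last by move: hc'; rewrite /Num.min /Num.max t1 => /andP[].
have [c2 _] := MVT_is_derive 0 1 primitive_derive; rewrite P00 !subr0 mulr1 => ->.
have /andP[b3 b4] := hB c2; lra.
Qed.

Lemma cutoff_bounds (d t : R) : 0 < d ->
  0 <= cutoff d t <= excess t /\ excess t <= cutoff d t + d.
Proof.
move=> d0; have [/andP[h1 h2] h3] := primitive_bounds (d^-1 * t - d^-1).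
have E : excess t = d * Num.max (d^-1 * t - d^-1) 0.
  have dn : d != 0 by rewrite gt_eqF.
  rewrite (_ : d^-1 * t - d^-1 = d^-1 * (t - 1)); last by ring.
  rewrite maxr_pMr ?(ltW d0)// mulr0 mulVKf//.
rewrite E /cutoff; split; first by rewrite mulr_ge0 ?(ltW d0)//= ler_pM2l.
by rewrite -[X in _ <= _ + X]mulr1 -mulrDr ler_pM2l.
Qed.

Lemma step_lipschitz s t : `|B s - B t| <= 2 * `|s - t|.
Proof.
have [c _ ->] := MVT_is_derive t s dB.
by have /andP[b1 b2] := beta02 c; rewrite normrM (ger0_norm b1) ler_wpM2r.
Qed.

(** The chain rule multiplies the gradient by a factor in [0, 1], which can only decrease both
    Dirichlet integrals. *)
Lemma cutoff_H10 (d : R) u : 0 < d -> H10 Omega u ->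
  [/\ H10 Omega (fun x => cutoff d (u x)),
      dirichlet u (fun x => cutoff d (u x)) <= dirichlet u u &
      H1_norm Omega (fun x => cutoff d (u x)) <= H1_norm Omega u].
Proof.
move=> d0 hu; have [sB hB0 hB1 hB] := stB; have su := H10_sq hu.
have sc : smooth1 (cutoff d).
  by apply: smooth1_affine; exact: (smooth1_primitive primitive_derive).
have c0 : cutoff d 0 = 0.
  rewrite /cutoff mulr0 sub0r primitive_le0 ?mulr0// oppr_le0 invr_ge0 ltW//.
(* 2 / d is a Lipschitz constant for the derivative B((t - 1)/d) of the cutoff, because [beta] is at
   most 2. *)
have [||| hc gc] := H10_comp (C := 2 / d) sc c0 _ _ _ hu.
- by rewrite divr_ge0// ltW.
- by move=> t; rewrite cutoff_derive1//; have /andP[b1 b2] := hB ((t - 1) / d); rewrite ger0_norm.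
- move=> s t; rewrite cutoff_derive1//; apply: le_trans (step_lipschitz _ _) _.
  by rewrite -mulrBl normrM (gtr0_norm (x := d^-1)) ?invr_gt0// mulrA mulrAC opprB addrA subrK.
have gu := gradP (H10_H1 hu).
have sgu i : sq (fun x => grad Omega u x 0 i) := wgrad_sq i gu.
have sgc i := wgrad_sq i gc.
have gE x i : (derive1 (cutoff d) (u x) *: grad Omega u x) 0 i = B ((u x - 1) / d) * grad Omega u x 0 i.
  by rewrite mxE cutoff_derive1.
have le1 : dirichlet u (fun x => cutoff d (u x)) <= dirichlet u u.
  rewrite (dirichletE (H10_H1 hu) (H10_H1 hc) gu gc) (dirichletE (H10_H1 hu) (H10_H1 hu) gu gu).
  apply: ler_sum => i _; apply: le_Rintegral => //.
  - exact: (rintegrableM mOm (sgu i) (sgc i)).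
  - exact: (rintegrableM mOm (sgu i) (sgu i)).
  move=> x _; rewrite gE; have /andP[b1 b2] := hB ((u x - 1) / d).
  by rewrite mulrCA ler_piMl// -expr2 sqr_ge0.
split; [exact: hc|exact: le1|].
rewrite (H1_normE (H10_H1 hc)) (H1_normE (H10_H1 hu)) ler_wsqrtr// lerD//.
  apply: le_Rintegral => //; [exact: (H10_sq hc).2|exact: su.2|].
  move=> x _; have [/andP[h1 h2] _] := cutoff_bounds (u x) d0.
  rewrite -(real_normK (num_real (u x))) lerXn2r ?nnegrE//; exact: le_trans (excess_le _).
rewrite (dirichletE (H10_H1 hc) (H10_H1 hc) gc gc) (dirichletE (H10_H1 hu) (H10_H1 hu) gu gu).
apply: ler_sum => i _; apply: le_Rintegral => //.
- exact: (rintegrableM mOm (sgc i) (sgc i)).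
- exact: (rintegrableM mOm (sgu i) (sgu i)).
move=> x _; rewrite gE; have /andP[b1 b2] := hB ((u x - 1) / d).
by rewrite mulrACA ler_piMl// -?expr2 ?sqr_ge0// expr2; nra.
Qed.

(** With the cutoff replaced by the excess, the quadratic terms cancel and the powers leave kappa
    (1/2 - 1/p) = kappa / n. The replacement costs the term in [d]. Since B >= 0, only the [beta]
    term is lost, at most 1 per point. *)
Lemma potential_lower (d t : R) : 0 < d ->
  -1 + kappa / n%:R * excess t `^ p - d * ((kappa + lambda) / 2) * (1 + excess t `^ p) <=
  potential t - 2^-1 * (potential' t * cutoff d t).
Proof.
move=> d0; have p2 := crit_gt2; have n3' := dim_ge3.
have [/andP[h1 h2] h3] := cutoff_bounds t d0.
have a0 := excess_ge0 t.
have e1 : excess t <= 1 + excess t `^ p.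
  by rewrite -{1}(powRr1 a0); apply: powR_le1D => //; lra.
have e2 : excess t `^ (p - 1) <= 1 + excess t `^ p by apply: powR_le1D => //; lra.
have e3 : excess t * excess t `^ (p - 1) = excess t `^ p by apply: mulr_powRB1 => //; lra.
have [_ _ _ hB] := stB; have /andP[b1 b2] := hB ((t - 1) / epsilon).
(* Where [beta] does not vanish the excess is at most epsilon, which cancels the factor 1/epsilon; 2
   is the bound on [beta]. *)
have b3 : beta ((t - 1) / epsilon) / epsilon * cutoff d t <= 2.
  have [h|h] := pselect ((t - 1) / epsilon <= 0 \/ 1 <= (t - 1) / epsilon).
    by rewrite beta0// !mul0r.
  have /andP[q1 q2] := beta02 ((t - 1) / epsilon).
  have a1 : excess t <= epsilon.
    case: (lerP 1 ((t - 1) / epsilon)) => h5; first by exfalso; apply: h; right.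
    move: h5; rewrite ltr_pdivrMr// mul1r => h5.
    by have [[_ ->]|[_ ->]] := excessE t; exact: ltW.
  have a2 : epsilon^-1 * cutoff d t <= 1.
    by rewrite mulrC ler_pdivrMr// mul1r (le_trans h2).
  by rewrite -mulrA; apply: le_trans (ler_wpM2l q1 a2) _; rewrite mulr1.
rewrite /potential /potential'.
have kn : kappa / n%:R = kappa / 2 - kappa / p by rewrite -crit_inv; ring.
rewrite kn.
move: (B _) b1 b2 => bb b1 b2; move: (beta _ / epsilon) b3 => be b3.
move: (cutoff d t) h1 h2 h3 b3 => f h1 h2 h3 b3.
move: (excess t) (excess t `^ p) (excess t `^ (p - 1)) (powR_ge0 (excess t) (p - 1)) a0 e1 e2 e3 h2 h3 => a P Q Q0 a0 e1 e2 e3 h2 h3.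
move: (kappa / p) => kp.
have f1 : Q * (a - f) <= d * (1 + P).
  apply: le_trans (_ : Q * d <= _); first by rewrite ler_wpM2l//; lra.
  by rewrite mulrC ler_pM2l.
have f2 : a * (a - f) <= d * (1 + P).
  apply: le_trans (_ : a * d <= _); first by rewrite ler_wpM2l//; lra.
  by rewrite mulrC ler_pM2l.
have f3 := ler_wpM2l (ltW k0) f1; have f4 := ler_wpM2l (ltW l0) f2.
rewrite -e3 in f3 f4 *.
lra.
Qed.

(** The Dirichlet contribution, half of D(u, u) - D(u, cutoff u), is nonnegative and dropped; the
    rest is [potential_lower] integrated. *)
Lemma energy_bound (d : R) u : 0 < d -> H10 Omega u ->
  kappa / n%:R * I (fun x => excess (u x) `^ p) <=
  J u - 2^-1 * first_variation u (fun x => cutoff d (u x)) + fine (mu Omega) +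
  d * ((kappa + lambda) / 2) * (fine (mu Omega) + I (fun x => excess (u x) `^ p)).
Proof.
move=> d0 hu; have [hc le1 _] := cutoff_H10 d0 hu.
rewrite (functionalE hu) /first_variation.
have iP := potential_rintegrable hu; have [iD _] := potential'_rintegrable hu hc.
have ie := excess_powR_rintegrable hu.
have i1 : rintegrable mu Omega (fun=> 1) by exact: rintegrable_cst.
have i1e := rintegrableD mOm i1 ie.
have m1 : I (fun=> 1) = fine (mu Omega) by rewrite Rintegral_cst// mul1r.
set c1 := kappa / n%:R; set c2 := d * ((kappa + lambda) / 2).
have iz1 := rintegrableZ mOm c1 ie; have iz2 := rintegrableZ mOm c2 i1e.
have iz0 := rintegrableZ mOm (-1) i1; have iz3 := rintegrableZ mOm 2^-1 iD.
have iz01 := rintegrableD mOm iz0 iz1.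
have : I (fun x => -1 * 1 + c1 * excess (u x) `^ p - c2 * (1 + excess (u x) `^ p)) <=
   I (fun x => potential (u x) - 2^-1 * (potential' (u x) * cutoff d (u x))).
  apply: le_Rintegral => //.
  - exact: (rintegrableB mOm iz01 iz2).
  - exact: (rintegrableB mOm iP iz3).
  by move=> x _; rewrite mulr1; exact: potential_lower.
rewrite (RintegralB mOm iz01 iz2) (RintegralD mOm iz0 iz1) (RintegralB mOm iP iz3).
rewrite (RintegralZl c1 mOm ie) (RintegralZl c2 mOm i1e) (RintegralZl (-1) mOm i1) (RintegralZl 2^-1 mOm iD).
rewrite (RintegralD mOm i1 ie) m1.
move: (Rintegral _ _ (fun x => excess _ `^ p)) (Rintegral _ _ (fun x => potential (u x))) (Rintegral _ _ (fun x => potential' (u x) * _)) => q P Q.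
move: le1; move: (dirichlet u u) (dirichlet u _) => D1 D2.
by move: (fine (mu Omega)) => m; clearbody c1 c2; lra.
Qed.

Lemma potential_floor t : - (lambda / 2 * (1 + excess t `^ p) + kappa / p * excess t `^ p) <= potential t.
Proof.
have p2 := crit_gt2; have a0 := excess_ge0 t.
have e2 : excess t ^+ 2 <= 1 + excess t `^ p.
  by rewrite -powR_mulrn//; apply: powR_le1D => //; lra.
have [_ _ _ hB] := stB; have /andP[b1 b2] := hB ((t - 1) / epsilon).
have := ler_wpM2l (ltW l0) e2; rewrite /potential; move: (kappa / p * _) => z.
lra.
Qed.

Lemma coercive (K : R) : 0 <= K -> exists A : R, forall u, H10 Omega u -> J u <= K ->
  (forall v, H10 Omega v -> `|first_variation u v| <= K * H1_norm Omega v) ->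
  H1_norm Omega u <= A.
Proof.
move=> K0; have p2 := crit_gt2; have n3' := dim_ge3; have [Cp Cp0 hCp] := poincare.
set m := fine (mu Omega); have m0 : 0 <= m by exact: fine_ge0.
pose r := kappa / n%:R / 2; have r0 : 0 < r by rewrite !divr_gt0//; lra.
(* The cutoff error then has coefficient r, half of kappa / n, and is absorbed on the left. *)
pose d := r / ((kappa + lambda) / 2); have d0 : 0 < d by rewrite divr_gt0// divr_gt0// addr_gt0.
have dr : d * ((kappa + lambda) / 2) = r.
  by rewrite /d divfK// gt_eqF// divr_gt0// addr_gt0.
have kp : 0 <= kappa / p by rewrite ltW// divr_gt0//; lra.
have l2 : 0 <= lambda / 2 by rewrite divr_ge0// ltW.
have [A hA] := coercive_system K0 m0 r0 l2 kp Cp0.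
have rE : kappa / n%:R = r * 2 by rewrite divfK.
exists A => u hu Ju Du; have [hc _ nc] := cutoff_H10 d0 hu.
have := energy_bound d0 hu; rewrite dr -/m.
have ie := excess_powR_rintegrable hu; set q := Rintegral _ _ (fun x => excess _ `^ p).
have q0 : 0 <= q by apply: Rintegral_ge0 => x _; exact: powR_ge0.
have N0 := H1_norm_ge0 u; have := H1_norm_sqr (H10_H1 hu); have := hCp _ hu.
have D0 := dirichlet_ge0 u.
have fv : - first_variation u (fun x => cutoff d (u x)) <= K * H1_norm Omega u.
  apply: le_trans (ler_norm _) _; rewrite normrN; apply: le_trans (Du _ hc) _.
  by rewrite ler_wpM2l.
have JE := functionalE hu.
have i1 : rintegrable mu Omega (fun=> 1) by exact: rintegrable_cst.
have PE : - (lambda / 2 * (m + q) + kappa / p * q) <= I (fun x => potential (u x)).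
  have i1e := rintegrableD mOm i1 ie.
  have iz1 := rintegrableZ mOm (lambda / 2) i1e; have iz2 := rintegrableZ mOm (kappa / p) ie.
  have -> : - (lambda / 2 * (m + q) + kappa / p * q) =
      I (fun x => - (lambda / 2 * (1 + excess (u x) `^ p) + kappa / p * excess (u x) `^ p)).
    rewrite (_ : (fun x => - _) = fun x => -1 * (lambda / 2 * (1 + excess (u x) `^ p) + kappa / p * excess (u x) `^ p)); last first.
      by apply/funext => x; rewrite mulN1r.
    rewrite (RintegralZl (-1) mOm (rintegrableD mOm iz1 iz2)) (RintegralD mOm iz1 iz2).
    rewrite (RintegralZl _ mOm i1e) (RintegralZl _ mOm ie) (RintegralD mOm i1 ie).
    by rewrite Rintegral_cst// mul1r mulN1r.
  apply: le_Rintegral => //; last by move=> x _; exact: potential_floor.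
  - exact: (rintegrableN mOm (rintegrableD mOm iz1 iz2)).
  - exact: potential_rintegrable.
rewrite rE => hU hN hE; exact: (hA q _ _ _ _ _ _ N0 fv JE PE Ju hU hN hE).
Qed.

(** * Concentration is excluded *)

(* If [kappa] is below the threshold, every bounded level is strictly below the
   one at which concentration can occur. *)
Lemma critical_gap (M : R) : 0 < M -> kappa < kappa_star Omega M ->
  kappa / S * ((n%:R * (M + fine (mu Omega))) / S) `^ (p / 2 - 1) < 1.
Proof.
move=> M0; have n3' := dim_ge3; have m0 : 0 <= fine (mu Omega) by exact: fine_ge0.
move=> hk0; set m := n%:R * _.
have hk : kappa < (S `^ (n%:R / 2) / m) `^ (p / 2 - 1) by rewrite crit_half; exact: hk0.
have mp : 0 < m by rewrite mulr_gt0 ?ltr_wpDr//; apply: lt_le_trans n3'.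
(* The product of the bases is S^{(n-2)/2}, and p/2 - 1 = 2/(n-2) is the inverse exponent. *)
have E : (S `^ (n%:R / 2) / m) `^ (p / 2 - 1) * (m / S) `^ (p / 2 - 1) = S.
  rewrite -powRM ?divr_ge0 ?powR_ge0 ?(ltW mp) ?(ltW S0)//.
  rewrite (_ : S `^ (n%:R / 2) / m * (m / S) = S `^ (n%:R / 2 - 1)); last first.
    rewrite powRB ?powRr1 ?(ltW S0)//; last by rewrite (gt_eqF S0) implybT.
    by rewrite mulrA divfK// gt_eqF.
  rewrite -powRrM crit_half (_ : (n%:R / 2 - 1) * (2 / (n%:R - 2)) = 1) ?powRr1 ?(ltW S0)//.
  have h2 : n%:R - 2 != 0 :> R by rewrite gt_eqF//; lra.
  by move: (n%:R : R) h2 => N h2; field.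
have rp' : 0 < (m / S) `^ (p / 2 - 1) by rewrite powR_gt0// divr_gt0.
have := hk; rewrite -(ltr_pM2r rp') E => h.
by rewrite mulrAC ltr_pdivrMr// mul1r.
Qed.

(* Where both factors are controlled by the fixed function u, their product is
   linear in t up to the tail of u, on which |u| is large. *)
Lemma subcritical_remainder u (C e : R) : H10 Omega u -> 0 <= C -> 0 < e ->
  exists (K : R) (h : V -> R), [/\ 0 <= K, rintegrable mu Omega h, I h < e,
    forall x, 0 <= h x &
    forall x (a t : R), 0 <= a -> 0 <= t -> a <= C * (1 + `|u x|) -> t <= C * (1 + `|u x|) ->
      a `^ (p - 1) * t <= K * t + h x].
Proof.
move=> hu C0 ee; have p2 := crit_gt2; have pp : 0 < p by lra.
have p0 : 0 <= p by lra.
have su := H10_sq hu; have [mu_ _] := su.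
pose b x := C * (1 + `|u x|); have b0 x : 0 <= b x by rewrite mulr_ge0// addr_ge0.
have mb : measurable_fun Omega b.
  by apply: measurable_funM => //; apply: measurable_funD => //; apply: measurableT_comp.
pose f x := b x `^ p.
have mf : measurable_fun Omega f by exact: measurable_powR_comp.
have i1 : rintegrable mu Omega (fun=> 1) by exact: rintegrable_cst.
have jf : rintegrable mu Omega f.
  apply: (rintegrable_le mOm mf _ (rintegrableZ mOm (C `^ p * 2 `^ p) (rintegrableD mOm i1 (sobolev_integrable hu)))).
  move=> x _; rewrite ger0_norm ?powR_ge0// /f /b powRM ?addr_ge0// -mulrA ler_wpM2l ?powR_ge0//.
  by have := powR_add_le p0 (@ler01 R) (normr_ge0 (u x)); rewrite powR1.
have f0 x : Omega x -> 0 <= f x by move=> _; exact: powR_ge0.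
have [K K0 hK] := tail_small mOm jf f0 ee.
have mh : measurable_fun Omega (fun x => f x * (K < f x)%R%:R).
  apply: measurable_funM => //.
  rewrite (_ : (fun _ => _) = (fun c : bool => c%:R : R) \o (fun x => K < f x)) //.
  apply: measurableT_comp => //.
  by apply: measurable_fun_ltr.
have h0 x : 0 <= f x * (K < f x)%R%:R by rewrite mulr_ge0 ?powR_ge0// ler0n.
exists (1 + K), (fun x => f x * (K < f x)%R%:R); split => //.
- by rewrite addr_ge0// ltW.
- apply: (rintegrable_le mOm mh _ jf) => x _; rewrite ger0_norm//.
  by case: (K < f x); rewrite ?mulr1// mulr0 powR_ge0.
move=> x a t a0 t0 ab tb.
have p1 : 0 <= p - 1 by lra.
have a1 : a `^ (p - 1) <= b x `^ (p - 1) by rewrite (ge0_ler_powR p1) ?nnegrE.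
(* Above the threshold the product is at most b^p = f, the tail. Below it, b^{p-1} <= 1 + b^p <= 1 +
   K leaves a bound linear in [t]. *)
case: (ltrP K (f x)) => fK.
  rewrite mulr1 /f -(mulr_powRB1 (b0 x) pp) mulrC.
  apply: le_trans (_ : b x * b x `^ (p - 1) <= _).
    by apply: ler_pM => //; exact: powR_ge0.
  by rewrite lerDr mulr_ge0// addr_ge0// ltW.
rewrite mulr0 addr0 ler_wpM2r//; apply: le_trans a1 _.
apply: le_trans (powR_le1D (p := p) p1 _ (b0 x)) _; first lra.
by rewrite lerD2l.
Qed.

Lemma sum_three_errors (x j f m e M : R) : x <= j - 2^-1 * f + m + e -> - f <= e -> j <= M + e ->
  0 <= e -> x <= M + m + 3 * e.
Proof. lra. Qed.

Section concentration.
Variables (v_ : nat -> V -> R) (u : V -> R) (A M : R) (d : nat -> R).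
Hypotheses (hv : forall k, H10 Omega (v_ k)) (hu : H10 Omega u).
Hypothesis vA : forall k, H1_norm Omega (v_ k) <= A.
Hypothesis vu : I (fun x => (u x - v_ k x) ^+ 2) @[k --> \oo] --> 0.
Hypothesis dv : forall k f, H10 Omega f -> `|first_variation (v_ k) f| <= d k * H1_norm Omega f.
Hypothesis d0 : d @ \oo --> 0.
Hypothesis JM : forall e, 0 < e -> \forall k \near \oo, J (v_ k) <= M + e.
Hypotheses (M0 : 0 < M) (kM : kappa < kappa_star Omega M).
Let w k x := v_ k x - u x.
Let X k := dirichlet (w k) (w k).
Let Y k := I (fun x => excess (v_ k x) `^ (p - 1) * w k x).
Let m := fine (mu Omega).

Lemma squeeze0 (f g : nat -> R) (C : R) : (forall k, `|f k| <= C * g k) -> g @ \oo --> 0 -> f @ \oo --> 0.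
Proof.
move=> fg g0; apply/norm_cvg0P; apply: (@cvg0_le _ _ (fun k => C * g k)).
  by move=> k; rewrite normr_ge0 fg.
by rewrite -[X in _ --> X](mulr0 C); apply: cvgMr.
Qed.

Lemma diff_H10 k : H10 Omega (w k). Proof. exact: (H10B (hv k) hu). Qed.

Lemma diff_l2 : l2norm mu Omega (w k) @[k --> \oo] --> 0.
Proof.
have E k : l2norm mu Omega (w k) = Num.sqrt (I (fun x => (u x - v_ k x) ^+ 2)).
  by congr Num.sqrt; apply: eq_Rintegral => x _; rewrite -sqrrN opprB.
rewrite (funext E) -(@sqrtr0 R).
exact: (cvg_comp _ _ vu (@sqrt_continuous R 0)).
Qed.

Lemma bound_ge0 : 0 <= A.
Proof. by apply: le_trans (vA 0); exact: H1_norm_ge0. Qed.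

Lemma diff_bound k : H1_norm Omega (w k) <= A + H1_norm Omega u.
Proof.
have hN := H10Z (-1) hu.
have -> : w k = fun x => v_ k x + -1 * u x by apply/funext => x; rewrite mulN1r.
apply: le_trans (H1_normD (H10_H1 (hv k)) (H10_H1 hN)) _.
by rewrite (H1_normZ _ (H10_H1 hu)) normrN1 mul1r lerD2r.
Qed.

Lemma diff_dirichlet k : X k <= (A + H1_norm Omega u) ^+ 2.
Proof.
apply: le_trans (H1_norm_dirichlet (H10_H1 (diff_H10 k))) _.
by rewrite lerXn2r ?nnegrE ?H1_norm_ge0 ?diff_bound// addr_ge0 ?bound_ge0 ?H1_norm_ge0.
Qed.

Lemma diff_l1 : I (fun x => `|w k x|) @[k --> \oo] --> 0.
Proof.
apply: (@cvg0_le _ _ (fun k => l2norm mu Omega (w k) * Num.sqrt m)).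
  move=> k; rewrite Rintegral_ge0//=.
  exact: (rint_norm_l2norm mOm fOm (H10_sq (diff_H10 k))).
by rewrite -[X in _ --> X](mul0r (Num.sqrt m)); apply: cvgMl; exact: diff_l2.
Qed.

(** Test the derivative at v_k with w_k and write D(v_k, w_k) = X_k + D(u, w_k). The cross term
    vanishes by [dirichlet_weak], the [beta] term by L^1 convergence, the lambda term by L^2
    convergence. *)
Lemma diff_energy : X k - kappa * Y k @[k --> \oo] --> 0.
Proof.
have E k : X k - kappa * Y k = first_variation (v_ k) (w k)
    - epsilon^-1 * I (fun x => beta ((v_ k x - 1) / epsilon) * w k x)
    + lambda * I (fun x => excess (v_ k x) * w k x) - dirichlet u (w k).
  have hw := diff_H10 k; rewrite /first_variation.
  have [_ ->] := potential'_rintegrable (hv k) hw.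
  have := dirichletBl (H10_H1 (hv k)) (H10_H1 hu) (H10_H1 hw).
  rewrite -/(X k) -/(Y k) => ->; ring.
rewrite (funext E) -[X in _ --> X](subr0 0) -[X in X - _](addr0 0) -[X in X + _ - _](subr0 0).
apply: cvgB; last first.
  apply: (dirichlet_weak hu diff_H10 diff_dirichlet).
  rewrite (_ : (fun k => _) = fun k => I (fun x => (u x - v_ k x) ^+ 2))//.
  by apply/funext => k; apply: eq_Rintegral => x _; rewrite -sqrrN opprB.
apply: cvgD; first apply: cvgB.
- have dn : (fun k => `|d k|) @ \oo --> 0 by apply/norm_cvg0P.
  apply: (@squeeze0 _ (fun k => `|d k|) (A + H1_norm Omega u)) => // k.
  apply: le_trans (dv _ (diff_H10 k)) _; apply: le_trans (_ : `|d k| * H1_norm Omega (w k) <= _).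
    by rewrite ler_wpM2r ?H1_norm_ge0// ler_norm.
  by rewrite mulrC ler_wpM2r// diff_bound.
- rewrite -[X in _ --> X](mulr0 epsilon^-1); apply: cvgMr.
  apply: (squeeze0 (C := 2) _ diff_l1) => k.
  have hw := diff_H10 k; have iw := square_integrable_rintegrable mOm fOm (H10_sq hw).
  have ib := beta_rintegrable (hv k) hw.
  apply: le_trans (le_normr_Rintegral mOm ib) _.
  rewrite -(RintegralZl 2 mOm (rintegrable_norm iw)); apply: le_Rintegral => //.
  - exact: (rintegrable_norm ib).
  - exact: (rintegrableZ mOm 2 (rintegrable_norm iw)).
  move=> x _; have /andP[b1 b2] := beta02 ((v_ k x - 1) / epsilon).
  by rewrite normrM (ger0_norm b1) ler_wpM2r.
rewrite -[X in _ --> X](mulr0 lambda); apply: cvgMr.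
apply: (squeeze0 (C := A) _ diff_l2) => k.
have hw := diff_H10 k; have su := excess_sq (H10_sq (hv k)).
apply: le_trans (rint_norm_le mOm su (H10_sq hw)) _.
rewrite ler_wpM2r ?l2norm_ge0//; apply: le_trans (vA k).
rewrite (H1_normE (H10_H1 (hv k))) ler_wsqrtr//.
apply: le_trans (_ : I (fun x => v_ k x ^+ 2) <= _); last by rewrite lerDl dirichlet_ge0.
apply: le_Rintegral => //; [exact: su.2|exact: (H10_sq (hv k)).2|] => x _.
by rewrite -(real_normK (num_real (v_ k x))) lerXn2r ?nnegrE ?excess_ge0// excess_le.
Qed.

(** Common source of both upper bounds on [Y]. Where the first alternative fails,
    [subcritical_remainder] gives K |w_k| + h: the first tends to 0 in L^1, the second has small
    integral. Points where w_k <= 0 or the excess is 0 contribute nothing positive. *)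
Lemma nonlinear_term_le (z : nat -> V -> R) (C theta e : R) : 0 <= C -> 0 <= theta -> 0 < e ->
  (forall k, rintegrable mu Omega (z k)) -> (forall k x, 0 <= z k x) ->
  (forall k x, 0 < excess (v_ k x) -> 0 < w k x ->
    excess (v_ k x) `^ (p - 1) * w k x <= theta * z k x \/
    (excess (v_ k x) <= C * (1 + `|u x|) /\ w k x <= C * (1 + `|u x|))) ->
  \forall k \near \oo, Y k <= theta * I (z k) + e.
Proof.
move=> C0 t0 ee iz z0 hz; have p2 := crit_gt2.
have e2 : 0 < e / 2 by rewrite divr_gt0.
have [K [h [K0 ih he h0 hh]]] := subcritical_remainder hu C0 e2.
have K1 : 0 < K + 1 by rewrite ltr_wpDl.
have : \forall k \near \oo, I (fun x => `|w k x|) < e / 2 / (K + 1).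
  have /cvgrPdist_lt/(_ _ (divr_gt0 e2 K1)) := diff_l1; apply: filterS => k.
  by rewrite sub0r normrN; apply: le_lt_trans; exact: ler_norm.
apply: filterS => k hk; have hw := diff_H10 k.
have iw := rintegrable_norm (square_integrable_rintegrable mOm fOm (H10_sq hw)).
have j1 := rintegrableZ mOm theta (iz k); have j2 := rintegrableZ mOm K iw.
have j12 := rintegrableD mOm j1 j2; have j := rintegrableD mOm j12 ih.
have : Y k <= I (fun x => theta * z k x + K * `|w k x| + h x).
  apply: (le_Rintegral mOm (excess_pred_rintegrable (hv k) hw) j).
  move=> x _; have a0 := excess_ge0 (v_ k x).
  have r1 : 0 <= theta * z k x by rewrite mulr_ge0.
  have r2 : 0 <= K * `|w k x| by rewrite mulr_ge0.
  have r3 := h0 x.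
  case: (lerP (w k x) 0) => w0.
    apply: le_trans (_ : 0 <= _); last by rewrite !addr_ge0.
    by rewrite mulr_ge0_le0// powR_ge0.
  move: a0; rewrite le_eqVlt => /predU1P[a0|a0].
    by rewrite -a0 powR0 ?mul0r ?addr_ge0//; rewrite gt_eqF//; lra.
  have [h1|[h1 h2]] := hz k x a0 w0.
    by apply: le_trans h1 _; rewrite -addrA lerDl addr_ge0.
  apply: le_trans (hh x _ _ (ltW a0) (ltW w0) h1 h2) _.
  by rewrite (gtr0_norm w0) -addrA lerDr.
move/le_trans; apply.
rewrite (RintegralD mOm j12 ih) (RintegralD mOm j1 j2) (RintegralZl _ mOm (iz k)) (RintegralZl _ mOm iw).
have hK : K * I (fun x => `|w k x|) <= e / 2.
  apply: le_trans (_ : (K + 1) * I (fun x => `|w k x|) <= _).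
    by rewrite ler_wpM2r ?lerDl// Rintegral_ge0.
  by rewrite mulrC -ler_pdivlMr// ltW.
by rewrite -addrA lerD2l (splitr e) lerD// ltW.
Qed.

(* Brezis-Lieb type comparison: where v - u is not the dominant part of v, the
   remainder lemma applies. *)
Lemma diff_concentration (theta e : R) : 1 < theta -> 0 < e ->
  \forall k \near \oo, Y k <= theta * I (fun x => `|w k x| `^ p) + e.
Proof.
move=> t1 ee; have p2 := crit_gt2; have pp : 0 < p by lra.
have p1 : 0 < p - 1 by lra.
(* The power p - 1 turns the pointwise comparison constant [t] into [theta]. *)
pose t := theta `^ (p - 1)^-1.
have tp : t `^ (p - 1) = theta.
  by rewrite -powRrM mulVf ?gt_eqF// powRr1//; lra.
have t2 : 1 < t.
  have : 1 `^ (p - 1)^-1 < t.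
    by apply: gt0_ltr_powR; rewrite ?nnegrE ?invr_gt0//; lra.
  by rewrite powR1.
have tt : 0 < t - 1 by lra.
have c0 : 0 <= (t - 1)^-1 by rewrite invr_ge0 ltW.
apply: (@nonlinear_term_le _ (1 + (t - 1)^-1)) => //; first by rewrite addr_ge0.
- lra.
- by move=> k; exact: sobolev_integrable (diff_H10 k).
move=> k x a0 w0; rewrite (gtr0_norm w0).
have n0 := normr_ge0 (u x); have nu := ler_norm (u x).
have aw : excess (v_ k x) <= w k x + `|u x|.
  have [[_ ->]|[_ ->]] := excessE (v_ k x); first by rewrite /w; lra.
  by rewrite addr_ge0// ltW.
case: (lerP (excess (v_ k x)) (t * w k x)) => ha; [left|right].
  rewrite -(mulr_powRB1 (ltW w0) pp) mulrCA [leRHS]mulrC ler_pM2r// -tp.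
  rewrite -powRM ?(ltW w0)//; last lra.
  by rewrite (ge0_ler_powR (ltW p1)) ?nnegrE ?(ltW a0)// mulr_ge0 ?(ltW w0)//; lra.
(* Here t w_k < excess <= w_k + |u|, so w_k, and with it the excess, is controlled by |u|. *)
have hw : w k x <= (t - 1)^-1 * `|u x|.
  rewrite mulrC ler_pdivlMr//; lra.
have c1 : (t - 1)^-1 * `|u x| <= (1 + (t - 1)^-1) * (1 + `|u x|) - `|u x|.
  by move: (t - 1)^-1 c0 => c c0; nra.
split; lra.
Qed.

(** Where w_k > theta (v_k - 1)_+, the bound w_k <= (v_k - 1)_+ + 1 + |u| gives (theta - 1) w_k <=
    theta (1 + |u|): both factors are controlled by u. *)
Lemma diff_excess (theta e : R) : 1 < theta -> 0 < e ->
  \forall k \near \oo, Y k <= theta * I (fun x => excess (v_ k x) `^ p) + e.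
Proof.
move=> t1 ee; have p2 := crit_gt2; have pp : 0 < p by lra.
have tt : 0 < theta - 1 by lra.
have c0 : 0 <= theta / (theta - 1) by rewrite divr_ge0//; lra.
apply: (@nonlinear_term_le _ (theta / (theta - 1))) => //.
- lra.
- by move=> k; exact: (excess_powR_rintegrable (hv k)).
- by move=> k x; exact: powR_ge0.
move=> k x a0 w0.
have nu := ler_norm (- u x); rewrite normrN in nu.
case: (lerP (w k x) (theta * excess (v_ k x))) => ha; [left|right].
  rewrite -(mulr_powRB1 (ltW a0) pp) mulrCA [leRHS]mulrCA [excess _ * _]mulrC mulrCA ler_wpM2l// ?powR_ge0//.
have wE : w k x <= excess (v_ k x) + 1 + `|u x|.
  have [[_ ->]|[h1 h2]] := excessE (v_ k x); first by rewrite /w; lra.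
  by move: a0; rewrite h2 ltxx.
have hw : w k x <= theta / (theta - 1) * (1 + `|u x|).
  rewrite mulrAC ler_pdivlMr//; nra.
split => //; apply: le_trans hw; apply: ltW; apply: le_lt_trans ha.
by rewrite ler_peMl ?(ltW a0)// ltW.
Qed.

(** [energy_bound] along the sequence. The integrals of the excess are bounded by [Q] uniformly in
    k, so one small cutoff parameter serves for all k. *)
Lemma excess_energy (e : R) : 0 < e ->
  \forall k \near \oo, kappa * I (fun x => excess (v_ k x) `^ p) <= n%:R * (M + m) + e.
Proof.
move=> ee; have p2 := crit_gt2; have n3' := dim_ge3; have m0 : 0 <= m by exact: fine_ge0.
have np : 0 < n%:R :> R by apply: lt_le_trans n3'.
have A0 := bound_ge0.
pose Q := (A ^+ 2 / S) `^ (p / 2).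
have Q0 : 0 <= Q by exact: powR_ge0.
have hQ k : I (fun x => excess (v_ k x) `^ p) <= Q.
  apply: (@le_trans _ _ (I (fun x => `|v_ k x| `^ p))).
    apply: (le_Rintegral mOm (excess_powR_rintegrable (hv k)) (sobolev_integrable (hv k))) => x _.
    have p0 : 0 <= p by lra.
    by rewrite (ge0_ler_powR p0) ?nnegrE ?excess_ge0// excess_le.
  apply: le_trans (sobolev_power (hv k)) _; have ph : 0 <= p / 2 by lra.
  rewrite (ge0_ler_powR ph) ?nnegrE ?divr_ge0 ?dirichlet_ge0 ?sqr_ge0 ?(ltW S0)//.
  rewrite ler_pM2r ?invr_gt0//; apply: le_trans (H1_norm_dirichlet (H10_H1 (hv k))) _.
  by rewrite lerXn2r ?nnegrE ?H1_norm_ge0.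
(* The errors come from the level of J, the derivative and the cutoff; multiplying by n turns 3 e1
   into e. *)
pose e1 := e / n%:R / 3; have e10 : 0 < e1 by rewrite !divr_gt0.
have kl : 0 < (kappa + lambda) / 2 by rewrite divr_gt0// addr_gt0.
have mQ : 0 < m + Q + 1 by rewrite ltr_wpDl// addr_ge0.
pose t := e1 / ((kappa + lambda) / 2) / (m + Q + 1).
have t0 : 0 < t by rewrite /t divr_gt0// divr_gt0.
have A1 : 0 < A + 1 by rewrite ltr_wpDl.
have : \forall k \near \oo, `|d k| < e1 / (A + 1).
  have /cvgrPdist_lt/(_ _ (divr_gt0 e10 A1)) := d0.
  by apply: filterS => k; rewrite sub0r normrN.
apply: filterS2 (JM e10) => k Jk dk.
have [hc _ nc] := cutoff_H10 t0 (hv k).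
have := energy_bound t0 (hv k).
have hd : - first_variation (v_ k) (fun x => cutoff t (v_ k x)) <= e1.
  apply: le_trans (ler_norm _) _; rewrite normrN; apply: le_trans (dv _ hc) _.
  apply: le_trans (_ : `|d k| * (A + 1) <= _); last by rewrite -ler_pdivlMr// ltW.
  apply: le_trans (_ : `|d k| * H1_norm Omega (fun x => cutoff t (v_ k x)) <= _).
    by rewrite ler_wpM2r ?H1_norm_ge0// ler_norm.
  by rewrite ler_wpM2l//; apply: le_trans nc _; apply: le_trans (vA k) _; rewrite lerDl.
have hq := hQ k; set q := Rintegral _ _ _ in hq *.
have tE : t * ((kappa + lambda) / 2) * (m + q) <= e1.
  have -> : t * ((kappa + lambda) / 2) = e1 / (m + Q + 1) by rewrite /t mulrAC divfK ?gt_eqF.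
  rewrite mulrAC ler_pdivrMr// ler_pM2l//.
  by rewrite -addrA lerD2l; apply: le_trans hq _; rewrite lerDl.
have nE : n%:R * (3 * e1) = e by rewrite /e1; field; rewrite gt_eqF.
move=> h.
have h3 : kappa / n%:R * q <= M + m + 3 * e1.
  move: (J _) (first_variation _ _) h hd Jk tE => j f h hd Jk tE.
  exact: (sum_three_errors (le_trans h (lerD (lexx _) tE)) hd Jk (ltW e10)).
have := ler_wpM2l (ltW np) h3; rewrite mulrDr nE.
by rewrite mulrA mulrCA divff ?gt_eqF// mulr1.
Qed.

(** The first bound on [Y] keeps X_k below theta N (M + |Omega|). Inserted in the factor
    (X_k/S)^{p/2 - 1} of the Sobolev bound, this gives X_k <= rho' X_k + o(1) with rho' < 1. *)
Lemma diff_dirichlet_cvg : X k @[k --> \oo] --> 0.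
Proof.
have p2 := crit_gt2; have n3' := dim_ge3; have m0 : 0 <= m by exact: fine_ge0.
pose m1 := n%:R * (M + m).
have m1p : 0 < m1 by rewrite mulr_gt0 ?ltr_wpDr//; apply: lt_le_trans n3'.
pose r := p / 2 - 1; have r0 : 0 < r by rewrite /r; lra.
have r1 : 0 < 1 + r by lra.
have gap : kappa / S * (m1 / S) `^ r < 1 by exact: critical_gap M0 kM.
set rho := kappa / S * (m1 / S) `^ r in gap.
have rho0 : 0 <= rho by rewrite mulr_ge0 ?powR_ge0// divr_ge0// ltW.
have rho1 : 0 < 1 + rho by lra.
(* In total [theta] enters with exponent 1 + r; this choice makes rho' = 2 rho / (1 + rho), still
   less than 1. *)
pose theta := (2 / (1 + rho)) `^ (1 + r)^-1.
have tE : theta * theta `^ r = 2 / (1 + rho).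
  rewrite -[in LHS](_ : 1 + r - 1 = r); last by ring.
  rewrite mulr_powRB1 ?powR_ge0// -powRrM mulVf ?gt_eqF// powRr1//.
  by rewrite divr_ge0// ltW.
have t1 : 1 < theta.
  have : 1 `^ (1 + r)^-1 < theta.
    apply: gt0_ltr_powR; rewrite ?nnegrE ?invr_gt0//; first by rewrite divr_ge0// ltW.
    by rewrite ltr_pdivlMr//; lra.
  by rewrite powR1.
pose rho' := 2 / (1 + rho) * rho.
have rho'1 : 0 < 1 - rho' by rewrite subr_gt0 /rho' mulrAC ltr_pdivrMr//; lra.
have c1 (e : R) : 0 < e -> \forall k \near \oo, X k <= kappa * Y k + e.
  move=> ee; have /cvgrPdist_lt/(_ _ ee) := diff_energy; apply: filterS => k.
  rewrite sub0r normrN => h; have := le_lt_trans (ler_norm _) h.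
  by rewrite ltrBlDl => /ltW.
have c2 : \forall k \near \oo, X k <= theta * m1.
  (* A factor strictly between 1 and [theta] leaves room for the errors: they add up to (t2 + kappa
     + 1) e, which is the gap (theta - t2) m1. *)
  pose t2 := (1 + theta) / 2; have t21 : 1 < t2 by rewrite /t2; lra.
  have D0 : 0 < t2 + kappa + 1 by rewrite addr_gt0// addr_gt0//; lra.
  pose e := (theta - t2) * m1 / (t2 + kappa + 1).
  have ee : 0 < e by rewrite divr_gt0// mulr_gt0// /t2; lra.
  have eE : e * (t2 + kappa + 1) = (theta - t2) * m1 by rewrite divfK// gt_eqF.
  apply: filterS3 (c1 _ ee) (diff_excess t21 ee) (excess_energy ee) => k.
  rewrite -/m1; move: (X k) (Y k) (Rintegral _ _ _) => x y q h1 h2 h3.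
  have h4 := ler_wpM2l (ltW k0) h2.
  have t20 : 0 <= t2 by lra.
  have h5 := ler_wpM2l t20 h3.
  clearbody e t2 m1 theta; move: kappa h4 h5 h1 eE => K h4 h5 h1 eE; lra.
apply/cvgrPdist_le => e ee.
(* Chosen so that (1 - rho') X_k <= (kappa + 1) e' reads X_k <= e. *)
pose e' := e * (1 - rho') / (kappa + 1).
have k1 : 0 < kappa + 1 by rewrite addr_gt0.
have ee' : 0 < e' by rewrite divr_gt0// mulr_gt0.
have eE : e' * (kappa + 1) = e * (1 - rho') by rewrite divfK// gt_eqF.
apply: filterS3 (c1 _ ee') c2 (diff_concentration t1 ee') => k h1 h2 h3.
have X0 : 0 <= X k by exact: dirichlet_ge0.
rewrite sub0r normrN ger0_norm// -(ler_pM2r rho'1) -eE.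
have h4 := sobolev_power (diff_H10 k); rewrite -/(X k) in h4.
have XS : 0 <= X k / S by rewrite divr_ge0// ltW.
have tt0 : 0 <= theta by lra.
have h5 : (X k / S) `^ (p / 2) <= X k / S * (theta `^ r * (m1 / S) `^ r).
  have ph : 0 < p / 2 by lra.
  have mS : 0 <= m1 / S by rewrite divr_ge0 ?(ltW m1p) ?(ltW S0).
  rewrite -(mulr_powRB1 XS ph) -/r ler_wpM2l// -powRM//.
  have tmS : 0 <= theta * (m1 / S) by rewrite mulr_ge0.
  rewrite (ge0_ler_powR (ltW r0)) ?nnegrE//.
  by rewrite [leRHS]mulrA ler_pM2r ?invr_gt0.
have h6 := ler_wpM2l tt0 (le_trans h4 h5).
have h7 : kappa * (theta * (X k / S * (theta `^ r * (m1 / S) `^ r))) = rho' * X k.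
  rewrite /rho' -tE /rho; ring.
have h8 := ler_wpM2l (ltW k0) (le_trans h3 (lerD h6 (lexx e'))).
rewrite mulrDr h7 in h8.
move: h1 h8; move: (X k) (Y k) => x y h1 h8.
clearbody e' rho'; move: kappa h1 h8 => K h1 h8; lra.
Qed.

Lemma diff_H1_cvg : H1_norm Omega (w k) @[k --> \oo] --> 0.
Proof.
have E k : H1_norm Omega (w k) = Num.sqrt (I (fun x => (u x - v_ k x) ^+ 2) + X k).
  rewrite (H1_normE (H10_H1 (diff_H10 k))); congr (Num.sqrt (_ + _)).
  by apply: eq_Rintegral => x _; rewrite -sqrrN opprB.
have c : I (fun x => (u x - v_ k x) ^+ 2) + X k @[k --> \oo] --> 0.
  by rewrite -[X in _ --> X](addr0 0); apply: cvgD; [exact: vu|exact: diff_dirichlet_cvg].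
rewrite (funext E) -(@sqrtr0 R).
exact: (cvg_comp _ _ c (@sqrt_continuous R 0)).
Qed.

End concentration.

(** * Subsequences and the conclusion *)

Lemma subsequence_cvg (s : nat -> nat) (f : nat -> R) (l : R) : (forall k, (s k < s k.+1)%N) ->
  f @ \oo --> l -> f (s k) @[k --> \oo] --> l.
Proof.
move=> hs fl; apply: (cvg_comp s f _ fl) => P [N _ hN].
by exists N => // k /= Nk; apply: hN => /=; apply: leq_trans Nk (strict_mono_ge hs k).
Qed.

Lemma cvg_bound (f : nat -> R) (l : R) : f @ \oo --> l -> exists K : R, forall j, `|f j| <= K.
Proof.
move=> fl; have [K [_ hK]] := cvg_seq_bounded (cvgP _ fl).
by exists (K + 1) => j; apply: hK => //; rewrite ltrDl.
Qed.

Lemma palais_smale_functional (M c : R) : 0 < M -> kappa < kappa_star Omega M -> c <= M ->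
  palais_smale Omega J c.
Proof.
move=> M0 kM cM u_ dJ hu hJ hdJ hd.
have fv j v : H10 Omega v ->
    `|first_variation (u_ j) v| <= dual_norm Omega (dJ j) * H1_norm Omega v.
  move=> hv; rewrite -(frechet_first_variation (hu j) (hdJ j) hv).
  exact: (dual_norm_bound (hdJ j).1 hv).
have [K1 K1P] := cvg_bound hJ; have [K2 K2P] := cvg_bound hd.
pose K := Num.max K1 K2.
have K0 : 0 <= K by rewrite le_max (le_trans _ (K1P 0)).
have [A hA] := coercive K0.
have uA j : H1_norm Omega (u_ j) <= A.
  apply: hA => //.
    by apply: le_trans (ler_norm _) _; rewrite le_max K1P.
  move=> v hv; apply: le_trans (fv j v hv) _; rewrite ler_wpM2r ?H1_norm_ge0//.
  by apply: le_trans (ler_norm _) _; rewrite le_max K2P orbT.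
have [s [u [hs hv vu]]] := H10_precompact hu uA.
exists s, u; split => //.
have JM e : 0 < e -> \forall k \near \oo, J (u_ (s k)) <= M + e.
  move=> ee; have /cvgrPdist_lt/(_ _ ee) := subsequence_cvg hs hJ; apply: filterS => k.
  rewrite distrC => h; have := le_lt_trans (ler_norm _) h; rewrite ltrBlDl => /ltW h'.
  by apply: le_trans h' _; rewrite lerD2r.
exact: (diff_H1_cvg (fun k => hu (s k)) hv (fun k => uA (s k)) vu
  (fun k => fv (s k)) (subsequence_cvg hs hd) JM M0 kM).
Qed.

End sobolev_space.

Theorem proposition1p4 (R : realType) (N : nat) (Omega : set 'rV[R]_N)
    (beta : R -> R) (lambda epsilon M kappa : R) :
  (3 <= N)%N ->
  bounded_domain Omega ->
  C2_boundary Omega ->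
  smooth_bump beta ->
  0 < lambda ->
  0 < epsilon ->
  0 < M ->
  0 < kappa ->
  kappa < kappa_star Omega M ->
  forall c : R, c <= M ->
    palais_smale Omega (J_functional Omega beta lambda kappa epsilon) c.
Proof.
move=> n3 [oO _ _ bO] _ hb l0 e0 M0 k0 kM c cM.
have S0 := sobolev_const_gt0 n3 k0 kM; have [L hL] := bump_lipschitz hb.
have [_ b02 b0 _ _] := hb.
exact: (palais_smale_functional oO bO (bump_smooth_step hb) n3 S0 (bump_primitive_derive hb)
  b02 b0 hL (bump_primitive0 hb) l0 k0 e0 M0 kM cM).
Qed.
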